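(* Let $1\le p<\infty$ and let $S=\{a_k\}_{k\in\mathbb{N}}$ be a sequence in the unit ball $\mathbb{B}$ of $\mathbb{C}^2$ which is interpolating for $H^p(\mathbb{B})$. Then for every disc $(\sigma,\phi)$ passing through $S$, with $\sigma=\{\alpha_k\}_{k\in\mathbb{N}}$, the sequence $\sigma$ is interpolating in $A^p(\mathbb{D})$ for $\ell^p_H(S)$; that is, for every $\lambda=\{\lambda_k\}_{k\in\mathbb{N}}\in\ell^p_H(S)$ there is $g\in A^p(\mathbb{D})$ with $g(\alpha_k)=\lambda_k$ for all $k\in\mathbb{N}$.
   Context: $\mathbb{D}$ is the open unit disc of $\mathbb{C}$, $\lambda$ as a measure is Lebesgue area measure on $\mathbb{D}$, and $d\sigma$ as a measure is Lebesgue (surface) measure on $\partial\mathbb{B}$. $H^p(\mathbb{B})$ is the space of holomorphic $f$ on $\mathbb{B}$ with $\|f\|_{H^p(\mathbb{B})}^p:=\sup_{r<1}\int_{\partial\mathbb{B}}|f(r\zeta)|^p\,d\sigma(\zeta)<\infty$. $A^p(\mathbb{D})$ is the space of holomorphic $g$ on $\mathbb{D}$ with $\int_{\mathbb{D}}|g|^p\,d\lambda<\infty$. For $S=\{a_k\}\subset\mathbb{B}\subset\mathbb{C}^2$, $\ell^p_H(S)$ is the space of complex sequences $\lambda=\{\lambda_k\}$ with $\|\lambda\|_{H,p}^p:=\sum_k|\lambda_k|^p(1-|a_k|^2)^2<\infty$. $S$ is interpolating for $H^p(\mathbb{B})$ if there is a constant $C$ such that for every $\lambda\in\ell^p_H(S)$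 there is $f\in H^p(\mathbb{B})$ with $f(a_k)=\lambda_k$ for all $k$ and $\|f\|_{H^p(\mathbb{B})}\le C\|\lambda\|_{H,p}$. A disc passing through $S$ is a pair $(\sigma,\phi)$ where $\sigma=\{\alpha_k\}_{k\in\mathbb{N}}$ is a sequence in $\mathbb{D}$ and $\phi:\mathbb{D}\to\mathbb{B}$ is holomorphic with $\phi(\alpha_k)=a_k$ for all $k$. *)

(* Defs.v *)
From HB Require Import structures.
From mathcomp Require Import all_boot all_order all_algebra complex.
From mathcomp Require Import all_classical all_reals all_analysis.
From mathcomp Require Import measurable_realfun.

Set Implicit Arguments.
Unset Strict Implicit.
Unset Printing Implicit Defensive.

Import Order.TTheory GRing.Theory Num.Theory ComplexField.
Import numFieldNormedType.Exports.

Local Open Scope classical_set_scope.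
Local Open Scope ring_scope.

(* The regular algebra R[i]^o carries the normed module structure of R[i]     *)
(* over itself, so [differentiable] on these types is complex (Frechet)       *)
(* differentiability.                                                         *)
Notation Cplx R := (R[i]^o).
Notation Cplx2 R := (Cplx R * Cplx R)%type.

(* R^2 and R^4 with their Borel sigma-algebras: R[i] has no measurable        *)
(* structure in the library, so integrals are taken in real coordinates.      *)
Notation Real2 R := (measurableTypeR R * measurableTypeR R)%type.
Notation Real4 R := (Real2 R * Real2 R)%type.

Section geometry.
Context {R : realType}.

(* The library norm on R[i] is R[i]-valued and the one on pairs is the        *)
(* maximum norm.                                                              *)
Definition cmod (z : Cplx R) : R := Normc.normc z.

Definition sqnorm (z : Cplx2 R) : R := cmod z.1 ^+ 2 + cmod z.2 ^+ 2.

Definition unit_disc : set (Cplx R) := [set z | cmod z < 1].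

Definition unit_ball : set (Cplx2 R) := [set z | sqnorm z < 1].

Definition unit_sphere : set (Cplx2 R) := [set z | sqnorm z = 1].

Definition to_cplx (x : Real2 R) : Cplx R := (x.1 +i* x.2)%C.

Definition to_cplx2 (x : Real4 R) : Cplx2 R := (to_cplx x.1, to_cplx x.2).

Definition holomorphic_on (V W : normedModType R[i]) (U : set V) (f : V -> W) :=
  forall z, U z -> differentiable f z.

End geometry.

Section lebesgue.
Context {R : realType}.

Definition leb2 : set (Real2 R) -> \bar R :=
  (@lebesgue_measure R \x @lebesgue_measure R)%E.

HB.instance Definition _ := Measure.on leb2.

Let leb2_sigma_finite : sigma_finite [set: Real2 R] leb2.
Proof.
have /sigma_finiteP[F [TF ndF Foo]] := sigma_finiteT (@lebesgue_measure R).
exists (fun n => F n `*` F n).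
  rewrite -setXTT TF predeqE => -[x y]; split.
    move=> [/= [n _ Fnx] [k _ Fky]]; exists (maxn n k) => //; split.
    - by move: x Fnx; exact/subsetPset/ndF/leq_maxl.
    - by move: y Fky; exact/subsetPset/ndF/leq_maxr.
  by move=> [n _ []/= ? ?]; split; exists n.
move=> k; have [? ?] := Foo k.
split; first exact: measurableX.
by rewrite /leb2 product_measure1E// lte_mul_pinfty// ge0_fin_numE.
Qed.

HB.instance Definition _ :=
  Measure_isSigmaFinite.Build _ _ _ leb2 leb2_sigma_finite.

Definition leb4 : set (Real4 R) -> \bar R := (leb2 \x leb2)%E.

HB.instance Definition _ := Measure.on leb4.

End lebesgue.

Section surface_measure.
Context {R : realType}.
Implicit Types x : Real4 R.

Definition sqnorm4 x : R :=
  x.1.1 ^+ 2 + x.1.2 ^+ 2 + (x.2.1 ^+ 2 + x.2.2 ^+ 2).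

Lemma sqnorm_to_cplx2 x : sqnorm (to_cplx2 x) = sqnorm4 x.
Proof.
by rewrite /sqnorm /cmod /= !sqr_sqrtr // addr_ge0 // sqr_ge0.
Qed.

Definition radial x : Real4 R :=
  let c := (Num.sqrt (sqnorm4 x))^-1 in
  ((c * x.1.1, c * x.1.2), (c * x.2.1, c * x.2.2)).

Definition ball4 : set (Real4 R) := [set x | sqnorm4 x < 1].

Let msqr (f : Real4 R -> measurableTypeR R) :
  measurable_fun setT f -> measurable_fun setT (fun x => f x ^+ 2 : R).
Proof. exact: measurable_funX. Qed.

Let m11 : measurable_fun setT (fun x => x.1.1 : measurableTypeR R).
Proof. exact: (measurableT_comp measurable_fst measurable_fst). Qed.

Let m12 : measurable_fun setT (fun x => x.1.2 : measurableTypeR R).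
Proof. exact: (measurableT_comp measurable_snd measurable_fst). Qed.

Let m21 : measurable_fun setT (fun x => x.2.1 : measurableTypeR R).
Proof. exact: (measurableT_comp measurable_fst measurable_snd). Qed.

Let m22 : measurable_fun setT (fun x => x.2.2 : measurableTypeR R).
Proof. exact: (measurableT_comp measurable_snd measurable_snd). Qed.

Lemma measurable_sqnorm4 : measurable_fun [set: Real4 R] sqnorm4.
Proof.
by do 2!apply: measurable_funD; exact: msqr.
Qed.

Lemma measurable_ball4 : measurable ball4.
Proof.
have -> : ball4 = [set: Real4 R] `&` sqnorm4 @^-1` `]-oo, 1[%classic.
  by apply/seteqP; split => x /=; rewrite in_itv /= ?setTI; [|case].
exact: measurable_sqnorm4.
Qed.

Lemma measurable_radial : measurable_fun [set: Real4 R] radial.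
Proof.
have sqnorm4_ge0 x : 0 <= sqnorm4 x by rewrite !addr_ge0 // sqr_ge0.
have mc : measurable_fun setT (fun x => (Num.sqrt (sqnorm4 x))^-1).
  rewrite (_ : (fun _ => _) = (@powR R ^~ (- 2^-1)) \o sqnorm4).
    by apply: measurableT_comp; [exact: measurable_powR
                                |exact: measurable_sqnorm4].
  by apply/funext => x /=; rewrite powRN powR12_sqrt.
by do 2!apply: measurable_fun_pair; exact: measurable_funM.
Qed.

(* Surface measure of the unit sphere of C^2 = R^4 in polar coordinates:      *)
(* [sphere_measure A] is 4 (the real dimension) times the volume of the cone  *)
(* {x | 0 < |x| < 1, x / |x| \in A}. The origin, which [radial] fixes, is     *)
(* Lebesgue-negligible.                                                       *)
Definition sphere_measure : set (Real4 R) -> \bar R :=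
  pushforward (mscale 4%:nng (mrestr leb4 measurable_ball4)) radial.

Let sphere_measure0 : sphere_measure set0 = 0%E.
Proof. by apply: measure0; exact: measurable_radial. Qed.

Let sphere_measure_ge0 A : (0 <= sphere_measure A)%E.
Proof. by apply: measure_ge0; exact: measurable_radial. Qed.

Let sphere_measure_semi_sigma_additive : semi_sigma_additive sphere_measure.
Proof.
by apply: measure_semi_sigma_additive; exact: measurable_radial.
Qed.

HB.instance Definition _ := isMeasure.Build _ _ _ sphere_measure
  sphere_measure0 sphere_measure_ge0 sphere_measure_semi_sigma_additive.

End surface_measure.

Section spaces.
Context {R : realType}.
Implicit Types (p : R) (a : nat -> Cplx2 R) (l : nat -> Cplx R).

Definition Hp_pow p (f : Cplx2 R -> Cplx R) : \bar R :=
  ereal_sup [set (\int[sphere_measure]_(x in to_cplx2 @^-1` unit_sphere)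
                    (cmod (f (r%:C%C *: to_cplx2 x)) `^ p)%:E)%E
            | r in [set r : R | 0 <= r < 1]].

Definition Hp_norm p (f : Cplx2 R -> Cplx R) : \bar R :=
  poweR (Hp_pow p f) p^-1.

(* Elements of the function spaces are total functions whose values off the   *)
(* ball (resp. the disc) are irrelevant.                                      *)
Definition Hp p : set (Cplx2 R -> Cplx R) :=
  [set f | holomorphic_on unit_ball f /\ (Hp_pow p f < +oo)%E].

Definition Ap p : set (Cplx R -> Cplx R) :=
  [set g | holomorphic_on unit_disc g /\
    (\int[leb2]_(x in to_cplx @^-1` unit_disc)
       (cmod (g (to_cplx x)) `^ p)%:E < +oo)%E].

Definition lpH_pow p a l : \bar R :=
  (\sum_(0 <= k <oo) (cmod (l k) `^ p * (1 - sqnorm (a k)) ^+ 2)%:E)%E.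

Definition lpH_norm p a l : \bar R := poweR (lpH_pow p a l) p^-1.

Definition lpH p a : set (nat -> Cplx R) :=
  [set l | (lpH_pow p a l < +oo)%E].

Definition interpolating_Hp p a : Prop :=
  exists C : R, forall l, lpH p a l ->
    exists f, [/\ Hp p f, forall k, f (a k) = l k &
                  (Hp_norm p f <= C%:E * lpH_norm p a l)%E].

Definition disc_through a (alpha : nat -> Cplx R) (phi : Cplx R -> Cplx2 R) :=
  [/\ forall k, unit_disc (alpha k),
      forall z, unit_disc z -> unit_ball (phi z),
      holomorphic_on unit_disc phi &
      forall k, phi (alpha k) = a k].

Definition interpolating_Ap p a (alpha : nat -> Cplx R) : Prop :=
  forall l, lpH p a l -> exists g, Ap p g /\ forall k, g (alpha k) = l k.

End spaces.

(* Main.v *)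
From HB Require Import structures.
Require Import Defs.
From mathcomp Require Import all_boot all_order all_algebra complex.
From mathcomp Require Import all_classical all_reals all_analysis.
From mathcomp Require Import measurable_realfun ring lra.

(** Interpolation in H^p(B) only has to provide, for each l, one function f in
H^p(B) with f (a k) = l k: the interpolating function on the disc is g = f o phi,
since g (alpha k) = f (a k). What has to be proved is that composition with an
arbitrary holomorphic map phi from the disc to the ball of C^2 sends H^p(B) into
A^p(D) ([composition_Ap]). This is a Carleson-type estimate; the following route
uses neither boundary values nor maximal functions.

The one-variable function theory is elementary. Goursat's theorem gives
circle means of holomorphic functions, hence a maximum principle for functions
that are supported from below by real parts of holomorphic ones ([subh_at],
[max_principle]); powers |h|^q with q >= 1/2 are of this kind. Comparing |phi|^2
with 1 - c (1/|w| - 1) yields Hopf's lemma ([hopf]):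
1 - |phi(w)|^2 >= c (1 - |w|^2).
Moreover, sums over N-th roots of unity turn the maximum principle into
sub-mean value properties over rotation invariant sets ([area_submean]) without
parametrizing circles, and, by homogeneity on complex lines through 0, into the
bound of the integral of |f|^p over the shell a <= |x|^2 < b by
(b^2 - a^2) M / 4, where M is the p-th power of the H^p norm ([shell_bound]).

For z in the ball and a thin shell close to the sphere let the cap at z be the
part of the shell where |<x, z> - |z|^2| < d |z|, with d = (1 - |z|) / 2. Slicing
it by the complex line of z and the discs orthogonal to it shows that
u = |f|^(p/2) satisfies the sub-mean value property over caps ([ball_submean]).
With z = phi(w) this says c0 |f(phi(w))|^(p/2) <= int Q(w, x) u(x) dx, where
Q(w, x) is d^-2 on the cap and 0 elsewhere. It remains to bound the operator with
kernel Q from L^2 of the shell to L^2 of the disc, which is done by Schur's test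
([schur_test]) with the weight s(w) = (1 - |w|^2)^(-1/2) on the disc and the
weight int Q(w, x) s(w) dw on the shell. The test asks for a bound of
int int Q(w, x) Q(w', x) s(w') dx dw' by a multiple of s(w). Caps that meet are as
close as they are large, so the integral in x is at most a multiple of
|1 - <phi(w'), phi(w)>|^-2 ([cap_kernel_overlap]). For w fixed this is |F(w')|^2
with F = 1 / (1 - <phi, phi(w)>) holomorphic of positive real part; on the layer
4^-(k+1) < 1 - |w'|^2 <= 4^-k Hopf's lemma bounds |F|, and then
|F|^2 <= Re (2 B F - F^2) has an explicit mean ([layer_kernel_le]). Summing over
the layers gives a geometric series ([disc_kernel_schur]).

The L^2 norm of |f o phi|^(p/2) over |w|^2 < 1 - 4^-n is finite, so it can be
absorbed in Schur's test; the resulting bound does not depend on n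
([disc_integral_le]). *)

Set Implicit Arguments.
Unset Strict Implicit.
Unset Printing Implicit Defensive.

Import Order.TTheory GRing.Theory Num.Theory ComplexField.
Import numFieldNormedType.Exports.

Local Open Scope classical_set_scope.
Local Open Scope ring_scope.

(** * Complex numbers with real moduli *)

Section cmod_theory.
Context {R : realType}.
Implicit Types (x y z h d : Cplx R) (g : Cplx R -> Cplx R).

(** The projections are given their own names because the generic ones do not
see through the regular algebra on which the moduli are defined. *)
Definition cre z : R := complex.Re z.

Definition cim z : R := complex.Im z.

Lemma cmodE z : cmod z = Num.sqrt (cre z ^+ 2 + cim z ^+ 2).
Proof. by case: z. Qed.

Lemma cmod_norm z : `|z : R[i]| = (cmod z)%:C%C.
Proof. by rewrite normc_def cmodE. Qed.

Lemma cmod_ge0 z : 0 <= cmod z.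
Proof. by rewrite cmodE sqrtr_ge0. Qed.
Hint Resolve cmod_ge0 : core.

Lemma sqr_cmod z : cmod z ^+ 2 = cre z ^+ 2 + cim z ^+ 2.
Proof. by rewrite cmodE sqr_sqrtr // addr_ge0 // sqr_ge0. Qed.

Lemma cmodM x y : cmod (x * y) = cmod x * cmod y.
Proof. exact: Normc.normcM. Qed.

Lemma cmodV x : cmod (x^-1) = (cmod x)^-1.
Proof. exact: Normc.normcV. Qed.

Lemma cmodN x : cmod (- x) = cmod x.
Proof. exact: normcN. Qed.

Lemma cmodD x y : cmod (x + y) <= cmod x + cmod y.
Proof. exact: le_normcD. Qed.

Lemma cmodB x y : cmod (x - y) <= cmod x + cmod y.
Proof. by rewrite -(cmodN y) cmodD. Qed.

Lemma cmodBC x y : cmod (x - y) = cmod (y - x).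
Proof. by rewrite -cmodN opprB. Qed.

Lemma cmod0 : cmod (0 : Cplx R) = 0.
Proof. exact: Normc.normc0. Qed.

Lemma cmod1 : cmod (1 : Cplx R) = 1.
Proof. exact: Normc.normc1. Qed.

Lemma cmod_eq0 z : (cmod z == 0) = (z == 0).
Proof.
apply/eqP/eqP => [|->]; last exact: cmod0.
exact: Normc.eq0_normc.
Qed.

Lemma cmod_gt0 z : (0 < cmod z) = (z != 0).
Proof. by rewrite lt_def cmod_eq0 cmod_ge0 andbT. Qed.

Lemma Re_le_cmod z : `|cre z| <= cmod z.
Proof. by rewrite cmodE -[leLHS]sqrtr_sqr ler_wsqrtr// lerDl sqr_ge0. Qed.

Lemma Im_le_cmod z : `|cim z| <= cmod z.
Proof. by rewrite cmodE -[leLHS]sqrtr_sqr ler_wsqrtr// lerDr sqr_ge0. Qed.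

Lemma cmod_le_ReIm z : cmod z <= `|cre z| + `|cim z|.
Proof.
rewrite -(@ler_pXn2r _ 2%N) ?nnegrE ?addr_ge0//.
rewrite sqr_cmod sqrrD !real_normK ?num_real//.
by rewrite -subr_ge0 (_ : _ - _ = `|cre z| * `|cim z| *+ 2) ?mulrn_wge0 ?mulr_ge0//; ring.
Qed.

Lemma creM x y : cre (x * y) =
  cre x * cre y - cim x * cim y.
Proof. by case: x y => [a b] [c e]. Qed.

Lemma cimM x y : cim (x * y) =
  cre x * cim y + cim x * cre y.
Proof. by case: x y => [a b] [c e]. Qed.

Lemma creD x y : cre (x + y) = cre x + cre y.
Proof. by case: x y => [a b] [c e]. Qed.

Lemma cimD x y : cim (x + y) = cim x + cim y.
Proof. by case: x y => [a b] [c e]. Qed.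

Lemma creN x : cre (- x) = - cre x.
Proof. by case: x. Qed.

Lemma cimN x : cim (- x) = - cim x.
Proof. by case: x. Qed.

Definition cpt (s t : R) : Cplx R := (s +i* t)%C.

Lemma Re_cpt s t : cre (cpt s t) = s. Proof. by []. Qed.

Lemma Im_cpt s t : cim (cpt s t) = t. Proof. by []. Qed.

Lemma cpt_ReIm z : cpt (cre z) (cim z) = z.
Proof. by case: z. Qed.

Lemma cplx_eq x y : cre x = cre y ->
  cim x = cim y -> x = y.
Proof. by case: x y => [a b] [c e] /= -> ->. Qed.

(** Convergence in the normed module is stated with R[i]-valued norms; the
estimates below need real moduli, hence this epsilon-delta form. *)
Definition has_cderiv g z d := forall e, 0 < e ->
  exists2 del : R, 0 < del &
    forall h, cmod h < del -> cmod (g (z + h) - g z - d * h) <= e * cmod h.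

Lemma differentiable_cderiv g z :
  differentiable g z <-> exists d, has_cderiv g z d.
Proof.
split.
  move=> /derivable1_diffP /cvg_ex[d /= /cvgrPdist_lt dP].
  exists d => e e0.
  have eC0 : 0 < (e%:C)%C :> R[i] by rewrite ltcR.
  have := dP _ eC0; rewrite /nbhs /= => -[r /= r0 rP].
  have rr : (complex.Re r)%:C%C = r by apply: RRe_real; exact: gtr0_real.
  have r0' : 0 < complex.Re r by rewrite -ltcR rr.
  exists (complex.Re r) => // h hr.
  have [->|h0] := eqVneq h 0; first by rewrite addr0 subrr mulr0 subr0 cmod0 mulr0.
  have := rP h; rewrite /ball_ /= sub0r normrN => /(_ _ h0).
  rewrite cmod_norm -rr ltcR => /(_ hr).
  rewrite cmod_norm ltcR => hl.
  rewrite (_ : _ - _ = - ((d - h^-1 * (g (h * 1 + z) - g z)) * h)); last first.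
    by rewrite mulr1 [h + z]addrC; field.
  rewrite cmodN cmodM ler_wpM2r//.
  exact: ltW.
move=> [d dP]; apply/derivable1_diffP; apply/cvg_ex; exists d.
apply/cvgrPdist_le => /= e e0.
have er : (complex.Re e)%:C%C = e by apply: RRe_real; exact: gtr0_real.
have e0' : 0 < complex.Re e by rewrite -ltcR er.
have [r r0 rP] := dP _ e0'.
rewrite /nbhs /=; exists (r%:C%C); first by rewrite /= ltcR.
move=> h; rewrite /ball_ /= sub0r normrN cmod_norm ltcR => hr h0.
rewrite -er cmod_norm lecR.
have := rP h hr.
rewrite (_ : g (z + h) - _ - _ = - ((d - h^-1 * (g (h * 1 + z) - g z)) * h)); last first.
  by rewrite mulr1 [h + z]addrC; field.
by rewrite cmodN cmodM ler_pM2r// cmod_gt0.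
Qed.

Lemma differentiable_ccont g z : differentiable g z ->
  forall e, 0 < e -> exists2 del : R, 0 < del &
    forall h, cmod h < del -> cmod (g (z + h) - g z) <= e.
Proof.
move=> /differentiable_cderiv[d dP] e e0.
have [r r0 rP] := dP 1 ltr01.
have K0 : 0 < 1 + cmod d by rewrite ltr_pwDl.
exists (Num.min r (e / (1 + cmod d))).
  by rewrite lt_min r0 divr_gt0.
move=> h; rewrite lt_min => /andP[/rP hr he].
rewrite -[_ - _](subrK (d * h)).
rewrite (le_trans (cmodD _ _))// cmodM.
rewrite (le_trans (lerD hr (lexx _)))// -mulrDl.
by rewrite mulrC -ler_pdivlMr// ltW.
Qed.

End cmod_theory.
#[global] Hint Extern 0 (is_true (0 <= cmod _)) => solve [apply: cmod_ge0] : core.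
Arguments cmod : simpl never.

(** * Integrals over segments *)

Section segment_integral.
Context {R : realType}.
Implicit Types (f : R -> R) (a b c : R).

Definition sint a b f : R := \int[lebesgue_measure]_(t in `[a, b]) f t.

Lemma sint_integrable a b f : {within `[a, b], continuous f} ->
  lebesgue_measure.-integrable `[a, b] (EFin \o f).
Proof. by move=> cf; apply: continuous_compact_integrable => //; exact: segment_compact. Qed.

Lemma sint_split a b c f : a <= b -> b <= c ->
  {within `[a, c], continuous f} -> sint a c f = sint a b f + sint b c f.
Proof.
move=> ab bc cf.
have := Rintegral_itvB (sint_integrable cf) (x := b).
rewrite !bnd_simp => /(_ ab bc) e.
have ib : lebesgue_measure.-integrable `[b, c] (EFin \o f).
  apply: integrableS (sint_integrable cf) => //.
  by apply: subset_itvr; rewrite bnd_simp.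
have ib' : lebesgue_measure.-integrable `]b, c] (EFin \o f).
  by apply: integrableS ib => //; apply: subset_itvr; rewrite bnd_simp.
by rewrite /sint -(Rintegral_itv_obnd_cbnd ib') -e addrC subrK.
Qed.

Lemma sint_affine a b u v : a <= b ->
  sint a b (fun t => u + v * t) = (b - a) * (u + v * ((a + b) / 2)).
Proof.
rewrite le_eqVlt => /predU1P[<-|ab].
  by rewrite subrr mul0r /sint set_itv1 Rintegral_set1.
have cn (k : R -> R) : (forall x, derivable k x 1) -> continuous k.
  by move=> dk x; apply: differentiable_continuous; apply/derivable1_diffP.
have d1 (x : R) : is_derive x (1:R) (fun t : R => u * t + v * t ^+ 2 / 2) (u + v * x).
  have -> : (fun t : R => u * t + v * t ^+ 2 / 2) =
      (fun t => u * id t + (v / 2) * (id t ^+ 2)).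
    by apply/funext => t /=; rewrite mulrAC.
  by apply: is_derive_eq; rewrite /GRing.scale /=; field.
have d0 (x : R) : is_derive x (1:R) (fun t : R => u + v * t) v.
  apply: (@is_derive_eq _ _ _ (fun t : R => u + v * id t)) .
  by rewrite /GRing.scale /= add0r mul1r mulr1.
rewrite /sint /Rintegral (@continuous_FTC2 _ _ (fun t : R => u * t + v * t ^+ 2 / 2))//.
- by rewrite -EFinB /=; field.
- by apply: continuous_subspaceT => x; apply: (cn (fun t : R => u + v * t)) => y; case: (d0 y).
- split.
  + by move=> x _; case: (d1 x).
  + by apply: cvg_at_right_filter; apply: (cn (fun t : R => u * t + v * t ^+ 2 / 2)) => y; case: (d1 y).
  + by apply: cvg_at_left_filter; apply: (cn (fun t : R => u * t + v * t ^+ 2 / 2)) => y; case: (d1 y).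
- by move=> x _; rewrite derive1E; case: (d1 x).
Qed.

(** An affine approximation of f with error e determines the integral of f up to
the length of the segment times e. *)
Lemma sint_err a b u v e f : a <= b -> {within `[a, b], continuous f} ->
  (forall t, a <= t <= b -> `|f t - (u + v * t)| <= e) ->
  `|sint a b f - (b - a) * (u + v * ((a + b) / 2))| <= e * (b - a).
Proof.
move=> ab cf fe.
have ca (w : R) : {within `[a, b], continuous (fun t : R => w + v * t)}.
  apply: continuous_subspaceT => x; apply: cvgD; first exact: cvg_cst.
  by apply: cvgM; [exact: cvg_cst|exact: cvg_id].
have U : sint a b f <= sint a b (fun t => (u + e) + v * t).
  apply: le_Rintegral => //; [exact: sint_integrable|exact: sint_integrable|].
  move=> t /=; rewrite in_itv /= => /fe; rewrite ler_norml => /andP[_].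
  by rewrite lerBlDr addrA [e + u]addrC.
have L : sint a b (fun t => (u - e) + v * t) <= sint a b f.
  apply: le_Rintegral => //; [exact: sint_integrable|exact: sint_integrable|].
  move=> t /=; rewrite in_itv /= => /fe; rewrite ler_norml => /andP[+ _].
  lra.
move: U L; rewrite !sint_affine// => U L.
rewrite ler_norml; apply/andP; split; nra.
Qed.

End segment_integral.

(** * Goursat's theorem on rectangles *)

Section goursat.
Context {R : realType}.
Variable g : Cplx R -> Cplx R.
Implicit Types (x y w l : R).

Lemma path_continuous (gam : R -> Cplx R) (L : Cplx R -> R) a b :
  (forall s t, cmod (gam s - gam t) <= `|s - t|) ->
  (forall z z', `|L z - L z'| <= cmod (z - z')) ->
  (forall t, a <= t <= b -> differentiable g (gam t)) ->
  {within `[a, b], continuous (fun t => L (g (gam t)))}.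
Proof.
move=> gam1 L1 dg; apply: continuous_in_subspaceT => t.
rewrite inE /= in_itv /= => /dg /differentiable_ccont cg.
apply/cvgrPdist_le => /= e /cg[del del0 delP].
apply/nbhs_normP; exists del => //= s st.
have := delP (gam s - gam t); rewrite [gam t + _]addrC subrK => H.
rewrite (le_trans (L1 _ _))// cmodBC H// (le_lt_trans (gam1 _ _))//.
by rewrite distrC.
Qed.

(** The imaginary part of the integral of g dz over the boundary of the
rectangle with lower left corner x + iy, width w and height l, counterclockwise.
On the vertical sides it involves Re g only. *)
Definition rect_im x y w l :=
  sint x (x + w) (fun t => cim (g (cpt t y)))
  - sint x (x + w) (fun t => cim (g (cpt t (y + l))))
  + sint y (y + l) (fun t => cre (g (cpt (x + w) t)))
  - sint y (y + l) (fun t => cre (g (cpt x t))).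

Definition diff_rect x y w l := forall s t, x <= s <= x + w -> y <= t <= y + l ->
  differentiable g (cpt s t).

Lemma Re_lip (z z' : Cplx R) : `|cre z - cre z'| <= cmod (z - z').
Proof. by rewrite -creN -creD Re_le_cmod. Qed.

Lemma Im_lip (z z' : Cplx R) : `|cim z - cim z'| <= cmod (z - z').
Proof. by rewrite -cimN -cimD Im_le_cmod. Qed.

Lemma horiz_lip y s t : cmod (cpt s y - cpt t y) <= `|s - t|.
Proof.
have -> : cpt s y - cpt t y = cpt (s - t) 0.
  by apply: cplx_eq => //=; rewrite subrr.
by rewrite cmodE /= expr0n addr0 sqrtr_sqr.
Qed.

Lemma vert_lip x s t : cmod (cpt x s - cpt x t) <= `|s - t|.
Proof.
have -> : cpt x s - cpt x t = cpt 0 (s - t).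
  by apply: cplx_eq => //=; rewrite subrr.
by rewrite cmodE /= expr0n add0r sqrtr_sqr.
Qed.

Lemma horiz_continuous x y w l t (L : Cplx R -> R) :
  (forall z z', `|L z - L z'| <= cmod (z - z')) ->
  diff_rect x y w l -> y <= t <= y + l ->
  {within `[x, x + w], continuous (fun s => L (g (cpt s t)))}.
Proof.
move=> L1 dg tP; apply: (path_continuous (gam := fun s => (cpt s t))) => //.
  exact: horiz_lip.
by move=> s sP; exact: dg.
Qed.

Lemma vert_continuous x y w l s (L : Cplx R -> R) :
  (forall z z', `|L z - L z'| <= cmod (z - z')) ->
  diff_rect x y w l -> x <= s <= x + w ->
  {within `[y, y + l], continuous (fun t => L (g (cpt s t)))}.
Proof.
move=> L1 dg sP; apply: (path_continuous (gam := fun t => (cpt s t))) => //.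
  exact: vert_lip.
by move=> t tP; exact: dg.
Qed.

Lemma diff_rect_sub x y w l x' y' w' l' : x <= x' -> y <= y' ->
  x' + w' <= x + w -> y' + l' <= y + l ->
  diff_rect x y w l -> diff_rect x' y' w' l'.
Proof.
move=> ? ? ? ? dg s t /andP[? ?] /andP[? ?].
by apply: dg; apply/andP; split; lra.
Qed.

Lemma rect_im_quarter x y w l : 0 <= w -> 0 <= l -> diff_rect x y (w + w) (l + l) ->
  rect_im x y (w + w) (l + l) = rect_im x y w l + rect_im (x + w) y w l
    + rect_im x (y + l) w l + rect_im (x + w) (y + l) w l.
Proof.
move=> w0 l0 dg; rewrite /rect_im !addrA.
have H t : t = y \/ t = y + l \/ t = y + l + l ->
    sint x (x + w + w) (fun s => cim (g (cpt s t))) =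
    sint x (x + w) (fun s => cim (g (cpt s t))) +
    sint (x + w) (x + w + w) (fun s => cim (g (cpt s t))).
  move=> tP; apply: sint_split; rewrite ?lerDl//.
  rewrite -[x + w + w]addrA; apply: (horiz_continuous Im_lip dg).
  by case: tP => [->|[->|->]]; lra.
have V s : s = x \/ s = x + w \/ s = x + w + w ->
    sint y (y + l + l) (fun t => cre (g (cpt s t))) =
    sint y (y + l) (fun t => cre (g (cpt s t))) +
    sint (y + l) (y + l + l) (fun t => cre (g (cpt s t))).
  move=> sP; apply: sint_split; rewrite ?lerDl//.
  rewrite -[y + l + l]addrA; apply: (vert_continuous Re_lip dg).
  by case: sP => [->|[->|->]]; lra.
rewrite (H y) ?(H (y + l + l)) ?(V x) ?(V (x + w + w)); [|by auto..].
ring.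
Qed.

(** A boundary integral kills affine functions, so if g is affine up to e on the
rectangle then only e times the perimeter remains. *)
Lemma rect_im_small x y w l (z d : Cplx R) e : 0 <= w -> 0 <= l ->
  diff_rect x y w l ->
  (forall s t, x <= s <= x + w -> y <= t <= y + l ->
    cmod (g (cpt s t) - g z - d * ((cpt s t) - z)) <= e) ->
  `|rect_im x y w l| <= 2 * (e * w + e * l).
Proof.
move=> w0 l0 dg ge.
pose u0 := cre (g z); pose v0 := cim (g z).
pose a := cre d; pose b := cim d.
pose X := cre z; pose Y := cim z.
have zE : z = cpt X Y by rewrite cpt_ReIm.
have RP s t : x <= s <= x + w -> y <= t <= y + l ->
    `|cre (g (cpt s t)) - (u0 + a * (s - X) - b * (t - Y))| <= e.
  move=> sP tP; apply: le_trans (ge _ _ sP tP); apply: le_trans (Re_le_cmod _).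
  rewrite !(creD, creN, creM, cimD, cimN, Re_cpt, Im_cpt) -/u0 -/a -/b -/X -/Y.
  by rewrite le_eqVlt; apply/orP; left; apply/eqP; congr (`| _ |); ring.
have IP s t : x <= s <= x + w -> y <= t <= y + l ->
    `|cim (g (cpt s t)) - (v0 + b * (s - X) + a * (t - Y))| <= e.
  move=> sP tP; apply: le_trans (ge _ _ sP tP); apply: le_trans (Im_le_cmod _).
  rewrite !(creD, creN, cimM, cimD, cimN, Re_cpt, Im_cpt) -/v0 -/a -/b -/X -/Y.
  by rewrite le_eqVlt; apply/orP; left; apply/eqP; congr (`| _ |); ring.
have xw : x <= x + w by rewrite lerDl.
have yl : y <= y + l by rewrite lerDl.
have H t : y <= t <= y + l -> `|sint x (x + w) (fun s => cim (g (cpt s t)))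
    - (x + w - x) * ((v0 - b * X + a * (t - Y)) + b * ((x + (x + w)) / 2))| <= e * (x + w - x).
  move=> tP; apply: sint_err => //; first exact: (horiz_continuous Im_lip dg).
  move=> s sP; apply: le_trans (IP _ _ sP tP).
  by rewrite le_eqVlt; apply/orP; left; apply/eqP; congr (`| _ |); ring.
have V s : x <= s <= x + w -> `|sint y (y + l) (fun t => cre (g (cpt s t)))
    - (y + l - y) * ((u0 + a * (s - X) + b * Y) + - b * ((y + (y + l)) / 2))| <= e * (y + l - y).
  move=> sP; apply: sint_err => //; first exact: (vert_continuous Re_lip dg).
  move=> t tP; apply: le_trans (RP _ _ sP tP).
  by rewrite le_eqVlt; apply/orP; left; apply/eqP; congr (`| _ |); ring.
have y1 : y <= y <= y + l by rewrite lexx.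
have y2 : y <= y + l <= y + l by rewrite lexx yl.
have x1 : x <= x <= x + w by rewrite lexx.
have x2 : x <= x + w <= x + w by rewrite lexx xw.
move: (H _ y1) (H _ y2) (V _ x1) (V _ x2); rewrite /rect_im.
move: (sint x _ _) (sint x _ _) (sint y _ _) (sint y _ _) => s1 s2 s3 s4.
rewrite [x + w - x]addrAC subrr add0r [y + l - y]addrAC subrr add0r.
rewrite !ler_norml => /andP[? ?] /andP[? ?] /andP[? ?] /andP[? ?].
apply/andP; split; nra.
Qed.

End goursat.

Section goursat_theorem.
Context {R : realType}.
Variable g : Cplx R -> Cplx R.
Implicit Types (x y w l K : R).

Lemma nested_point (u d : nat -> R) :
  (forall n, 0 <= d n) ->
  (forall n, u n <= u n.+1) -> (forall n, u n.+1 + d n.+1 <= u n + d n) ->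
  exists c, forall n, u n <= c <= u n + d n.
Proof.
move=> d0 ul ur.
have ulm n m : (n <= m)%N -> u n <= u m.
  by move=> nm; apply: (nondecreasing_seqP u).1.
have urm n m : (n <= m)%N -> u m + d m <= u n + d n.
  elim: m => [|m IH]; first by rewrite leqn0 => /eqP ->.
  rewrite leq_eqVlt => /predU1P[->//|/IH]; exact: le_trans.
have ub n m : u m <= u n + d n.
  have := ulm _ _ (leq_maxr n m); move=> /le_trans; apply.
  apply: le_trans (urm _ _ (leq_maxl n m)).
  by rewrite lerDl.
exists (sup (range u)) => n; apply/andP; split.
  apply: ub_le_sup; last by exists n.
  by exists (u 0 + d 0) => _ [m _ <-].
by apply: ge_sup; [exists (u 0%N); exists 0%N|move=> _ [m _ <-]].
Qed.

(** By additivity one of the four quarters of the rectangle carries at least a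
quarter of the boundary integral. *)
Lemma rect_im_next K x y w l : 0 <= w -> 0 <= l ->
  diff_rect g x y (w + w) (l + l) ->
  K + K + K + K <= `|rect_im g x y (w + w) (l + l)| ->
  exists2 p : R * R, [/\ x <= p.1, p.1 + w <= x + (w + w), y <= p.2 &
    p.2 + l <= y + (l + l)] & K <= `|rect_im g p.1 p.2 w l|.
Proof.
move=> w0 l0 dg; rewrite rect_im_quarter// => H.
apply: contrapT => N.
have N' (a b : R) : x <= a -> a + w <= x + (w + w) -> y <= b ->
    b + l <= y + (l + l) -> `|rect_im g a b w l| < K.
  move=> *; rewrite ltNge; apply/negP => Kp; apply: N.
  by exists (a, b).
have xw : x <= x + w by rewrite lerDl.
have yl : y <= y + l by rewrite lerDl.
have H1 : `|rect_im g (x + w) (y + l) w l| < K by apply: N'; lra.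
have H2 : `|rect_im g x (y + l) w l| < K by apply: N'; lra.
have H3 : `|rect_im g (x + w) y w l| < K by apply: N'; lra.
have H4 : `|rect_im g x y w l| < K by apply: N'; lra.
have := le_lt_trans (le_trans (ler_normD _ _) (lerD (le_trans (ler_normD _ _)
  (lerD (ler_normD _ _) (lexx _))) (lexx _)))
  (ltrD (ltrD (ltrD H4 H3) H2) H1).
by rewrite ltNge H.
Qed.

(** Goursat's argument: halving the rectangle repeatedly while keeping a quarter
of the boundary integral leads to a point at which g could not be
differentiable. *)
Theorem goursat x y w l : 0 <= w -> 0 <= l -> diff_rect g x y w l ->
  rect_im g x y w l = 0.
Proof.
move=> w0 l0 dg; apply/eqP; apply: contrapT => /negP; rewrite -normr_gt0.
set K := `|_| => K0.
pose wn n := w / 2 ^+ n; pose ln n := l / 2 ^+ n.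
have wn0 n : 0 <= wn n by rewrite divr_ge0// exprn_ge0.
have ln0 n : 0 <= ln n by rewrite divr_ge0// exprn_ge0.
have wnS n : wn n = wn n.+1 + wn n.+1 by rewrite /wn exprS; field; rewrite expf_neq0.
have lnS n : ln n = ln n.+1 + ln n.+1 by rewrite /ln exprS; field; rewrite expf_neq0.
pose P n (p : R * R) := [/\ x <= p.1, p.1 + wn n <= x + w, y <= p.2,
  p.2 + ln n <= y + l & K / 4 ^+ n <= `|rect_im g p.1 p.2 (wn n) (ln n)|].
pose Q n (p p' : R * R) := [/\ p.1 <= p'.1, p'.1 + wn n.+1 <= p.1 + wn n,
  p.2 <= p'.2 & p'.2 + ln n.+1 <= p.2 + ln n].
have step (np : nat * (R * R)) : exists p', P np.1 np.2 -> P np.1.+1 p' /\ Q np.1 np.2 p'.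
  case: np => n [a b] /=.
  have [|nP] := pselect (P n (a, b)); last by exists (a, b).
  move=> [/= xa aw yb bl Kn].
  have dg' : diff_rect g a b (wn n.+1 + wn n.+1) (ln n.+1 + ln n.+1).
    by rewrite -wnS -lnS; exact: diff_rect_sub dg.
  have KE : K / 4 ^+ n = K / 4 ^+ n.+1 + K / 4 ^+ n.+1 + K / 4 ^+ n.+1 + K / 4 ^+ n.+1.
    by rewrite exprS; field; rewrite expf_neq0.
  have [|[a' b'] /= [? wa ? lb] K'] := rect_im_next (K := K / 4 ^+ n.+1) (wn0 n.+1) (ln0 n.+1) dg'.
    by rewrite -wnS -lnS -KE.
  rewrite -wnS in wa; rewrite -lnS in lb.
  by exists (a', b') => _; split; split => //=; lra.
have [nxt nxtP] := choice step.
pose s := fix s n := if n is m.+1 then nxt (m, s m) else (x, y).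
have sP n : P n (s n).
  elim: n => [|n IH]; first by split => //=; rewrite /wn /ln !expr0 ?divr1.
  by have [] := nxtP (n, s n) IH.
have sQ n : Q n (s n) (s n.+1) by have [] := nxtP (n, s n) (sP n).
have [X XP] := @nested_point (fun n => (s n).1) wn wn0
  (fun n => let: And4 h _ _ _ := sQ n in h) (fun n => let: And4 _ h _ _ := sQ n in h).
have [Y YP] := @nested_point (fun n => (s n).2) ln ln0
  (fun n => let: And4 _ _ h _ := sQ n in h) (fun n => let: And4 _ _ _ h := sQ n in h).
have : differentiable g (cpt X Y).
  have := XP 0%N; have := YP 0%N; rewrite /= /wn /ln !expr0 !divr1.
  by move=> ? ?; exact: dg.
move=> /differentiable_cderiv[d dP].
(* Small enough to contradict the lower bound K / 4^n when the n-th rectangle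
has side lengths w / 2^n and l / 2^n; the 1 keeps e defined for w = l = 0. *)
pose e := K / (4 * (w + l + 1) ^+ 2).
have wl0 : 0 < w + l + 1 by rewrite ltr_wpDl// addr_ge0.
have e0 : 0 < e by rewrite divr_gt0// mulr_gt0// exprn_gt0.
have [del del0 delP] := dP _ e0.
have [n nP] : exists n, wn n + ln n < del.
  have [n nP] : exists n, (w + l) / del < 2 ^+ n.
    exists (Num.bound ((w + l) / del)).
    apply: lt_le_trans (archi_boundP _) _; first by rewrite divr_ge0 ?addr_ge0// ltW.
    by rewrite -natrX ler_nat ltnW// ltn_expl.
  exists n; rewrite /wn /ln -mulrDl ltr_pdivrMr ?exprn_gt0//.
  by rewrite mulrC -ltr_pdivrMr.
have [? ? ? ? Kn] := sP n.
have : `|rect_im g (s n).1 (s n).2 (wn n) (ln n)| <=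
    2 * (e * (wn n + ln n) * wn n + e * (wn n + ln n) * ln n).
  apply: (@rect_im_small _ _ _ _ _ _ (cpt X Y) d) => //.
    exact: diff_rect_sub dg.
  move=> a b /andP[a1 a2] /andP[b1 b2].
  have /andP[? ?] := XP n; have /andP[? ?] := YP n.
  have hb : cmod (cpt a b - cpt X Y) <= wn n + ln n.
    rewrite (le_trans (cmod_le_ReIm _))// creD cimD creN cimN /=.
    rewrite lerD// ler_norml; apply/andP; split; rewrite /cre /cim /=; lra.
  have := delP _ (le_lt_trans hb nP); rewrite [cpt X Y + _]addrC subrK => /le_trans; apply.
  by rewrite ler_pM2l.
move/(le_trans Kn); apply/negP; rewrite -ltNge.
have -> : 2 * (e * (wn n + ln n) * wn n + e * (wn n + ln n) * ln n) = 2 * e * (w + l) ^+ 2 / 4 ^+ n.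
  rewrite (_ : 4 ^+ n = 2 ^+ n * 2 ^+ n :> R); last by rewrite -exprMn; congr (_ ^+ _); ring.
  by rewrite /wn /ln; field; rewrite expf_neq0.
rewrite ltr_pM2r ?invr_gt0 ?exprn_gt0//.
have <- : e * (4 * (w + l + 1) ^+ 2) = K.
  by rewrite /e divfK// mulf_neq0// expf_neq0// gt_eqF.
rewrite [2 * e]mulrC -mulrA ltr_pM2l//.
have : 0 <= w + l by rewrite addr_ge0.
move: (w + l) => S S0; nra.
Qed.

End goursat_theorem.

(** * The complex exponential *)

Section complex_exponential.
Context {R : realType}.
Implicit Types (z h : Cplx R) (S : Cplx R -> Cplx R).

Lemma is_derive_eps (f : R -> R) (x d e : R) : is_derive x (1 : R) f d -> 0 < e ->
  exists2 del : R, 0 < del &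
    forall h : R, `|h| < del -> `|f (x + h) - f x - d * h| <= e * `|h|.
Proof.
move=> [df <-] e0.
have /cvgrPdist_lt/(_ _ e0)/nbhs_normP[del /= del0 delP] := df.
exists del => // h hd; have [->|h0] := eqVneq h 0.
  by rewrite addr0 subrr mulr0 subr0 normr0 mulr0.
have := delP h; rewrite /= sub0r normrN => /(_ hd h0)/ltW hl.
rewrite -ler_pdivrMr ?normr_gt0// -normfV -normrM; apply: le_trans hl.
rewrite -[leRHS]normrN /derive; set L := lim _.
have -> : h *: (1 : R) + x = x + h by rewrite addrC /GRing.scale /= mulr1.
rewrite /GRing.scale /= le_eqVlt; apply/orP; left; apply/eqP; congr (`| _ |).
by field.
Qed.

Definition cexp z : Cplx R := cpt (expR (cre z) * cos (cim z)) (expR (cre z) * sin (cim z)).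

Lemma cexpD z h : cexp (z + h) = cexp z * cexp h.
Proof.
apply: cplx_eq; rewrite -/(cre _) -/(cim _) ?(creM, cimM) /cexp !(Re_cpt, Im_cpt);
by rewrite creD cimD expRD (cosD, sinD); ring.
Qed.

Lemma cmod_cexp z : cmod (cexp z) = expR (cre z).
Proof.
rewrite cmodE /cexp !(Re_cpt, Im_cpt) !exprMn -mulrDr cos2Dsin2 mulr1.
by rewrite sqrtr_sqr ger0_norm// expR_ge0.
Qed.

Lemma differentiable_cexp z : differentiable cexp z.
Proof.
apply/differentiable_cderiv; exists (cexp z) => e e0.
set M := cmod (cexp z).
have M0 : 0 < M by rewrite /M cmod_cexp expR_gt0.
pose e1 := Num.min 1 (e / (9 * M)).
have e10 : 0 < e1 by rewrite /e1 lt_min ltr01 divr_gt0// mulr_gt0.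
have e11 : e1 <= 1 by rewrite /e1 ge_min lexx.
have e1M : M * (9 * e1) <= e.
  have : e1 <= e / (9 * M) by rewrite /e1 ge_min lexx orbT.
  by rewrite ler_pdivlMr ?mulr_gt0// mulrC -mulrA mulrCA.
clearbody e1.
have [d1 d10 P1] := is_derive_eps (is_derive_expR 0) e10.
have [d2 d20 P2] := is_derive_eps (is_derive_cos 0) e10.
have [d3 d30 P3] := is_derive_eps (is_derive_sin 0) e10.
exists (Num.min (Num.min d1 d2) (Num.min d3 e1)).
  by rewrite !lt_min d10 d20 d30 e10.
move=> h; rewrite !lt_min => /andP[/andP[h1 h2] /andP[h3 h4]].
have ha := Re_le_cmod h; have hb := Im_le_cmod h.
set a := cre h in ha *; set b := cim h in hb *.
have := P1 a (le_lt_trans ha h1); rewrite add0r expR0 mul1r => Ea.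
have := P2 b (le_lt_trans hb h2); rewrite add0r cos0 sin0 oppr0 mul0r subr0 => Cb.
have := P3 b (le_lt_trans hb h3); rewrite add0r cos0 sin0 mul1r subr0 => Sb.
rewrite cexpD (_ : _ - _ - _ = cexp z * (cexp h - 1 - h)); last by ring.
rewrite cmodM -/M (le_trans _ (ler_wpM2r (cmod_ge0 h) e1M))//.
rewrite -mulrA ler_pM2l// (le_trans (cmod_le_ReIm _))//.
rewrite !(creD, cimD, creN, cimN) -/a -/b /cexp Re_cpt Im_cpt -/a -/b.
have -> : expR a * cos b - cre 1 - a = (expR a - 1 - a) + expR a * (cos b - 1).
  by rewrite /cre /=; ring.
have -> : expR a * sin b - cim 1 - b = expR a * (sin b - b) + (expR a - 1) * b.
  by rewrite /cim /=; ring.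
have A1 : `|a| <= e1 by apply: le_trans ha _; exact: ltW.
have X1 : `|expR a - 1| <= 2 * e1.
  rewrite -[expR a - 1](subrK a) (le_trans (ler_normD _ _))//.
  rewrite (le_trans (lerD Ea (lexx _)))//.
  have := normr_ge0 a; nra.
have X2 : `|expR a| <= 3.
  rewrite -[expR a](subrK 1) (le_trans (ler_normD _ _))// normr1; lra.
have N0 := cmod_ge0 h; have a0 := normr_ge0 a; have b0 := normr_ge0 b.
have Y1 : `|expR a - 1 - a + expR a * (cos b - 1)| <= e1 * cmod h + 3 * (e1 * cmod h).
  rewrite (le_trans (ler_normD _ _))// normrM lerD//.
    by rewrite (le_trans Ea)// ler_pM2l.
  by rewrite ler_pM// (le_trans Cb)// ler_pM2l.
have Y2 : `|expR a * (sin b - b) + (expR a - 1) * b| <= 3 * (e1 * cmod h) + 2 * e1 * cmod h.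
  rewrite (le_trans (ler_normD _ _))// !normrM lerD//.
    by rewrite ler_pM// (le_trans Sb)// ler_pM2l.
  by rewrite ler_pM.
lra.
Qed.

End complex_exponential.

(** * Compactness *)

Section compactness.
Context {R : realType}.
Implicit Types (r M : R) (z : Cplx2 R) (w : Cplx R).

Definition near2 r z z' := cmod (z'.1 - z.1) < r /\ cmod (z'.2 - z.2) < r.

(** Compactness in the form in which it is checked and used below: openness of
the complement is stated with real radii. *)
Definition closed_bounded2 (K : set (Cplx2 R)) :=
  (exists M, forall z, K z -> cmod z.1 <= M /\ cmod z.2 <= M) /\
  (forall z, ~ K z -> exists2 r : R, 0 < r & forall z', near2 r z z' -> ~ K z').

Lemma Real4_nbhs (x : (R * R) * (R * R)) r : 0 < r ->
  \forall y \near x, near2 r (to_cplx2 x) (to_cplx2 y).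
Proof.
move=> r0; apply/nbhs_ballP; exists (r / 2); first by rewrite /= divr_gt0.
move=> y [[a b] [c d]]; rewrite /ball /= in a b c d.
by split; apply: le_lt_trans (cmod_le_ReIm _) _; rewrite [ltRHS]splitr ltrD//;
   rewrite /cre /cim /= distrC.
Qed.

(** Heine-Borel: a property that holds near each point at all small scales holds
on the whole compact set at one scale. The continuity and extremum theorems
below are instances, with P chosen as the conclusion at scale r. *)
Lemma compact_uniform_scale2 (K : set (Cplx2 R)) (P : R -> Cplx2 R -> Prop) :
  closed_bounded2 K ->
  (forall z, K z -> exists2 r : R, 0 < r & forall (del : R) z', 0 < del < r ->
     near2 r z z' -> K z' -> P del z') ->
  exists2 r : R, 0 < r & forall z, K z -> P r z.
Proof.
move=> [[M KM] Kc] HP.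
have cI : compact (`[- M, M] : set R) by exact: segment_compact.
have := compact_setX (compact_setX cI cI) (compact_setX cI cI).
move=> /compact_near_coveringP.
move/(_ R (0^'+) (fun del x => K (to_cplx2 x) -> P del (to_cplx2 x)) _).
case.
  move=> x _; have [/HP[r r0 rP]|/Kc[r r0 rP]] := pselect (K (to_cplx2 x)).
    exists ([set y | near2 r (to_cplx2 x) (to_cplx2 y)], [set del | 0 < del < r]).
      split; first exact: Real4_nbhs.
      exists r => //= del; rewrite /ball_ /= sub0r normrN => delr del0.
      by rewrite del0 (le_lt_trans (ler_norm _) delr).
    by move=> [y del] /= [yx delr] Ky; exact: rP.
  exists ([set y | near2 r (to_cplx2 x) (to_cplx2 y)], setT).
    by split; [exact: Real4_nbhs|exact: filterT].
  by move=> [y del] /= [/rP].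
move=> r /= r0 rP; exists (r / 2); first by rewrite divr_gt0.
move=> z Kz; have [z1M z2M] := KM _ Kz.
pose x : (R * R) * (R * R) := ((cre z.1, cim z.1), (cre z.2, cim z.2)).
have xz : to_cplx2 x = z.
  by rewrite /to_cplx2 /to_cplx /x /=; case: (z) => [[a b] [c d]].
have B (w : Cplx R) : cmod w <= M -> (- M <= cre w <= M) /\ (- M <= cim w <= M).
  by move=> wM; rewrite -!ler_norml; split; apply: le_trans wM;
    [exact: Re_le_cmod|exact: Im_le_cmod].
have [B1 B2] := B _ z1M; have [B3 B4] := B _ z2M.
rewrite -xz; apply: (rP (r / 2)) => //=.
- by rewrite sub0r normrN ger0_norm ?divr_ge0 ?ltW// ltr_pdivrMr// ltr_pMr// ltr1n.
- by rewrite divr_gt0.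
- by rewrite xz.
Qed.

Definition ccont_at2 (f : Cplx2 R -> R) z := forall e, 0 < e ->
  exists2 r : R, 0 < r & forall z', near2 r z z' -> `|f z' - f z| <= e.

Lemma uniform_continuity2 (K : set (Cplx2 R)) (f : Cplx2 R -> R) e :
  closed_bounded2 K -> (forall z, K z -> ccont_at2 f z) -> 0 < e ->
  exists2 r : R, 0 < r & forall z z', K z -> near2 r z z' -> `|f z' - f z| <= e.
Proof.
move=> Kcb fc e0.
have [|r r0 rP] := @compact_uniform_scale2 K
    (fun r z => forall z', near2 r z z' -> `|f z' - f z| <= e) Kcb.
  move=> z Kz; have [r r0 rP] := fc z Kz (e / 2) (divr_gt0 e0 (ltr0n _ 2)).
  exists (r / 2); first by rewrite divr_gt0.
  have rr : r / 2 <= r by rewrite ler_pdivrMr// ler_peMr ?ler1n// ltW.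
  move=> del z' /andP[d0 dr] [z1 z2] _ z'' [z3 z4].
  rewrite (splitr e) -(subrK (f z) (f z'')) -addrA.
  rewrite (le_trans (ler_normD _ _))// lerD//; last first.
    by rewrite distrC rP//; split; apply: lt_le_trans rr.
  apply: rP; split.
    rewrite -(subrK z'.1 z''.1) -addrA (le_lt_trans (cmodD _ _))//.
    by rewrite (splitr r) ltrD// (lt_trans _ dr).
  rewrite -(subrK z'.2 z''.2) -addrA (le_lt_trans (cmodD _ _))//.
  by rewrite (splitr r) ltrD// (lt_trans _ dr).
by exists r => // z z' Kz; exact: rP.
Qed.

Lemma max_exists2 (K : set (Cplx2 R)) (f : Cplx2 R -> R) :
  closed_bounded2 K -> (forall z, K z -> ccont_at2 f z) -> K !=set0 ->
  exists2 z, K z & forall z', K z' -> f z' <= f z.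
Proof.
move=> Kcb fc [z0 Kz0].
have [r r0 rP] : exists2 r : R, 0 < r & forall z, K z -> f z <= r^-1.
  apply: (@compact_uniform_scale2 K (fun r z => f z <= r^-1) Kcb).
  move=> z Kz; have [r r0 rP] := fc z Kz 1 ltr01.
  exists (Num.min r (`|f z| + 1)^-1); first by rewrite lt_min r0 invr_gt0 ltr_wpDl.
  move=> del z' /andP[d0]; rewrite lt_min => /andP[dr df] [z1 z2] _.
  have : `|f z' - f z| <= 1.
    by apply: rP; split; [apply: lt_le_trans z1 _|apply: lt_le_trans z2 _];
      rewrite ge_min lexx.
  move=> /ler_normlP[_]; rewrite lerBlDr => /le_trans; apply.
  have N1 : 0 < `|f z| + 1 by rewrite ltr_wpDl.
  have : `|f z| + 1 <= del^-1.
    by rewrite -[leLHS]invrK lef_pV2 ?posrE ?invr_gt0// ltW.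
  by apply: le_trans; rewrite addrC lerD2r ler_norm.
have hs : has_sup (f @` K).
  by split; [exists (f z0); exists z0|exists r^-1 => _ [z Kz <-]; exact: rP].
apply: contrapT => N.
have lts z : K z -> f z < sup (f @` K).
  move=> Kz; rewrite lt_neqAle; apply/andP; split; last first.
    by apply: ub_le_sup; [case: hs|exists z].
  apply/negP => /eqP fz; apply: N; exists z => // z' Kz'; rewrite fz.
  by apply: ub_le_sup; [case: hs|exists z'].
have [q q0 qP] : exists2 q : R, 0 < q & forall z, K z -> f z <= sup (f @` K) - q.
  apply: (@compact_uniform_scale2 K (fun q z => f z <= _ - q) Kcb).
  move=> z Kz; have := lts _ Kz; rewrite -subr_gt0; set s := sup _ => gap.
  have [q q0 qP] := fc z Kz _ (divr_gt0 gap (ltr0n _ 2)).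
  exists (Num.min q ((s - f z) / 2)); first by rewrite lt_min q0 divr_gt0.
  move=> del z' /andP[d0]; rewrite lt_min => /andP[dr df] [z1 z2] _.
  have : `|f z' - f z| <= (s - f z) / 2.
    by apply: qP; split; [apply: lt_le_trans z1 _|apply: lt_le_trans z2 _];
      rewrite ge_min lexx.
  by move=> /ler_normlP[_]; lra.
have : sup (f @` K) <= sup (f @` K) - q.
  by apply: ge_sup; [case: hs|move=> _ [z Kz <-]; exact: qP].
by rewrite lerBrDr gerDl leNgt q0.
Qed.

Definition ccont_at (f : Cplx R -> R) w := forall e, 0 < e ->
  exists2 r : R, 0 < r & forall w', cmod (w' - w) < r -> `|f w' - f w| <= e.

Definition closed_bounded (K : set (Cplx R)) :=
  (exists M, forall w, K w -> cmod w <= M) /\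
  (forall w, ~ K w -> exists2 r : R, 0 < r & forall w', cmod (w' - w) < r -> ~ K w').

(** The plane is embedded in C^2 as the line z.2 = 0, so that the statements in
one variable follow from those in two. *)
Let cyl (K : set (Cplx R)) : set (Cplx2 R) := [set z | K z.1 /\ z.2 = 0].

Let cyl_cb K : closed_bounded K -> closed_bounded2 (cyl K).
Proof.
move=> [[M KM] Kc]; split.
  exists M => z [Kz z2]; have H := KM _ Kz; split=> //; rewrite z2 cmod0.
  exact: le_trans (cmod_ge0 _) H.
move=> z /not_andP[/Kc[r r0 rP]|z2].
  by exists r => // z' [/rP nK _] [].
exists (cmod z.2); first by rewrite cmod_gt0; exact/eqP.
by move=> z' [_ +] [_ z'2]; rewrite z'2 sub0r cmodN ltxx.
Qed.

Let cyl_cont K (f : Cplx R -> R) : (forall w, K w -> ccont_at f w) ->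
  forall z, cyl K z -> ccont_at2 (fun z => f z.1) z.
Proof.
move=> fc z [Kz _] e e0; have [r r0 rP] := fc _ Kz e e0.
by exists r => // z' [? _]; exact: rP.
Qed.

Lemma uniform_continuity (K : set (Cplx R)) (f : Cplx R -> R) e :
  closed_bounded K -> (forall w, K w -> ccont_at f w) -> 0 < e ->
  exists2 r : R, 0 < r & forall w w', K w -> cmod (w' - w) < r -> `|f w' - f w| <= e.
Proof.
move=> Kcb fc e0.
have [r r0 rP] := uniform_continuity2 (cyl_cb Kcb) (cyl_cont fc) e0.
exists r => // w w' Kw ww'; apply: (rP (w, 0) (w', 0)) => //.
by split => /=; rewrite ?subrr ?cmod0.
Qed.

Lemma max_exists (K : set (Cplx R)) (f : Cplx R -> R) :
  closed_bounded K -> (forall w, K w -> ccont_at f w) -> K !=set0 ->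
  exists2 w, K w & forall w', K w' -> f w' <= f w.
Proof.
move=> Kcb fc [w0 Kw0].
have [|z [Kz _] zP] := max_exists2 (cyl_cb Kcb) (cyl_cont fc).
  by exists (w0, 0).
by exists z.1 => // w Kw; exact: (zP (w, 0)).
Qed.

End compactness.

(** * Circle means of holomorphic functions *)

Section mean_value.
Context {R : realType}.
Implicit Types (S : Cplx R -> Cplx R) (z c w : Cplx R).

Lemma sint_cst (a b u : R) : a <= b -> sint a b (fun=> u) = (b - a) * u.
Proof.
move=> ab; have := sint_affine u 0 ab; rewrite mul0r addr0 => <-.
by congr (sint _ _ _); apply/funext => t; rewrite mul0r addr0.
Qed.

Let cst_integrable (a b u : R) :
  lebesgue_measure.-integrable `[a, b] (EFin \o (fun=> u : R)).
Proof. by apply: sint_integrable; apply: continuous_subspaceT => x; exact: cvg_cst. Qed.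

Lemma sint_ub (a b M : R) (f : R -> R) : a <= b ->
  {within `[a, b], continuous f} -> (forall t, a <= t <= b -> f t <= M) ->
  sint a b f <= (b - a) * M.
Proof.
move=> ab cf fM; rewrite -sint_cst//; apply: le_Rintegral => //; exact: sint_integrable.
Qed.

Lemma sint_lb (a b m : R) (f : R -> R) : a <= b ->
  {within `[a, b], continuous f} -> (forall t, a <= t <= b -> m <= f t) ->
  (b - a) * m <= sint a b f.
Proof.
move=> ab cf fM; rewrite -sint_cst//; apply: le_Rintegral => //; exact: sint_integrable.
Qed.

Lemma cexp_2pi (x : R) : cexp (cpt x (0 + 2 * pi)) = cexp (cpt x 0).
Proof. by rewrite /cexp !Im_cpt !Re_cpt add0r mulr_natl sin2pi cos2pi cos0 sin0. Qed.

(** In logarithmic polar coordinates circles about c become vertical segments,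
and the horizontal sides of a rectangle of height 2 pi cancel by periodicity; so
the mean of Re S over a circle does not depend on the radius, and small circles
identify it as Re (S c). A mean is at most the maximum. *)
Lemma Re_le_on_circle S c (r : R) : 0 < r ->
  (forall z, cmod (z - c) <= r -> differentiable S z) ->
  exists2 z, cmod (z - c) = r & cre (S c) <= cre (S z).
Proof.
move=> r0 dS; pose G z := S (c + cexp z).
have dG z : cre z <= ln r -> differentiable G z.
  move=> zr; apply: (@differentiable_comp _ _ _ _ (fun z => c + cexp z) S).
    by apply: differentiableD; [exact: differentiable_cst|exact: differentiable_cexp].
  apply: dS; rewrite addrC addKr cmod_cexp -[leRHS](@lnK _ r) ?posrE//.
  by rewrite ler_expR.
have pi0 : 0 <= 0 + 2 * pi :> R by rewrite add0r mulr_ge0// pi_ge0.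
have cG x : x <= ln r -> {within `[0, 0 + 2 * pi], continuous (fun t => cre (G (cpt x t)))}.
  move=> xr; apply: (@vert_continuous _ _ x 0 0 (2 * pi)) => //.
  - exact: Re_lip.
  - by move=> s t /andP[? sx] _; apply: dG; rewrite Re_cpt (le_trans sx)// addr0.
  - by rewrite addr0 lexx.
have [t0 t0i t0P] := EVT_max pi0 (cG _ (lexx _)).
have zr : cmod (c + cexp (cpt (ln r) t0) - c) = r.
  by rewrite addrC addKr cmod_cexp Re_cpt lnK ?posrE.
exists (c + cexp (cpt (ln r) t0)) => //; rewrite -/(G _) leNgt; apply/negP => lt0.
set k := cre (G _) in lt0.
have eta0 : 0 < (cre (S c) - k) / 2 by rewrite divr_gt0// subr_gt0.
have /dS/differentiable_ccont/(_ _ eta0)[del del0 delP] : cmod (c - c) <= r.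
  by rewrite subrr cmod0 ltW.
(* The circle of radius expR x <= del / 2, on which Re S is close to Re (S c). *)
pose x := Num.min (ln r) (ln (del / 2)).
have xr : x <= ln r by rewrite /x ge_min lexx.
have near_c t : cre (S c) - (cre (S c) - k) / 2 <= cre (G (cpt x t)).
  have := delP (cexp (cpt x t)); rewrite cmod_cexp Re_cpt => H.
  have : expR x < del.
    rewrite (@le_lt_trans _ _ (del / 2))//; last by rewrite ltr_pdivrMr// ltr_pMr// ltr1n.
    rewrite -[leRHS](@lnK _ (del / 2)) ?posrE ?divr_gt0// ler_expR.
    by rewrite /x ge_min lexx orbT.
  move=> /H/(le_trans (Re_le_cmod _)); rewrite creD creN -/(G _) => /ler_normlP[+ _].
  lra.
have rect : rect_im G x 0 (ln r - x) (2 * pi) = 0.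
  apply: goursat; rewrite ?subr_ge0 ?mulr_ge0 ?pi_ge0//.
  by move=> s t /andP[_]; rewrite addrC subrK => sr _; exact: dG.
move: rect; rewrite /rect_im [x + (_ - x)]addrC subrK /G.
under [X in X - _ + _]eq_Rintegral do rewrite -cexp_2pi.
rewrite [X in X + _ - _]subrr add0r => /eqP; rewrite subr_eq0 => /eqP rE.
have U : sint 0 (0 + 2 * pi) (fun t => cre (G (cpt (ln r) t))) <= (0 + 2 * pi - 0) * k.
  apply: sint_ub; [exact: pi0|exact: cG|].
  by move=> t ti; apply: t0P; rewrite in_itv.
have L : (0 + 2 * pi - 0) * (cre (S c) - (cre (S c) - k) / 2) <=
    sint 0 (0 + 2 * pi) (fun t => cre (G (cpt x t))).
  by apply: sint_lb; [exact: pi0|exact: cG|].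
have pi1 : 0 < 2 * pi :> R by rewrite mulr_gt0// pi_gt0.
move: L; rewrite -rE => /le_trans/(_ U); rewrite subr0 add0r ler_pM2l//.
lra.
Qed.

End mean_value.

(** * Subharmonic functions and the maximum principle *)

Section subharmonic.
Context {R : realType}.
Implicit Types (S g : Cplx R -> Cplx R) (u v : Cplx R -> R) (z c w : Cplx R).

(** Subharmonicity in the form in which it is easiest to check and to use: v is
touched from below at w by the real part of a holomorphic function. *)
Definition subh_at v w := exists2 r : R, 0 < r & exists S,
  [/\ forall z, cmod (z - w) < r -> differentiable S z,
      cre (S w) = v w & forall z, cmod (z - w) < r -> cre (S z) <= v z].

Lemma differentiable_idc z : differentiable (fun w : Cplx R => w) z.
Proof. exact: ex_diff. Qed.

Lemma ccont_at_add u v w : ccont_at u w -> ccont_at v w ->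
  ccont_at (fun z => u z + v z) w.
Proof.
move=> cu cv e e0; have e2 : 0 < e / 2 by rewrite divr_gt0.
have [r r0 rP] := cu _ e2; have [q q0 qP] := cv _ e2.
exists (Num.min r q); first by rewrite lt_min r0.
move=> z; rewrite lt_min => /andP[/rP zr /qP zq].
by rewrite opprD addrACA (le_trans (ler_normD _ _))// [leRHS]splitr lerD.
Qed.

Lemma cmod_lip z w : `|cmod z - cmod w| <= cmod (z - w).
Proof.
apply/ler_normlP; split.
  by rewrite opprB lerBlDr cmodBC -[in leLHS](subrK z w) cmodD.
by rewrite lerBlDr -[in leLHS](subrK w z) cmodD.
Qed.

Lemma ccont_at_sqr_cmod w : ccont_at (fun z => cmod z ^+ 2) w.
Proof.
move=> e e0; pose K := 2 * cmod w + 1.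
have K0 : 0 < K by rewrite /K ltr_wpDl// mulr_ge0.
exists (Num.min 1 (e / K)); first by rewrite lt_min ltr01 divr_gt0.
move=> z; rewrite lt_min => /andP[z1 zK].
have D := cmod_lip z w.
rewrite subr_sqr normrM.
have -> : e = (e / K) * K by rewrite divfK// gt_eqF.
rewrite ler_pM//; first by rewrite (le_trans D)// ltW.
rewrite ger0_norm ?addr_ge0// /K mulr_natl mulr2n addrAC lerD2r.
have := le_trans (ler_norm _) D; move: z1; lra.
Qed.

Lemma ccont_at_scale v w (k : R) : ccont_at v w -> ccont_at (fun z => k * v z) w.
Proof.
move=> cv e e0; have K0 : 0 < `|k| + 1 by rewrite ltr_wpDl.
have [r r0 rP] := cv _ (divr_gt0 e0 K0).
exists r => // z /rP; rewrite -mulrBr normrM ler_pdivlMr// => H.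
rewrite (le_trans _ H)// mulrC ler_wpM2l// lerDl//.
Qed.

Lemma sqr_cmod_expand z w : cmod z ^+ 2 = cmod w ^+ 2 +
  2 * cre (cpt (cre w) (- cim w) * (z - w)) + cmod (z - w) ^+ 2.
Proof.
rewrite !sqr_cmod creM !Re_cpt !Im_cpt -!/(cre _) -!/(cim _) creD cimD creN cimN.
ring.
Qed.

(** Adding a small multiple of |z|^2 to v makes its circle means exceed the
value at the centre strictly, so that the maximum cannot be interior. *)
Lemma max_principle (K : set (Cplx R)) v (b : R) : closed_bounded K ->
  (forall w, K w -> ccont_at v w) ->
  (forall w, K w -> v w <= b \/
    (subh_at v w /\ exists2 r : R, 0 < r & forall z, cmod (z - w) < r -> K z)) ->
  forall w, K w -> v w <= b.
Proof.
move=> Kcb vc vK w1 Kw1; rewrite leNgt; apply/negP => bv.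
have [[M KM] _] := Kcb.
pose eta := (v w1 - b) / (2 * (M ^+ 2 + 1)).
have M0 : 0 < M ^+ 2 + 1 by rewrite ltr_wpDl ?sqr_ge0.
have eta0 : 0 < eta by rewrite divr_gt0 ?subr_gt0// mulr_gt0.
have etaM : eta * (2 * (M ^+ 2 + 1)) = v w1 - b by rewrite divfK// gt_eqF// mulr_gt0.
pose f z := v z + eta * cmod z ^+ 2.
have fc w : K w -> ccont_at f w.
  move=> /vc H; apply: ccont_at_add => //; apply: ccont_at_scale.
  exact: ccont_at_sqr_cmod.
have [|w0 Kw0 w0P] := max_exists Kcb fc; first by exists w1.
have [vb|[[r r0 [S [dS Sw Sv]]] [q q0 Kq]]] := vK _ Kw0.
  have := w0P _ Kw1; rewrite /f.
  have : cmod w0 ^+ 2 <= M ^+ 2 by rewrite ler_sqr ?nnegrE ?KM// (le_trans _ (KM _ Kw0)).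
  have := sqr_ge0 (cmod w1); nra.
pose s := Num.min r q / 2.
have rq0 : 0 < Num.min r q by rewrite lt_min r0.
have s0 : 0 < s by rewrite divr_gt0.
have srq : s < Num.min r q by rewrite ltr_pdivrMr// ltr_pMr// ltr1n.
have sr : s < r by apply: lt_le_trans srq _; rewrite ge_min lexx.
have sq : s < q by apply: lt_le_trans srq _; rewrite ge_min lexx orbT.
(* The support of v + eta |z|^2 at w0, up to the positive term
eta |z - w0|^2. *)
pose T z := S z + cpt (2 * eta) 0 * (cpt (cre w0) (- cim w0) * (z - w0)).
have dT z : cmod (z - w0) <= s -> differentiable T z.
  move=> zs; apply: differentiableD; first by apply: dS; exact: le_lt_trans sr.
  apply: differentiableM; first exact: differentiable_cst.
  apply: differentiableM; first exact: differentiable_cst.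
  by apply: differentiableB; [exact: differentiable_idc|exact: differentiable_cst].
have TE z : cre (T z) = cre (S z) + eta * (cmod z ^+ 2 - cmod w0 ^+ 2 - cmod (z - w0) ^+ 2).
  rewrite /T creD creM Re_cpt Im_cpt mul0r subr0 (sqr_cmod_expand z w0).
  by ring.
have [z zs] := Re_le_on_circle s0 dT.
rewrite !TE zs !subrr cmod0 Sw.
have zr : cmod (z - w0) < r by rewrite zs.
have := Sv _ zr.
have Kz : K z by apply: Kq; rewrite zs.
have := w0P _ Kz; rewrite /f.
have : 0 < eta * s ^+ 2 by rewrite mulr_gt0// exprn_gt0.
rewrite expr0n /=.
move: (cmod z ^+ 2) (cmod w0 ^+ 2) (s ^+ 2) (v z) (v w0) => *; nra.
Qed.

Lemma subh_at_re S w (r : R) : 0 < r ->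
  (forall z, cmod (z - w) < r -> differentiable S z) -> subh_at (fun z => cre (S z)) w.
Proof. by move=> r0 dS; exists r => //; exists S. Qed.

Lemma subh_at_add u v w : subh_at u w -> subh_at v w ->
  subh_at (fun z => u z + v z) w.
Proof.
move=> [r r0 [S [dS Sw Su]]] [q q0 [T [dT Tw Tv]]].
exists (Num.min r q); first by rewrite lt_min r0.
exists (fun z => S z + T z); split => [z|/=|z]; rewrite ?lt_min ?creD.
- by move=> /andP[/dS ? /dT ?]; exact: differentiableD.
- by rewrite Sw Tw.
- by move=> /andP[/Su ? /Tv ?]; exact: lerD.
Qed.

Lemma subh_at_scale v w (k : R) : 0 <= k -> subh_at v w ->
  subh_at (fun z => k * v z) w.
Proof.
move=> k0 [r r0 [S [dS Sw Su]]]; exists r => //.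
exists (fun z => cpt k 0 * S z); split => [z zr|/=|z zr].
- by apply: differentiableM; [exact: differentiable_cst|exact: dS].
- by rewrite creM Re_cpt Im_cpt mul0r subr0 Sw.
- by rewrite creM Re_cpt Im_cpt mul0r subr0 ler_wpM2l// Su.
Qed.

Lemma subh_at_rot v w c : cmod c = 1 -> subh_at v (c * w) ->
  subh_at (fun z => v (c * z)) w.
Proof.
move=> c1 [r r0 [S [dS Sw Sv]]]; exists r => //.
have H z : cmod (z - w) < r -> cmod (c * z - c * w) < r.
  by rewrite -mulrBr cmodM c1 mul1r.
exists (fun z => S (c * z)); split => [z /H/dS dz| |z /H/Sv]; [|by []|by []].
apply: (@differentiable_comp _ _ _ _ (fun z => c * z) S); last exact: dz.
by apply: differentiableM; [exact: differentiable_cst|exact: differentiable_idc].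
Qed.

Definition csqrt z : Cplx R := sqrtc z.

Lemma sqr_csqrt z : csqrt z * csqrt z = z.
Proof. by rewrite -expr2; exact: sqr_sqrtc. Qed.

Lemma csqrt_Re_gt0 z : 0 < cre z -> 0 < cre (csqrt z).
Proof.
case: z => a b; rewrite /csqrt /cre /= => a0.
by rewrite sqrtr_gt0 divr_gt0// ltr_wpDl.
Qed.

Lemma differentiable_csqrt z : 0 < cre z ->
  differentiable csqrt z.
Proof.
move=> z0; apply/differentiable_cderiv.
set s := csqrt z; have s0 : 0 < cre s by exact: csqrt_Re_gt0.
have sm : 0 < cmod s by apply: lt_le_trans s0 (le_trans (ler_norm _) (Re_le_cmod _)).
have sn0 : s != 0 by rewrite -cmod_gt0.
have sz : s * s = z by exact: sqr_csqrt.
exists ((2 * s)^-1) => e e0.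
pose K := 2 * cmod s * cre s ^+ 2.
have K0 : 0 < K by rewrite !mulr_gt0.
exists (Num.min (cre z) (e * K)); first by rewrite lt_min z0 mulr_gt0.
move=> h; rewrite lt_min => /andP[h1 h2].
have zh0 : 0 < cre (z + h).
  by rewrite creD; have := le_lt_trans (Re_le_cmod _) h1; rewrite ltr_norml; lra.
set t := csqrt (z + h); have t0 : 0 < cre t by exact: csqrt_Re_gt0.
have tz : t * t = z + h by exact: sqr_csqrt.
have hE : h = (t - s) * (t + s) by rewrite mulrDr !mulrBl sz tz [s * t]mulrC; ring.
have ts : cre s <= cmod (t + s).
  by apply: le_trans (le_trans (ler_norm _) (Re_le_cmod _)); rewrite creD lerDr ltW.
have -> : t - s - (2 * s)^-1 * h = - ((t - s) * (t - s) / (2 * s)).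
  by rewrite hE; field.
rewrite cmodN !cmodM cmodV cmodM.
have -> : cmod (2 : Cplx R) = 2.
  rewrite (_ : 2 = cpt 2 0 :> Cplx R); first by rewrite cmodE /= expr0n addr0 sqrtr_sqr ger0_norm.
  by apply: cplx_eq; rewrite /= ?addr0.
have D : cmod (t - s) * cre s <= cmod h.
  by rewrite hE cmodM ler_wpM2l.
rewrite ler_pdivrMr ?mulr_gt0// -(@ler_pM2r _ (cre s ^+ 2)) ?exprn_gt0//.
apply: (@le_trans _ _ (cmod h * cmod h)).
  rewrite expr2 mulrACA ler_pM// mulr_ge0//; exact: ltW.
apply: le_trans (ler_wpM2l (cmod_ge0 h) (ltW h2)) _.
by rewrite le_eqVlt; apply/orP; left; apply/eqP; rewrite /K; ring.
Qed.

(** Young's inequality for the exponents r and r / (r - 1), applied to t * 1. *)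
Lemma bernoulli_powR (t r : R) : 0 <= t -> 1 <= r -> 1 + r * (t - 1) <= t `^ r.
Proof.
move=> t0; rewrite le_eqVlt => /predU1P[<-|r1].
  by rewrite powRr1// mul1r addrC subrK.
have r0 : 0 < r by apply: lt_trans r1.
have rr : 0 < r / (r - 1) by rewrite divr_gt0// subr_gt0.
have rn0 : r != 0 by rewrite gt_eqF.
have rn1 : r - 1 != 0 by rewrite gt_eqF// subr_gt0.
have e1 : r^-1 + (r / (r - 1))^-1 = 1 by field; rewrite rn1 rn0.
have := @conjugate_powR _ t 1 r (r / (r - 1)) t0 ler01 r0 rr e1.
rewrite mulr1 powR1 invf_div mul1r -mulrDl ler_pdivlMr// => H; lra.
Qed.

(** Near a zero of g the constant 0 supports |g|^q. Elsewhere a holomorphic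
square root s of g / g w exists near w, and |s|^(2q) >= 1 + 2q (|s| - 1) >= Re
(1 + 2q (s - 1)) by Bernoulli's inequality. *)
Lemma subh_at_powR g w (r q : R) : 2^-1 <= q -> 0 < r ->
  (forall z, cmod (z - w) < r -> differentiable g z) ->
  subh_at (fun z => cmod (g z) `^ q) w.
Proof.
move=> q2 r0 dg; have q0 : 0 < q by apply: lt_le_trans q2; rewrite invr_gt0.
have [gw0|gw0] := eqVneq (g w) 0.
  exists r => //; exists (fun=> 0); split => [z _||z _].
  - exact: differentiable_cst.
  - by rewrite gw0 cmod0 powR0// gt_eqF.
  - exact: powR_ge0.
have /dg/differentiable_ccont/(_ (cmod (g w) / 2))[|d d0 dP] : cmod (w - w) < r.
- by rewrite subrr cmod0.
- by rewrite divr_gt0// cmod_gt0.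
have gm0 : 0 < cmod (g w) by rewrite cmod_gt0.
pose k z := (g w)^-1 * g z.
have kw : k w = 1 by rewrite /k mulVf.
have k0 z : cmod (z - w) < d -> 0 < cre (k z).
  move=> /dP; rewrite [w + _]addrC subrK => H.
  have : cmod (k z - 1) <= 2^-1.
    rewrite /k (_ : _ - 1 = (g w)^-1 * (g z - g w)); last by field.
    by rewrite cmodM cmodV mulrC ler_pdivrMr// mulrC.
  by move=> /(le_trans (Re_le_cmod _)) /ler_normlP[]; rewrite creD creN /cre /=; lra.
exists (Num.min r d); first by rewrite lt_min r0.
(* k = g / g w has positive real part near w, where the principal square root
is holomorphic. *)
exists (fun z => cpt (cmod (g w) `^ q) 0 * (1 + cpt (2 * q) 0 * (csqrt (k z) - 1))).
split => [z||z].
- rewrite lt_min => /andP[/dg dz /k0 kz].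
  apply: differentiableM; first exact: differentiable_cst.
  apply: differentiableD; first exact: differentiable_cst.
  apply: differentiableM; first exact: differentiable_cst.
  apply: differentiableB; last exact: differentiable_cst.
  apply: (@differentiable_comp _ _ _ _ k csqrt); last exact: differentiable_csqrt.
  by apply: differentiableM; [exact: differentiable_cst|].
- rewrite kw (_ : csqrt 1 = 1); last exact: sqrtc1.
  by rewrite subrr mulr0 addr0 mulr1 Re_cpt.
rewrite lt_min => /andP[_ /k0 kz].
rewrite !creM !Im_cpt !mul0r !subr0 !Re_cpt creD creM Im_cpt mul0r subr0 Re_cpt.
rewrite creD creN.
have -> : cmod (g z) `^ q = cmod (g w) `^ q * (cmod (csqrt (k z)) `^ (2 * q)).
  rewrite powRrM powR_mulrn// expr2 -cmodM sqr_csqrt -powRM//.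
  by rewrite -cmodM mulrA mulfV// mul1r.
rewrite ler_wpM2l ?powR_ge0//.
apply: le_trans (bernoulli_powR _ _) => //; last by rewrite -ler_pdivrMl ?mulr1.
rewrite (_ : cre 1 = 1)// lerD2l ler_wpM2l ?mulr_ge0 ?(ltW q0)// lerD2r.
exact: le_trans (ler_norm _) (Re_le_cmod _).
Qed.

Lemma powR_continuous (q t e : R) : 0 < q -> 0 <= t -> 0 < e ->
  exists2 d : R, 0 < d & forall s, 0 <= s -> `|s - t| < d -> `|s `^ q - t `^ q| <= e.
Proof.
move=> q0; rewrite le_eqVlt => /predU1P[<- e0|t0 e0].
  exists (e `^ q^-1); first exact: powR_gt0.
  move=> s s0; rewrite powR0 ?gt_eqF// !subr0 !ger0_norm ?powR_ge0// => se.
  rewrite -[leRHS](@powRr1 _ e) ?(ltW e0)// -(mulVf (lt0r_neq0 q0)) powRrM.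
  by apply: ge0_ler_powR; rewrite ?nnegrE ?powR_ge0// ltW.
have := is_derive1_powR q t0 => -[+ _] => /derivable1_diffP/differentiable_continuous.
move=> /cvgrPdist_le /(_ _ e0)/nbhs_normP[d /= d0 dP].
exists d => // s s0 st; rewrite distrC; apply: dP.
by rewrite /= distrC.
Qed.

Lemma ccont_at_powR g w (q : R) : 0 < q -> differentiable g w ->
  ccont_at (fun z => cmod (g z) `^ q) w.
Proof.
move=> q0 /differentiable_ccont dg e e0.
have [d d0 dP] := powR_continuous q0 (cmod_ge0 (g w)) e0.
have [r r0 rP] := dg _ (divr_gt0 d0 (ltr0n _ 2)).
exists r => // z /rP; rewrite [w + _]addrC subrK => H.
apply: dP => //; apply: le_lt_trans (cmod_lip _ _) (le_lt_trans H _).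
by rewrite ltr_pdivrMr// ltr_pMr// ltr1n.
Qed.

End subharmonic.

(** * Sums over discrete rotations *)

Section rotations.
Context {R : realType}.
Implicit Types (v : Cplx R -> R) (w z u : Cplx R).

Lemma unit_cexp u : cmod u = 1 -> exists2 t, 0 <= t <= 2 * pi & u = cexp (cpt 0 t).
Proof.
move=> u1.
have ab : cre u ^+ 2 + cim u ^+ 2 = 1 by rewrite -sqr_cmod u1 expr1n.
have a1 : -1 <= cre u <= 1 by rewrite -ler_norml -u1 Re_le_cmod.
have bE : Num.sqrt (1 - cre u ^+ 2) = `|cim u| by rewrite -ab addrC addKr sqrtr_sqr.
have ac : cos (acos (cre u)) = cre u by apply: acosK; rewrite in_itv.
have sn := sin_acos a1.
have acge := acos_ge0 a1; have acle := acos_lepi a1.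
have [b0|b0] := leP 0 (cim u).
  exists (acos (cre u)); first by lra.
  apply: cplx_eq; rewrite /cexp -!/(cre _) -!/(cim _) !Re_cpt !Im_cpt expR0 mul1r.
    by rewrite ac.
  by rewrite sn bE ger0_norm.
exists (2 * pi - acos (cre u)); first by lra.
have e2 : 2 * pi - acos (cre u) = - acos (cre u) + pi *+ 2.
  by rewrite mulr_natl addrC.
apply: cplx_eq; rewrite /cexp -!/(cre _) -!/(cim _) !Re_cpt !Im_cpt expR0 mul1r e2.
  by rewrite cosD2pi cosN ac.
by rewrite sinD2pi sinN sn bE ltr0_norm// opprK.
Qed.

Definition uroot (N j : nat) : Cplx R := cexp (cpt 0 (2 * pi * j%:R / N%:R)).

Lemma cmod_uroot N j : cmod (uroot N j) = 1.
Proof. by rewrite cmod_cexp Re_cpt expR0. Qed.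

Lemma uroot0 N : uroot N 0 = 1.
Proof.
rewrite /uroot mulr0 mul0r /cexp !Re_cpt !Im_cpt expR0 cos0 sin0 !mul1r.
exact: cplx_eq.
Qed.

Lemma urootD N j k : uroot N (j + k) = uroot N j * uroot N k.
Proof.
rewrite /uroot -cexpD; congr cexp; apply: cplx_eq; rewrite /= ?addr0//.
by rewrite natrD mulrDr mulrDl.
Qed.

Lemma urootN N : (0 < N)%N -> uroot N N = 1.
Proof.
move=> N0; rewrite /uroot mulfK ?pnatr_eq0 -?lt0n//.
rewrite -[2 * pi]add0r cexp_2pi /cexp !Re_cpt !Im_cpt expR0 cos0 sin0 !mul1r.
exact: cplx_eq.
Qed.

(** Sums over finitely many rotations replace circle means: unlike integrals
they are subharmonic for trivial reasons. *)
Definition rotsum (N : nat) v w := \sum_(j < N) v (uroot N j * w).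

Lemma rotsum_uroot N v w k : (0 < N)%N -> rotsum N v (uroot N k * w) = rotsum N v w.
Proof.
move=> N0; elim: k w => [|k IH] w.
  by rewrite uroot0 mul1r.
rewrite -addn1 urootD -mulrA IH /rotsum.
case: N N0 {IH} => // N _.
rewrite big_ord_recr big_ord_recl /= addrC; congr (_ + _).
  by rewrite mulrA -urootD addn1 urootN// uroot0.
by apply: eq_bigr => i _; rewrite mulrA -urootD /bump /= addn1 add1n.
Qed.

(** Relative density of the roots of unity: the error is measured in units of
the radius. *)
Definition uroot_dense (N : nat) (d : R) := forall w w', cmod w = cmod w' ->
  exists k, cmod (uroot N k * w - w') <= d * cmod w.

Lemma uroot_denseE (d : R) : 0 < d -> exists2 N, (0 < N)%N & uroot_dense N d.
Proof.
move=> d0; have [r r0 rP] := differentiable_ccont (differentiable_cexp (0 : Cplx R)) d0.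
have pi0 : 0 < 2 * pi :> R by rewrite mulr_gt0// pi_gt0.
exists (Num.bound (2 * pi / r)).+1 => // w w' ww'.
set N := _.+1; have N0 : 0 < N%:R :> R by rewrite ltr0n.
have Nr : 2 * pi / N%:R < r.
  rewrite ltr_pdivrMr// [r * _]mulrC -ltr_pdivrMr//.
  have q0 : 0 <= 2 * pi / r by rewrite divr_ge0// ltW.
  by apply: lt_trans (archi_boundP q0) _; rewrite /N ltr_nat.
have [w0|w0] := eqVneq w 0.
  exists 0%N; move: ww'; rewrite w0 cmod0 => /esym/eqP; rewrite cmod_eq0 => /eqP ->.
  by rewrite mulr0 subr0 cmod0 mulr0.
have wm : 0 < cmod w by rewrite cmod_gt0.
have [t /andP[t0 t2] tE] : exists2 t, 0 <= t <= 2 * pi & w' / w = cexp (cpt 0 t).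
  by apply: unit_cexp; rewrite cmodM cmodV ww' divff// -ww' gt_eqF.
have w'E : w' = cexp (cpt 0 t) * w by rewrite -tE divfK.
pose s := t * N%:R / (2 * pi).
have s0 : 0 <= s by rewrite /s divr_ge0 ?(ltW pi0)// mulr_ge0// ltW.
have tN : t = 2 * pi * s / N%:R.
  by rewrite /s [2 * pi * _]mulrC divfK ?gt_eqF// mulfK// gt_eqF.
pose k := Num.truncn s.
have /andP[k1 k2] := truncn_itv s0; rewrite -/k in k1 k2.
exists k; rewrite w'E -mulrBl cmodM ler_wpM2r//.
have -> : uroot N k - cexp (cpt 0 t) =
    cexp (cpt 0 t) * (cexp (0 + cpt 0 (2 * pi * k%:R / N%:R - t)) - cexp 0).
  rewrite mulrBr -!cexpD addr0 add0r; congr (cexp _ - _).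
  by apply: cplx_eq; rewrite /= ?addr0// addrC subrK.
rewrite cmodM cmod_cexp Re_cpt expR0 mul1r; apply: rP.
rewrite cmodE Re_cpt Im_cpt expr0n add0r sqrtr_sqr.
apply: le_lt_trans Nr; rewrite tN -mulrBl -mulrBr -mulrA mulrCA.
rewrite normrM -[leRHS]mul1r.
have -> : `|2 * pi / N%:R| = 2 * pi / N%:R :> R by rewrite ger0_norm// divr_ge0// ltW.
rewrite ler_pM2r ?divr_gt0//.
by move: k1 k2; rewrite -addn1 natrD ler_norml; lra.
Qed.

Lemma ccont_at_rot v w u : cmod u = 1 -> ccont_at v (u * w) ->
  ccont_at (fun z => v (u * z)) w.
Proof.
move=> u1 cv e /cv[r r0 rP]; exists r => // z zw.
by apply: rP; rewrite -mulrBr cmodM u1 mul1r.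
Qed.

Lemma ccont_at_sum n (F : nat -> Cplx R -> R) w : (forall j, ccont_at (F j) w) ->
  ccont_at (fun z => \sum_(j < n) F j z) w.
Proof.
move=> cF; elim: n => [|n IH].
  by move=> e e0; exists 1 => // z _; rewrite !big_ord0 subrr normr0 ltW.
have := ccont_at_add IH (cF n); congr ccont_at.
by apply/funext => z; rewrite big_ord_recr.
Qed.

Lemma subh_at_sum n (F : nat -> Cplx R -> R) w : (forall j, subh_at (F j) w) ->
  subh_at (fun z => \sum_(j < n) F j z) w.
Proof.
move=> cF; elim: n => [|n IH].
  exists 1 => //; exists (fun=> 0); split => [z _||z _]; rewrite ?big_ord0.
  - exact: differentiable_cst.
  - by [].
  - exact: lexx.
have := subh_at_add IH (cF n); congr subh_at.
by apply/funext => z; rewrite big_ord_recr.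
Qed.

Lemma disc_closed_bounded (r : R) : closed_bounded [set w : Cplx R | cmod w <= r].
Proof.
split; first by exists r.
move=> w /negP; rewrite -ltNge => rw; exists (cmod w - r); first by rewrite subr_gt0.
move=> z zw; apply/negP; rewrite -ltNge.
have := le_lt_trans (cmod_lip _ _) zw => /ltr_normlP[]; lra.
Qed.

(** A rotation sum of a subharmonic function is subharmonic and nearly constant
on circles, so the maximum principle makes it nearly increasing in the radius.
*)
Lemma rotsum_increasing v (r d e : R) N : (0 < N)%N -> uroot_dense N d ->
  (forall w, cmod w <= r -> ccont_at v w) ->
  (forall w, cmod w < r -> subh_at v w) ->
  (forall w w', cmod w <= r -> cmod w' = cmod w -> cmod (w' - w) <= d * cmod w ->
     `|v w' - v w| <= e) ->
  forall w1 w2, cmod w1 <= cmod w2 -> cmod w2 <= r ->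
    rotsum N v w1 <= rotsum N v w2 + N%:R * e.
Proof.
move=> N0 Nd cv sv ve w1 w2 w12 w2r.
pose b := rotsum N v w2 + N%:R * e.
have rw j (z : Cplx R) : cmod (uroot N j * z) = cmod z by rewrite cmodM cmod_uroot mul1r.
apply: (@max_principle _ [set w | cmod w <= cmod w2] (rotsum N v) b) => //.
- exact: disc_closed_bounded.
- move=> w /= ww2; apply: (@ccont_at_sum _ (fun j z => v (uroot N j * z))) => j.
  apply: ccont_at_rot; rewrite ?cmod_uroot//; apply: cv.
  by rewrite rw (le_trans ww2).
move=> w /=; rewrite le_eqVlt => /predU1P[ww2|ww2].
  left; have [k kP] := Nd _ _ (esym ww2).
  rewrite /b -(rotsum_uroot v w2 k N0) -lerBlDl /rotsum -sumrB.
  apply: (@le_trans _ _ (\sum_(j < N) e)); last first.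
    by rewrite sumr_const card_ord mulr_natl.
  apply: ler_sum => j _; apply: le_trans (ler_norm _) _.
  rewrite distrC; apply: ve; rewrite !rw ?ww2//.
  by rewrite -mulrBr rw (le_trans kP).
right; split.
  apply: (@subh_at_sum _ (fun j z => v (uroot N j * z))) => j.
  apply: subh_at_rot; rewrite ?cmod_uroot//; apply: sv.
  by rewrite rw (lt_le_trans ww2).
exists (cmod w2 - cmod w); first by rewrite subr_gt0.
by move=> z zw; have := le_lt_trans (cmod_lip _ _) zw => /ltr_normlP[]; lra.
Qed.

End rotations.

(** * Linear changes of variables *)

Section scaling_maps.
Context {R : realType}.

(** The change of variables formula for a map F with constant Jacobian 1 / k, as
a property of F that is stable under composition and products. *)
Definition scales d (T : measurableType d) (mu : {measure set T -> \bar R})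
    (F : T -> T) (k : R) :=
  measurable_fun setT F /\ forall h : T -> \bar R, measurable_fun setT h ->
    (forall x, (0 <= h x)%E) ->
    (\int[mu]_x h (F x) = k%:E * \int[mu]_x h x)%E.

Lemma scales_comp d (T : measurableType d) (mu : {measure set T -> \bar R})
    (F G : T -> T) (k l : R) :
  scales mu F k -> scales mu G l -> scales mu (F \o G) (k * l).
Proof.
move=> [mF Fk] [mG Gl]; split; first exact: (measurableT_comp mF mG).
move=> h mh h0; rewrite (Gl (h \o F) (measurableT_comp mh mF)).
  by rewrite Fk// EFinM muleA [(l%:E * _)%E]muleC.
by move=> x; exact: h0.
Qed.

Lemma scales_ext d (T : measurableType d) (mu : {measure set T -> \bar R})
    (F G : T -> T) (k : R) : F =1 G -> scales mu F k -> scales mu G k.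
Proof. by move=> /funext ->. Qed.

Let leb := (@lebesgue_measure R).

(** By uniqueness of Lebesgue measure it suffices to test half-open intervals.
*)
Let scales_lebesgue (F : measurableTypeR R -> measurableTypeR R) (k : R) :
  measurable_fun setT F -> 0 < k ->
  (forall a b : R, leb (F @^-1` `]a, b]%classic) = k%:E * leb `]a, b]%classic)%E ->
  scales leb F k.
Proof.
move=> mF k0 H; split=> // h mh h0.
have k1 : (k^-1%:E * k%:E = 1)%E by rewrite -EFinM mulVf// gt_eqF.
have kV : 0 <= k^-1 by rewrite invr_ge0 ltW.
pose m : {measure set (measurableTypeR R) -> \bar R} :=
  mscale (NngNum kV) (pushforward leb F).
have E A : measurable A -> leb A = m mF A.
  move=> mA; apply: lebesgue_measure_unique => // X [[a b] _ <-] /=.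
  change (leb `]a, b]%classic = (k^-1%:E * leb (F @^-1` `]a, b]%classic))%E).
  by rewrite H muleA k1 mul1e.
rewrite -[LHS](@ge0_integral_pushforward _ _ _ _ _ F mF leb setT h)//.
have -> : (\int[leb]_x h x = \int[m mF]_x h x)%E.
  by apply: eq_measure_integral => A mA _; exact: E.
rewrite (ge0_integral_mscale (pushforward leb F))//= muleA [(k%:E * _)%E]muleC k1 mul1e.
by [].
Qed.

Lemma scales_translate (c : R) :
  scales leb (fun x : measurableTypeR R => x + c : measurableTypeR R) 1.
Proof.
apply: scales_lebesgue => //; first exact: measurable_funD.
move=> a b; rewrite mul1e.
have -> : (fun x : measurableTypeR R => x + c : measurableTypeR R) @^-1` `]a, b]%classic = `]a - c, b - c]%classic.
  by apply/seteqP; split => x /=; rewrite !in_itv /= ltrBlDr lerBrDr.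
rewrite /leb !lebesgue_measure_itv /= !lte_fin ltrD2r.
by case: ifP => // _; rewrite -!EFinB; congr (_%:E); ring.
Qed.

Lemma scales_dilate (r : R) : 0 < r ->
  scales leb (fun x : measurableTypeR R => r * x : measurableTypeR R) r^-1.
Proof.
move=> r0; apply: scales_lebesgue => //; rewrite ?invr_gt0//; first exact: measurable_funM.
move=> a b.
have -> : (fun x : measurableTypeR R => r * x : measurableTypeR R) @^-1` `]a, b]%classic = `]a / r, b / r]%classic.
  by apply/seteqP; split => x /=; rewrite !in_itv /= ltr_pdivrMr// ler_pdivlMr// mulrC.
rewrite /leb !lebesgue_measure_itv /= !lte_fin ltr_pM2r ?invr_gt0//.
by case: ifP => _; rewrite ?mule0// -!EFinB -EFinM; congr (_%:E); ring.
Qed.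

End scaling_maps.

(** Fibrewise changes of variables, assembled by Tonelli's theorem. *)
Section skew_product.
Context {R : realType} d1 d2 (T1 : measurableType d1) (T2 : measurableType d2).
Variables (m1 : {sigma_finite_measure set T1 -> \bar R}).
Variables (m2 : {sigma_finite_measure set T2 -> \bar R}).

Let int_prod (h : T1 * T2 -> \bar R) : measurable_fun setT h ->
  (forall x, (0 <= h x)%E) ->
  (\int[m1 \x m2]_z h z = \int[m2]_y \int[m1]_x h (x, y))%E.
Proof. by move=> mh h0; rewrite fubini_tonelli1// -fubini_tonelli. Qed.

Lemma scales_skew1 (F : T2 -> T1 -> T1) (k : R) : 0 <= k ->
  measurable_fun setT (fun z : T1 * T2 => F z.2 z.1) ->
  (forall y, scales m1 (F y) k) ->
  scales (m1 \x m2)%E (fun z => (F z.2 z.1, z.2)) k.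
Proof.
move=> k0 mF sF.
have mG : measurable_fun setT (fun z : T1 * T2 => (F z.2 z.1, z.2)).
  by apply: measurable_fun_pair => //; exact: measurable_snd.
split=> // h mh h0.
rewrite (int_prod (h := fun z => h (F z.2 z.1, z.2))); last 2 first.
- exact: (measurableT_comp mh mG).
- by move=> z; exact: h0.
rewrite int_prod//=.
have k1 y : (\int[m1]_x h (F y x, y) = k%:E * \int[m1]_x h (x, y))%E.
  have [_ /(_ (fun x => h (x, y)))] := sF y; apply => //.
  exact: (measurableT_comp mh (pair2_measurable y)).
under eq_integral do rewrite k1.
rewrite ge0_integralZl_EFin//.
- by move=> y _; exact: integral_ge0.
- exact: measurable_fun_fubini_tonelli_G.
Qed.

Lemma scales_skew2 (F : T1 -> T2 -> T2) (k : R) : 0 <= k ->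
  measurable_fun setT (fun z : T1 * T2 => F z.1 z.2) ->
  (forall x, scales m2 (F x) k) ->
  scales (m1 \x m2)%E (fun z => (z.1, F z.1 z.2)) k.
Proof.
move=> k0 mF sF.
have mG : measurable_fun setT (fun z : T1 * T2 => (z.1, F z.1 z.2)).
  by apply: measurable_fun_pair => //; exact: measurable_fst.
split=> // h mh h0.
rewrite (fubini_tonelli1 (fun z => h (z.1, F z.1 z.2))); last 2 first.
- exact: (measurableT_comp mh mG).
- by move=> z; exact: h0.
rewrite fubini_tonelli1//= /fubini_F /=.
have k1 x : (\int[m2]_y h (x, F x y) = k%:E * \int[m2]_y h (x, y))%E.
  have [_ /(_ (fun y => h (x, y)))] := sF x; apply => //.
  exact: (measurableT_comp mh (pair1_measurable x)).
under eq_integral do rewrite k1.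
rewrite ge0_integralZl_EFin//.
- by move=> y _; exact: integral_ge0.
- exact: measurable_fun_fubini_tonelli_F.
Qed.

End skew_product.

Section plane_maps.
Context {R : realType}.
Implicit Types (c u : Cplx R).

Definition of_cplx c : Real2 R := (cre c, cim c).

Lemma to_cplxK (x : Real2 R) : of_cplx (to_cplx x) = x.
Proof. by case: x. Qed.

Lemma of_cplxK c : to_cplx (of_cplx c) = c.
Proof. by case: c. Qed.

Let measurable_coord1 d (T : measurableType d) (F : T -> Real2 R) :
  measurable_fun setT F -> measurable_fun setT (fun x => (F x).1).
Proof. by move=> mF; apply: (measurableT_comp measurable_fst mF). Qed.

Let measurable_coord2 d (T : measurableType d) (F : T -> Real2 R) :
  measurable_fun setT F -> measurable_fun setT (fun x => (F x).2).
Proof. by move=> mF; apply: (measurableT_comp measurable_snd mF). Qed.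

Lemma measurable_cmul d (T : measurableType d) u (F : T -> Real2 R) :
  measurable_fun setT F -> measurable_fun setT (fun x => of_cplx (u * to_cplx (F x))).
Proof.
move=> mF; rewrite /of_cplx; apply: measurable_fun_pair.
  apply: (@eq_measurable_fun _ _ _ _ _ (fun x => cre u * (F x).1 - cim u * (F x).2 : R)).
    by move=> x _; rewrite creM.
  by apply: measurable_funB; apply: measurable_funM => //; [exact: measurable_coord1|exact: measurable_coord2].
apply: (@eq_measurable_fun _ _ _ _ _ (fun x => cre u * (F x).2 + cim u * (F x).1 : R)).
  by move=> x _; rewrite cimM.
by apply: measurable_funD; apply: measurable_funM => //; [exact: measurable_coord2|exact: measurable_coord1].
Qed.

Lemma measurable_cadd d (T : measurableType d) (F G : T -> Real2 R) :
  measurable_fun setT F -> measurable_fun setT G ->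
  measurable_fun setT (fun x => of_cplx (to_cplx (F x) + to_cplx (G x))).
Proof.
move=> mF mG; rewrite /of_cplx; apply: measurable_fun_pair.
  apply: (@eq_measurable_fun _ _ _ _ _ (fun x => (F x).1 + (G x).1 : R)).
    by move=> x _; rewrite creD.
  by apply: measurable_funD; exact: measurable_coord1.
apply: (@eq_measurable_fun _ _ _ _ _ (fun x => (F x).2 + (G x).2 : R)).
  by move=> x _; rewrite cimD.
by apply: measurable_funD; exact: measurable_coord2.
Qed.

Let leb := (@lebesgue_measure R).

Lemma scales_cadd c : scales leb2 (fun x : Real2 R => of_cplx (to_cplx x + c)) 1.
Proof.
have H1 : scales leb2 (fun z : Real2 R => (z.1 + cre c, z.2) : Real2 R) 1.
  apply: (@scales_skew1 _ _ _ _ _ leb leb (fun _ x => x + cre c : measurableTypeR R)) => [//||y].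
    by apply: measurable_funD => //; exact: measurable_fst.
  exact: scales_translate.
have H2 : scales leb2 (fun z : Real2 R => (z.1, z.2 + cim c) : Real2 R) 1.
  apply: (@scales_skew2 _ _ _ _ _ leb leb (fun _ x => x + cim c : measurableTypeR R)) => [//||y].
    by apply: measurable_funD => //; exact: measurable_snd.
  exact: scales_translate.
have := scales_comp H1 H2; rewrite mulr1; apply: scales_ext => -[x y] /=.
by rewrite /of_cplx creD cimD.
Qed.

Lemma scales_cdilate (r : R) : 0 < r ->
  scales leb2 (fun x : Real2 R => of_cplx (cpt r 0 * to_cplx x)) (r ^- 2).
Proof.
move=> r0.
have H1 : scales leb2 (fun z : Real2 R => (r * z.1, z.2) : Real2 R) r^-1.
  apply: (@scales_skew1 _ _ _ _ _ leb leb (fun _ x => r * x : measurableTypeR R)) => [||y].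
  - by rewrite invr_ge0 ltW.
  - by apply: measurable_funM => //; exact: measurable_fst.
  - exact: scales_dilate.
have H2 : scales leb2 (fun z : Real2 R => (z.1, r * z.2) : Real2 R) r^-1.
  apply: (@scales_skew2 _ _ _ _ _ leb leb (fun _ x => r * x : measurableTypeR R)) => [||y].
  - by rewrite invr_ge0 ltW.
  - by apply: measurable_funM => //; exact: measurable_snd.
  - exact: scales_dilate.
have := scales_comp H1 H2; rewrite -expr2 exprVn; apply: scales_ext => -[x y] /=.
by rewrite /of_cplx creM cimM Re_cpt Im_cpt !mul0r subr0 addr0.
Qed.

(** A rotation with Im u <> 0 is a product of three shears, each of which
translates the fibres of a coordinate projection. *)
Let scales_crot_aux u : cmod u = 1 -> cim u != 0 ->
  scales leb2 (fun x : Real2 R => of_cplx (u * to_cplx x)) 1.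
Proof.
(* (1 t; 0 1) (1 0; Im u 1) (1 t; 0 1) is the matrix of the rotation. *)
move=> u1 b0; pose t := (cre u - 1) / cim u.
have ab : cre u ^+ 2 + cim u ^+ 2 = 1 by rewrite -sqr_cmod u1 expr1n.
have H1 (s : R) : scales leb2 (fun z : Real2 R => (z.1 + s * z.2, z.2) : Real2 R) 1.
  apply: (@scales_skew1 _ _ _ _ _ leb leb (fun y x => x + s * y : measurableTypeR R)) => [//||y].
    by apply: measurable_funD; [exact: measurable_fst|apply: measurable_funM => //; exact: measurable_snd].
  exact: scales_translate.
have H2 (s : R) : scales leb2 (fun z : Real2 R => (z.1, z.2 + s * z.1) : Real2 R) 1.
  apply: (@scales_skew2 _ _ _ _ _ leb leb (fun x y => y + s * x : measurableTypeR R)) => [//||y].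
    by apply: measurable_funD; [exact: measurable_snd|apply: measurable_funM => //; exact: measurable_fst].
  exact: scales_translate.
have := scales_comp (H1 t) (scales_comp (H2 (cim u)) (H1 t)).
rewrite !mulr1; apply: scales_ext => -[x y] /=.
have tb : t * cim u = cre u - 1 by rewrite divfK.
have E : y + cim u * (x + t * y) = cim u * x + cre u * y.
  by rewrite mulrDr mulrA [cim u * t]mulrC tb; ring.
rewrite E /of_cplx creM cimM (_ : cre (to_cplx (x, y)) = x)//.
rewrite (_ : cim (to_cplx (x, y)) = y)//; congr (_, _); last by rewrite addrC.
apply: (mulfI b0).
have -> : cim u * (x + t * y + t * (cim u * x + cre u * y)) =
  cim u * x + (t * cim u) * y + (t * cim u) * (cim u * x + cre u * y) by ring.
rewrite tb /=.
have -> : cim u * x + (cre u - 1) * y + (cre u - 1) * (cim u * x + cre u * y) =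
  cim u * cre u * x + (cre u ^+ 2 - 1) * y by ring.
by rewrite -ab; ring.
Qed.

Lemma scales_crot u : cmod u = 1 ->
  scales leb2 (fun x : Real2 R => of_cplx (u * to_cplx x)) 1.
Proof.
move=> u1; have [b0|b0] := eqVneq (cim u) 0; last exact: scales_crot_aux.
have i1 : cmod (cpt 0 1 : Cplx R) = 1 by rewrite cmodE Re_cpt Im_cpt expr0n expr1n add0r sqrtr1.
have a0 : cre u != 0.
  apply/eqP => a0; move: u1; rewrite cmodE a0 b0 expr0n addr0 sqrtr0 => /eqP.
  by rewrite eq_sym oner_eq0.
have s1 : scales leb2 (fun x : Real2 R => of_cplx (cpt 0 1 * to_cplx x)) 1.
  by apply: scales_crot_aux => //; rewrite Im_cpt oner_eq0.
have s2 : scales leb2 (fun x : Real2 R => of_cplx (cpt 0 (-1) * u * to_cplx x)) 1.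
  apply: scales_crot_aux.
    by rewrite cmodM u1 mulr1 cmodE Re_cpt Im_cpt expr0n sqrrN expr1n add0r sqrtr1.
  by rewrite cimM Re_cpt Im_cpt mul0r add0r mulN1r oppr_eq0.
have := scales_comp s1 s2; rewrite mulr1; apply: scales_ext => x /=.
rewrite of_cplxK !mulrA (_ : cpt 0 1 * cpt 0 (-1) = 1 :> Cplx R) ?mul1r//.
by apply: cplx_eq; rewrite -!/(cre _) -!/(cim _) (creM, cimM) !Re_cpt !Im_cpt /cre /cim /=; ring.
Qed.

End plane_maps.

Section space_maps.
Context {R : realType}.
Implicit Types (a b c d u : Cplx R).

Definition of_cplx2 (z : Cplx2 R) : Real4 R := (of_cplx z.1, of_cplx z.2).

Lemma of_cplx2K z : to_cplx2 (of_cplx2 z) = z.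
Proof. by case: z => z1 z2; rewrite /to_cplx2 !of_cplxK. Qed.

Lemma to_cplx2K (x : Real4 R) : of_cplx2 (to_cplx2 x) = x.
Proof. by case: x => x1 x2; rewrite /of_cplx2 !to_cplxK. Qed.

(** The complex 2 x 2 matrix (a b; c d) acting on R^4. *)
Definition mat4 a b c d (x : Real4 R) : Real4 R :=
  of_cplx2 (a * to_cplx x.1 + b * to_cplx x.2, c * to_cplx x.1 + d * to_cplx x.2).

Let scales_diag u c (k l : R) : 0 <= k -> 0 <= l ->
  scales leb2 (fun x : Real2 R => of_cplx (u * to_cplx x)) k ->
  scales leb2 (fun x : Real2 R => of_cplx (c * to_cplx x)) l ->
  scales leb4 (mat4 u 0 0 c) (k * l).
Proof.
move=> k0 l0 s1 s2.
have H1 : scales leb4 (fun x : Real4 R => (of_cplx (u * to_cplx x.1), x.2)) k.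
  apply: (@scales_skew1 _ _ _ _ _ leb2 leb2 (fun _ x => of_cplx (u * to_cplx x))) => // .
  exact: (measurable_cmul u measurable_fst).
have H2 : scales leb4 (fun x : Real4 R => (x.1, of_cplx (c * to_cplx x.2))) l.
  apply: (@scales_skew2 _ _ _ _ _ leb2 leb2 (fun _ x => of_cplx (c * to_cplx x))) => // .
  exact: (measurable_cmul c measurable_snd).
have := scales_comp H1 H2; apply: scales_ext => x /=.
by rewrite /mat4 /of_cplx2 /= !mul0r addr0 add0r.
Qed.

Lemma scales_rot4 u : cmod u = 1 -> scales leb4 (mat4 u 0 0 u) 1.
Proof. by move=> u1; rewrite -[1]mulr1; apply: scales_diag => //; exact: scales_crot. Qed.

Lemma scales_dilate4 (r : R) : 0 < r -> scales leb4 (mat4 (cpt r 0) 0 0 (cpt r 0)) (r ^- 4).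
Proof.
move=> r0; rewrite (_ : r ^- 4 = r ^- 2 * r ^- 2); last by rewrite -invfM -exprD.
have rn : 0 <= r ^- 2 by rewrite invr_ge0 exprn_ge0// ltW.
by apply: scales_diag => //; exact: scales_cdilate.
Qed.

(** A matrix of determinant 1 with c <> 0 is a product of three complex shears.
*)
Lemma scales_SL2 a b c d : c != 0 -> a * d - b * c = 1 -> scales leb4 (mat4 a b c d) 1.
Proof.
move=> c0 det.
have H1 (s : Cplx R) : scales leb4 (mat4 1 s 0 1) 1.
  have := @scales_skew1 _ _ _ _ _ leb2 leb2 (fun y x => of_cplx (to_cplx x + s * to_cplx y)) 1 ler01.
  case/(_ _ _)/Wrap.
  - have := measurable_cadd (@measurable_fst _ _ (Real2 R) (Real2 R)) (measurable_cmul s measurable_snd).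
    by apply: eq_measurable_fun => x _; rewrite of_cplxK.
  - by move=> y; exact: scales_cadd.
  by apply: scales_ext => x; rewrite /mat4 /of_cplx2 /= !mul1r mul0r add0r to_cplxK.
have H2 (s : Cplx R) : scales leb4 (mat4 1 0 s 1) 1.
  have := @scales_skew2 _ _ _ _ _ leb2 leb2 (fun x y => of_cplx (to_cplx y + s * to_cplx x)) 1 ler01.
  case/(_ _ _)/Wrap.
  - have := measurable_cadd (@measurable_snd _ _ (Real2 R) (Real2 R)) (measurable_cmul s measurable_fst).
    by apply: eq_measurable_fun => x _; rewrite of_cplxK.
  - by move=> y; exact: scales_cadd.
  by apply: scales_ext => x; rewrite /mat4 /of_cplx2 /= !mul1r mul0r addr0 to_cplxK addrC.
have := scales_comp (H1 ((a - 1) / c)) (scales_comp (H2 c) (H1 ((d - 1) / c))).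
rewrite !mulr1; apply: scales_ext => x /=.
rewrite /mat4 /= !of_cplxK; congr of_cplx2.
have -> : b = (a * d - 1) / c by rewrite -det; field.
by congr (_, _); field.
Qed.

Definition cconj u : Cplx R := cpt (cre u) (- cim u).

Lemma cmulJ u : u * cconj u = cpt (cmod u ^+ 2) 0.
Proof.
apply: cplx_eq; rewrite -!/(cre _) -!/(cim _) (creM, cimM) !Re_cpt !Im_cpt ?sqr_cmod; ring.
Qed.

Lemma cmod_conj u : cmod (cconj u) = cmod u.
Proof. by rewrite !cmodE Re_cpt Im_cpt sqrrN. Qed.

(** The unitary change of coordinates taking the first axis to the complex line
spanned by the unit vector (a, b). *)
Lemma scales_unitary a b : cmod a ^+ 2 + cmod b ^+ 2 = 1 ->
  scales leb4 (mat4 a (- cconj b) b (cconj a)) 1.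
Proof.
move=> ab1; have [b0|b0] := eqVneq b 0; last first.
  apply: scales_SL2 => //; rewrite mulNr opprK [cconj b * b]mulrC !cmulJ.
  by apply: cplx_eq; rewrite -!/(cre _) -!/(cim _) (creD, cimD) ?Re_cpt ?Im_cpt// addr0.
have a1 : cmod a = 1.
  move: ab1; rewrite b0 cmod0 expr0n addr0 => /eqP; rewrite sqrp_eq1//.
  by move=> /eqP.
rewrite b0 (_ : - cconj 0 = 0); last first.
  by apply: cplx_eq; rewrite /= ?oppr0.
by rewrite -[1]mulr1; apply: scales_diag => //; apply: scales_crot; rewrite ?cmod_conj.
Qed.

End space_maps.

(** * Measurability of continuous functions *)

Section open_measurable.
Context {R : realType}.
Implicit Types (z : Cplx2 R) (w : Cplx R).

Definition copen2 (U : set (Cplx2 R)) :=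
  forall z, U z -> exists2 r : R, 0 < r & forall z', near2 r z z' -> U z'.

Definition copen (U : set (Cplx R)) :=
  forall w, U w -> exists2 r : R, 0 < r & forall w', cmod (w' - w) < r -> U w'.

(** A countable family of boxes with rational centres, from which every open set
is assembled. *)
Let box (i : (rat * rat) * (rat * rat) * nat) : set (Real4 R) :=
  let: (q1, q2, (q3, q4), n) := i in
  let I q := `]ratr q - n.+1%:R^-1, ratr q + n.+1%:R^-1[%classic : set R in
  (I q1 `*` I q2) `*` (I q3 `*` I q4).

Let measurable_box i : measurable (box i).
Proof.
case: i => [[[q1 q2] [q3 q4]] n]; rewrite /box.
by do ?apply: measurableX; exact: measurable_itv.
Qed.

Let rat_near (x : R) n : exists q : rat, x \in `]ratr q - n.+1%:R^-1, ratr q + n.+1%:R^-1[.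
Proof.
have [|q] := @rat_in_itvoo R (x - n.+1%:R^-1) (x + n.+1%:R^-1).
  by rewrite ltrBlDr -addrA ltrDl addr_gt0 ?invr_gt0.
rewrite in_itv /= => /andP[q1 q2]; exists q; rewrite in_itv /=.
by move: q1 q2; rewrite ltrBlDr ltrBlDr => -> ->.
Qed.

Lemma measurable_copen2 (U : set (Cplx2 R)) : copen2 U ->
  measurable (to_cplx2 @^-1` U : set (Real4 R)).
Proof.
move=> oU.
have -> : to_cplx2 @^-1` U =
    \bigcup_(i in [set i | box i `<=` to_cplx2 @^-1` U]) box i.
  apply/seteqP; split=> [x Ux|x [i /= Ui]]; last exact: Ui.
  have [r r0 rP] := oU _ Ux.
  have [n nP] : exists n, n.+1%:R^-1 < r / 4.
    exists (Num.bound (4 / r)).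
    have b0 : 0 <= 4 / r by rewrite divr_ge0// ltW.
    rewrite -[ltRHS]invrK ltf_pV2 ?posrE ?invr_gt0 ?divr_gt0// invf_div.
    by apply: lt_trans (archi_boundP b0) _; rewrite ltr_nat.
  have [q1 P1] := rat_near x.1.1 n; have [q2 P2] := rat_near x.1.2 n.
  have [q3 P3] := rat_near x.2.1 n; have [q4 P4] := rat_near x.2.2 n.
  exists (((q1, q2), (q3, q4)), n) => /=; last by [].
  have D q (s t : R) : s \in `]ratr q - n.+1%:R^-1, ratr q + n.+1%:R^-1[ ->
      `](ratr q : R) - n.+1%:R^-1, ratr q + n.+1%:R^-1[%classic t -> `|t - s| < r / 2.
    rewrite /= !in_itv /= => /andP[s1 s2] /andP[t1 t2]; rewrite ltr_norml.
    move: s1 s2 t1 t2 nP; move: (ratr q : R) (n.+1%:R^-1 : R) => u e *.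
    apply/andP; split; lra.
  move=> y [[/(D _ _ _ P1) d1 /(D _ _ _ P2) d2] [/(D _ _ _ P3) d3 /(D _ _ _ P4) d4]].
  by apply: rP; split; apply: le_lt_trans (cmod_le_ReIm _) _;
    rewrite [ltRHS]splitr ltrD.
rewrite bigcup_mkcond; apply: countable_bigcupT_measurable => [|i].
  exact: countableP.
by case: ifP => _; [exact: measurable_box|exact: measurable0].
Qed.

Lemma measurable_copen (U : set (Cplx R)) : copen U ->
  measurable (to_cplx @^-1` U : set (Real2 R)).
Proof.
move=> oU; have m2 : measurable (to_cplx2 @^-1` [set z | U z.1] : set (Real4 R)).
  apply: measurable_copen2 => z /oU[r r0 rP]; exists r => // z' [z1 _].
  exact: rP.
have := @pair2_measurable _ _ (Real2 R) (Real2 R) (of_cplx 0).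
by move=> /(_ measurableT _ m2); rewrite setTI.
Qed.

Lemma measurable_ccont2 (U : set (Cplx2 R)) (f : Cplx2 R -> R) : copen2 U ->
  (forall z, U z -> ccont_at2 f z) ->
  measurable_fun (to_cplx2 @^-1` U : set (Real4 R)) (fun x => f (to_cplx2 x)).
Proof.
move=> oU fc; apply: (measurability _ (RGenOInfty.measurableE R)) => _ [_ [a ->] <-].
rewrite (_ : _ `&` _ = to_cplx2 @^-1` [set z | U z /\ a < f z]); last first.
  by apply/seteqP; split => x /=; rewrite in_itv /= andbT.
apply: measurable_copen2 => z [Uz az].
have [r r0 rP] := oU _ Uz; have d0 : 0 < (f z - a) / 2 by rewrite divr_gt0// subr_gt0.
have [q q0 qP] := fc _ Uz _ d0.
exists (Num.min r q); first by rewrite lt_min r0.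
move=> z'; rewrite /near2 !lt_min => -[/andP[? ?] /andP[? ?]]; split; first exact: rP.
have : `|f z' - f z| <= (f z - a) / 2 by exact: qP.
move: az d0 => + + /ler_normlP[]; lra.
Qed.

Lemma measurable_ccont (U : set (Cplx R)) (f : Cplx R -> R) : copen U ->
  (forall w, U w -> ccont_at f w) ->
  measurable_fun (to_cplx @^-1` U : set (Real2 R)) (fun x => f (to_cplx x)).
Proof.
move=> oU fc; apply: (measurability _ (RGenOInfty.measurableE R)) => _ [_ [a ->] <-].
rewrite (_ : _ `&` _ = to_cplx @^-1` [set w | U w /\ a < f w]); last first.
  by apply/seteqP; split => x /=; rewrite in_itv /= andbT.
apply: measurable_copen => z [Uz az].
have [r r0 rP] := oU _ Uz; have d0 : 0 < (f z - a) / 2 by rewrite divr_gt0// subr_gt0.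
have [q q0 qP] := fc _ Uz _ d0.
exists (Num.min r q); first by rewrite lt_min r0.
move=> z'; rewrite lt_min => /andP[? ?]; split; first exact: rP.
have : `|f z' - f z| <= (f z - a) / 2 by exact: qP.
move: az d0 => + + /ler_normlP[]; lra.
Qed.

End open_measurable.

(** * Mean values over rotation invariant plane sets *)

Section invariant_sets.
Context {R : realType} d (T : measurableType d) (mu : {measure set T -> \bar R}).

Lemma scales_integral (F : T -> T) (k : R) (E : set T) (h : T -> \bar R) :
  scales mu F k -> measurable E -> measurable_fun E h ->
  (forall x, E x -> (0 <= h x)%E) ->
  (\int[mu]_(x in F @^-1` E) h (F x) = k%:E * \int[mu]_(x in E) h x)%E.
Proof.
move=> [mF sF] mE mh h0; rewrite integral_mkcond [in RHS]integral_mkcond -sF.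
- apply: eq_integral => x _; rewrite /patch.
  by rewrite (_ : (x \in F @^-1` E) = (F x \in E)).
- exact/(measurable_restrictT h mE).1.
- by move=> x; rewrite /patch; case: ifPn => // /set_mem /h0.
Qed.

Lemma scales_measure (F : T -> T) (k : R) (E : set T) :
  scales mu F k -> measurable E -> mu (F @^-1` E) = (k%:E * mu E)%E.
Proof.
move=> sF mE; have mFE : measurable (F @^-1` E).
  by have [mF _] := sF; rewrite -[X in measurable X]setTI; exact: mF.
have := scales_integral sF mE (measurable_cst 1%E) (fun _ _ => lee01).
by rewrite !integral_cst// !mul1e.
Qed.

(** Averaging over measure preserving maps does not change an integral; the maps
are rotations below. *)
Lemma integral_orbit_sum (N : nat) (F : nat -> T -> T) (E : set T) (h : T -> R) :
  (forall j, scales mu (F j) 1) -> (forall j, F j @^-1` E = E) ->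
  measurable E -> measurable_fun E h -> (forall x, E x -> 0 <= h x) ->
  (\int[mu]_(x in E) (\sum_(j < N) h (F j x))%:E =
   N%:R%:E * \int[mu]_(x in E) (h x)%:E)%E.
Proof.
move=> sF FE mE mh h0.
have mhE : measurable_fun E (EFin \o h) by exact/measurable_EFinP.
have mhF j : measurable_fun E (fun x => (h (F j x))%:E).
  have [mF _] := sF j.
  apply: (@measurable_comp _ _ _ _ _ _ E _ _ (F j) mE _ mhE) => [_ [x Ex <-]|].
    by have : (F j @^-1` E) x by rewrite FE.
  exact: measurable_funTS.
under eq_integral do rewrite -sumEFin.
have h0F (j : nat) x : E x -> (0 <= (h (F j x))%:E)%E.
  by move=> Ex; rewrite lee_fin h0//; have : (F j @^-1` E) x by rewrite FE.
rewrite (ge0_integral_sum mu mE (fun j : 'I_N => mhF j) (fun j : 'I_N => @h0F j)).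
have Ej (j : nat) : (\int[mu]_(x in E) (h (F j x))%:E = \int[mu]_(x in E) (h x)%:E)%E.
  by have := scales_integral (sF j) mE mhE h0; rewrite FE mul1e.
under eq_bigr do rewrite Ej.
by rewrite sumr_const card_ord mule_natl.
Qed.

End invariant_sets.

Section area_means.
Context {R : realType}.
Implicit Types (v : Cplx R -> R) (w : Cplx R).

Definition radial_set (E : set (Real2 R)) :=
  forall c x, cmod c = 1 -> E (of_cplx (c * to_cplx x)) <-> E x.

Lemma integral_rotsum N v (E : set (Real2 R)) : radial_set E -> measurable E ->
  measurable_fun E (fun x => v (to_cplx x)) -> (forall x, E x -> 0 <= v (to_cplx x)) ->
  (\int[leb2]_(x in E) (rotsum N v (to_cplx x))%:E =
   N%:R%:E * \int[leb2]_(x in E) (v (to_cplx x))%:E)%E.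
Proof.
move=> rE mE mv v0.
pose F (j : nat) (x : Real2 R) := of_cplx (uroot N j * to_cplx x).
have sF j : scales leb2 (F j) 1 by apply: scales_crot; exact: cmod_uroot.
have FE j : F j @^-1` E = E.
  by apply/seteqP; split => x; apply rE; exact: cmod_uroot.
rewrite -(integral_orbit_sum N sF FE mE mv v0).
by apply: eq_integral => x _; under eq_bigr do rewrite /F of_cplxK.
Qed.

Let rotsum0 N v : rotsum N v 0 = N%:R * v 0.
Proof.
by rewrite /rotsum; under eq_bigr do rewrite mulr0; rewrite sumr_const card_ord mulr_natl.
Qed.

(** Uniform continuity provides the number of rotations that brings the error e
of the rotation sums below any bound. *)
Lemma rotsum_modulus v (r e : R) : (forall w, cmod w <= r -> ccont_at v w) ->
  0 <= r -> 0 < e ->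
  exists d N, [/\ (0 < N)%N, uroot_dense N d & forall w w', cmod w <= r ->
    cmod w' = cmod w -> cmod (w' - w) <= d * cmod w -> `|v w' - v w| <= e].
Proof.
move=> cv r0 e0.
have [q q0 qP] := uniform_continuity (disc_closed_bounded r) cv e0.
have r1 : 0 < r + 1 by rewrite ltr_wpDl.
have d0 : 0 < q / (r + 1) by rewrite divr_gt0.
have [N N0 Nd] := uroot_denseE d0.
exists (q / (r + 1)), N; split => // w w' wr w'w ww'.
apply: qP => //; apply: le_lt_trans ww' _.
by rewrite mulrAC ltr_pdivrMr// ltr_pM2l// (le_lt_trans wr)// ltrDl.
Qed.

Lemma lee_eps_measure (a b l : \bar R) : (0 <= l)%E -> (l < +oo)%E ->
  (forall e : R, 0 < e -> (a <= b + e%:E * l)%E) -> (a <= b)%E.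
Proof.
move=> l0 loo H; apply/lee_addgt0Pr => e e0.
case: l l0 loo H => [l| |]//; rewrite lee_fin => l0 _ H.
have l1 : 0 < l + 1 by rewrite ltr_wpDl.
apply: le_trans (H _ (divr_gt0 e0 l1)) _; apply: leeD => //.
by rewrite -EFinM lee_fin mulrAC ler_pdivrMr// ler_wpM2l ?(ltW e0)// lerDl.
Qed.

(** The rotation sums are nearly increasing in the radius and have the same
integral over a rotation invariant set as N v; divide by N and let the error
tend to 0. *)
Lemma area_submean v (r : R) (E : set (Real2 R)) :
  (forall w, cmod w <= r -> ccont_at v w) -> (forall w, cmod w < r -> subh_at v w) ->
  radial_set E -> measurable E -> (leb2 E < +oo)%E ->
  (forall x, E x -> cmod (to_cplx x) <= r) ->
  measurable_fun E (fun x => v (to_cplx x)) -> (forall x, E x -> 0 <= v (to_cplx x)) ->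
  ((v 0)%:E * leb2 E <= \int[leb2]_(x in E) (v (to_cplx x))%:E)%E.
Proof.
move=> cv sv rE mE Eoo Er mv v0.
have [r0|r0] := ltP r 0.
  have -> : E = set0.
    by apply/seteqP; split => // x /Er /(le_trans (cmod_ge0 _)); rewrite leNgt r0.
  by rewrite measure0 mule0 integral_set0.
apply: (@lee_eps_measure _ _ (leb2 E)) => // e e0.
have [d [N [N0 Nd Ne]]] := rotsum_modulus cv r0 e0.
have NR0 : 0 < N%:R :> R by rewrite ltr0n.
have mvE : measurable_fun E (fun x => (v (to_cplx x))%:E) by exact/measurable_EFinP.
rewrite -(@lee_pmul2l _ N%:R%:E)//.
have I0 : (0 <= \int[leb2]_(x in E) (v (to_cplx x))%:E)%E.
  by apply: integral_ge0 => x /v0; rewrite lee_fin.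
have L0 : (0 <= e%:E * leb2 E)%E by rewrite mule_ge0// lee_fin ltW.
rewrite (ge0_muleDr _ I0 L0).
rewrite -(integral_rotsum N rE)// !muleA -!EFinM -rotsum0.
have rs0 x : E x -> 0 <= rotsum N v (to_cplx x).
  move=> Ex; apply: sumr_ge0 => j _; rewrite -[_ * _]of_cplxK; apply: v0.
  by apply rE => //; exact: cmod_uroot.
have mrs : measurable_fun E (fun x => rotsum N v (to_cplx x)).
  apply: measurable_sum => j.
  have [mF _] := @scales_crot R _ (cmod_uroot N j).
  have : measurable_fun E (v \o to_cplx \o (fun x => of_cplx (uroot N j * to_cplx x))).
    apply: (@measurable_comp _ _ _ _ _ _ E) => //; last exact: measurable_funTS.
    by move=> _ [x Ex <-]; apply rE => //; exact: cmod_uroot.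
  by apply: eq_measurable_fun => x _ /=; rewrite of_cplxK.
have Ne0 : 0 <= N%:R * e by rewrite mulr_ge0// ltW.
have mrsE : measurable_fun E (fun x => (rotsum N v (to_cplx x))%:E) by exact/measurable_EFinP.
rewrite -!integral_cst// -ge0_integralD//.
have [v00|v00] := leP 0 (rotsum N v 0); last first.
  apply: (@le_trans _ _ 0%E).
    by rewrite integral_cst// mule_le0_ge0// lee_fin ltW.
  by apply: integral_ge0 => x Ex; rewrite -EFinD lee_fin addr_ge0 ?rs0.
apply: ge0_le_integral => //.
  by apply: emeasurable_funD.
move=> x Ex; rewrite -EFinD lee_fin.
apply: (rotsum_increasing N0 Nd cv sv Ne); last exact: Er.
by rewrite cmod0.
Qed.

(** The sub-mean value inequality for M - Re S, where M is the maximum of Re S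
on the disc. *)
Lemma area_mean_le S (r : R) (E : set (Real2 R)) :
  (forall w, cmod w <= r -> differentiable (S : Cplx R -> Cplx R) w) ->
  radial_set E -> measurable E -> (leb2 E < +oo)%E ->
  (forall x, E x -> cmod (to_cplx x) <= r) ->
  measurable_fun E (fun x => cre (S (to_cplx x))) ->
  (forall x, E x -> 0 <= cre (S (to_cplx x))) ->
  (\int[leb2]_(x in E) (cre (S (to_cplx x)))%:E <= (cre (S 0%R))%:E * leb2 E)%E.
Proof.
move=> dS rE mE Eoo Er mS S0.
have [r0|r0] := ltP r 0.
  have -> : E = set0.
    by apply/seteqP; split => // x /Er /(le_trans (cmod_ge0 _)); rewrite leNgt r0.
  by rewrite measure0 mule0 integral_set0.
have cS w : cmod w <= r -> ccont_at (fun z => cre (S z)) w.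
  move=> /dS/differentiable_ccont H e /H[q q0 qP]; exists q => // z /qP.
  rewrite [w + _]addrC subrK; apply: le_trans; exact: Re_lip.
have [|w0 _ w0P] := max_exists (disc_closed_bounded r) cS.
  by exists 0; rewrite /= cmod0.
pose M := cre (S w0); pose v w := M - cre (S w).
have vE w : v w = cre (cpt M 0 - S w) by rewrite creD creN.
have vc w : cmod w <= r -> ccont_at v w.
  move=> /cS H e /H[q q0 qP]; exists q => // z /qP.
  by rewrite /v opprD addrACA subrr add0r -opprD normrN.
have vs w : cmod w < r -> subh_at v w.
  move=> wr; rewrite (_ : v = fun w => cre (cpt M 0 - S w)); last exact/funext.
  apply: (@subh_at_re _ (fun w => cpt M 0 - S w) w (r - cmod w)).
    by rewrite subr_gt0.
  move=> z zw; apply: differentiableB; first exact: differentiable_cst.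
  by apply: dS; have := le_lt_trans (cmod_lip _ _) zw => /ltr_normlP[]; lra.
have v0 x : E x -> 0 <= v (to_cplx x) by move=> /Er xr; rewrite subr_ge0 w0P.
have mv : measurable_fun E (fun x => v (to_cplx x)) by exact: measurable_funB.
have := area_submean vc vs rE mE Eoo Er mv v0.
have Ipos : (0 <= \int[leb2]_(x in E) (cre (S (to_cplx x)))%:E)%E.
  by apply: integral_ge0 => x /S0; rewrite lee_fin.
have Jpos : (0 <= \int[leb2]_(x in E) (v (to_cplx x))%:E)%E.
  by apply: integral_ge0 => x /v0; rewrite lee_fin.
have : (\int[leb2]_(x in E) (v (to_cplx x))%:E +
    \int[leb2]_(x in E) (cre (S (to_cplx x)))%:E = M%:E * leb2 E)%E.
  rewrite -ge0_integralD//; [|exact/measurable_EFinP|exact/measurable_EFinP].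
  rewrite -integral_cst//; apply: eq_integral => x _.
  by rewrite -EFinD /v subrK.
have : (0 <= leb2 E)%E by [].
move: (leb2 E) Eoo => [l| |]// _ _.
move: (integral _ _ _) (integral _ _ _) Ipos Jpos => [i| |]// [j| |]// _ _.
rewrite -!EFinM !lee_fin => -[] e; rewrite /v mulrBl; move: e.
move: (M * l) (cre (S 0) * l) => *; lra.
Qed.

End area_means.

(** * Areas of discs and annuli *)

Section disc_measure.
Context {R : realType}.
Implicit Types (c a b : R).

(** The parameter is the squared radius, so that areas are linear in c. *)
Definition disc2 c : set (Real2 R) := [set x | cmod (to_cplx x) ^+ 2 < c].

Definition annulus a b : set (Real2 R) := [set x | a <= cmod (to_cplx x) ^+ 2 < b].

Let sqr_to_cplx (x : Real2 R) : cmod (to_cplx x) ^+ 2 = x.1 ^+ 2 + x.2 ^+ 2.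
Proof. by rewrite sqr_cmod. Qed.

Lemma measurable_sqr_cmod : measurable_fun setT (fun x : Real2 R => cmod (to_cplx x) ^+ 2).
Proof.
apply: (@eq_measurable_fun _ _ _ _ _ (fun x : Real2 R => x.1 ^+ 2 + x.2 ^+ 2 : R)).
  by move=> x _; rewrite sqr_to_cplx.
by apply: measurable_funD; apply: measurable_funX; [exact: measurable_fst|exact: measurable_snd].
Qed.

Lemma measurable_disc2 c : measurable (disc2 c).
Proof.
rewrite (_ : disc2 c = setT `&` (fun x => cmod (to_cplx x) ^+ 2) @^-1` `]-oo, c[%classic).
  by apply: measurable_sqr_cmod => //; exact: measurable_itv.
by apply/seteqP; split => x /=; rewrite in_itv /=; [split|case].
Qed.

Lemma annulusE a b : annulus a b = disc2 b `\` disc2 a.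
Proof.
apply/seteqP; split => x; rewrite /annulus /disc2 /=.
  by move=> /andP[ax xb]; split => //; apply/negP; rewrite -leNgt.
by move=> [xb /negP]; rewrite -leNgt xb andbT.
Qed.

Lemma measurable_annulus a b : measurable (annulus a b).
Proof. by rewrite annulusE; apply: measurableD; exact: measurable_disc2. Qed.

Let leb2_square (s : R) : 0 < s ->
  leb2 (`]- s, s[%classic `*` `]- s, s[%classic : set (Real2 R)) = ((s + s) * (s + s))%:E.
Proof.
move=> s0; rewrite /leb2 product_measure1E//.
have L : lebesgue_measure (`]- s, s[%classic : set R) = (s + s)%:E.
  by rewrite lebesgue_measure_itv /= lte_fin gtrN//= -EFinB opprK.
by transitivity ((s + s)%:E * (s + s)%:E)%E => //; congr (_ * _)%E; exact: L.
Qed.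

(** The area pi of the unit disc, as an abstract positive constant. *)
Definition disc_area : R := fine (leb2 (disc2 1)).

Let disc2_1 : leb2 (disc2 1) = disc_area%:E.
Proof.
rewrite fineK// ge0_fin_numE//.
apply: (@le_lt_trans _ _ (leb2 (`]- 2, 2[%classic `*` `]- 2, 2[%classic : set (Real2 R)))).
  apply: le_measure; rewrite ?inE; first exact: measurable_disc2.
    by apply: measurableX; exact: measurable_itv.
  move=> x; rewrite /disc2 /= sqr_to_cplx => x1.
  by split; rewrite /= in_itv /= -ltr_norml -ltr_sqr ?nnegrE// real_normK ?num_real//;
    have := sqr_ge0 x.1; have := sqr_ge0 x.2; lra.
by rewrite leb2_square// ltry.
Qed.

Lemma disc_area_gt0 : 0 < disc_area.
Proof.
rewrite -lte_fin -disc2_1.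
apply: (@lt_le_trans _ _ (leb2 (`]- 2^-1, 2^-1[%classic `*` `]- 2^-1, 2^-1[%classic : set (Real2 R)))).
  by rewrite leb2_square// lte_fin mulr_gt0// addr_gt0.
apply: le_measure; rewrite ?inE; last 2 first.
- exact: measurable_disc2.
- move=> x [/= ]; rewrite !in_itv /= -!ltr_norml /disc2 /= sqr_to_cplx => x1 x2.
  rewrite -[x.1 ^+ 2]real_normK ?num_real// -[x.2 ^+ 2]real_normK ?num_real//.
  by have := normr_ge0 x.1; have := normr_ge0 x.2; nra.
by apply: measurableX; exact: measurable_itv.
Qed.

(** Dilations scale areas by the square of the ratio. *)
Lemma leb2_disc2 c : 0 <= c -> leb2 (disc2 c) = (disc_area * c)%:E.
Proof.
rewrite le_eqVlt => /predU1P[<-|c0].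
  rewrite mulr0 (_ : disc2 0 = set0) ?measure0//.
  by apply/seteqP; split => // x; rewrite /disc2 /= ltNge sqr_ge0.
have s0 : 0 < Num.sqrt c by rewrite sqrtr_gt0.
have := scales_measure (scales_cdilate s0) (measurable_disc2 c).
have -> : (fun x : Real2 R => of_cplx (cpt (Num.sqrt c) 0 * to_cplx x)) @^-1` disc2 c = disc2 1.
  have cE : cmod (cpt (Num.sqrt c) 0) ^+ 2 = c.
    by rewrite sqr_cmod Re_cpt Im_cpt expr0n addr0 sqr_sqrtr// ltW.
  by apply/seteqP; split => x; rewrite /disc2 /= of_cplxK cmodM exprMn cE;
    rewrite -{2}[c]mulr1 ltr_pM2l.
move=> H; have {H} : leb2 (disc2 1) = ((Num.sqrt c ^- 2)%:E * leb2 (disc2 c))%E := H.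
rewrite disc2_1 sqr_sqrtr ?(ltW c0)// => H.
by rewrite mulrC EFinM H muleA -EFinM mulfV ?mul1e// gt_eqF.
Qed.

Lemma leb2_annulus a b : 0 <= a <= b -> leb2 (annulus a b) = (disc_area * (b - a))%:E.
Proof.
move=> /andP[a0 ab]; rewrite annulusE measureD//=; [|exact: measurable_disc2|exact: measurable_disc2|].
- rewrite setIidr; last by move=> x; rewrite /disc2 /= => /lt_le_trans; apply.
  by rewrite !leb2_disc2// ?(le_trans a0)// -EFinB mulrBr.
- by rewrite leb2_disc2 ?(le_trans a0)// ltry.
Qed.

Lemma radial_annulus a b : radial_set (annulus a b).
Proof. by move=> c x c1; rewrite /annulus /= of_cplxK cmodM c1 mul1r. Qed.

Lemma radial_disc2 a : radial_set (disc2 a).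
Proof. by move=> c x c1; rewrite /disc2 /= of_cplxK cmodM c1 mul1r. Qed.

End disc_measure.

(** * The ball and its surface measure *)

Section ball_geometry.
Context {R : realType}.
Implicit Types (z : Cplx2 R) (c w : Cplx R) (x : Real4 R) (a b r : R).

Lemma ccont_at2_comp_powR (f : Cplx2 R -> Cplx R) z (q : R) : 0 < q ->
  differentiable f z -> ccont_at2 (fun z => cmod (f z) `^ q) z.
Proof.
move=> q0 /differentiable_continuous cf e e0.
have [d d0 dP] := powR_continuous q0 (cmod_ge0 (f z)) e0.
have dC0 : 0 < (d%:C)%C :> R[i] by rewrite ltcR.
have /cvgrPdist_lt/(_ _ dC0)/nbhs_ballP[r /= r0 rP] := cf.
have rr : (complex.Re r)%:C%C = r by apply: RRe_real; exact: gtr0_real.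
have r0' : 0 < complex.Re r by rewrite -ltcR rr.
exists (complex.Re r) => // z' [z1 z2]; apply: dP => //.
have : (`|f z - f z'| : R[i]) < (d%:C)%C.
  apply: rP; split; rewrite /= -ball_normE /= -rr cmod_norm ltcR cmodBC //.
rewrite cmod_norm ltcR cmodBC => H.
exact: le_lt_trans (cmod_lip _ _) H.
Qed.

Lemma sqnorm_ge0 z : 0 <= sqnorm z.
Proof. by rewrite addr_ge0 ?sqr_ge0. Qed.

Lemma ccont_at2_sqnorm z : ccont_at2 sqnorm z.
Proof.
move=> e e0; have e2 : 0 < e / 2 by rewrite divr_gt0.
have [r r0 rP] := ccont_at_sqr_cmod z.1 e2.
have [s s0 sP] := ccont_at_sqr_cmod z.2 e2.
exists (Num.min r s); first by rewrite lt_min r0.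
move=> z'; rewrite /near2 !lt_min => -[/andP[/rP H1 _] /andP[_ /sP H2]].
by rewrite /sqnorm opprD addrACA (le_trans (ler_normD _ _))// [leRHS]splitr lerD.
Qed.

Lemma copen2_ball a : copen2 [set z | sqnorm z < a].
Proof.
move=> z /= za; have d0 : 0 < (a - sqnorm z) / 2 by rewrite divr_gt0// subr_gt0.
have [r r0 rP] := ccont_at2_sqnorm z d0; exists r => // z' /rP /ler_normlP[_].
move: za d0; rewrite /=; lra.
Qed.

Lemma closed_bounded2_ball a : closed_bounded2 [set z | sqnorm z <= a].
Proof.
split.
  exists (a + 1) => z; rewrite /= /sqnorm => za.
  have := sqr_ge0 (cmod z.1); have := sqr_ge0 (cmod z.2).
  have := sqr_ge0 (cmod z.1 - 1); have := sqr_ge0 (cmod z.2 - 1).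
  move: za; move: (cmod z.1) (cmod z.2) => s t *; split; nra.
move=> z /negP; rewrite -ltNge => az.
have d0 : 0 < (sqnorm z - a) / 2 by rewrite divr_gt0// subr_gt0.
have [r r0 rP] := ccont_at2_sqnorm z d0; exists r => // z' /rP /ler_normlP[+ _].
by move=> H; apply/negP; rewrite -ltNge; move: az H d0; lra.
Qed.

(** Scalar multiplication in coordinates. *)
Definition zscale c z : Cplx2 R := (c * z.1, c * z.2).

Lemma sqnorm_zscale c z : sqnorm (zscale c z) = cmod c ^+ 2 * sqnorm z.
Proof. by rewrite /sqnorm /= !cmodM !exprMn mulrDr. Qed.

Lemma zscaleM c w z : zscale (c * w) z = zscale c (zscale w z).
Proof. by rewrite /zscale /= !mulrA. Qed.

Lemma mat4_zscale c x : mat4 c 0 0 c x = of_cplx2 (zscale c (to_cplx2 x)).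
Proof. by rewrite /mat4 /zscale /= !mul0r addr0 add0r. Qed.

Lemma to_cplx2_radial x :
  to_cplx2 (radial x) = zscale (cpt (Num.sqrt (sqnorm4 x))^-1 0) (to_cplx2 x).
Proof.
rewrite /to_cplx2 /zscale /radial; set c := _^-1; congr (_, _);
by apply: cplx_eq; rewrite -!/(cre _) -!/(cim _) (creM, cimM) Re_cpt Im_cpt mul0r ?subr0 ?addr0.
Qed.

Lemma ccont_at2_zscale (u : Cplx2 R -> R) c z : ccont_at2 u (zscale c z) ->
  ccont_at2 (fun z => u (zscale c z)) z.
Proof.
move=> cu e /cu[r r0 rP]; have c1 : 0 < cmod c + 1 by rewrite ltr_wpDl.
exists (r / (cmod c + 1)); first by rewrite divr_gt0.
move=> z' [z1 z2]; apply: rP; split; rewrite /= -mulrBr cmodM.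
  move: z1; rewrite ltr_pdivlMr// => z1; apply: le_lt_trans z1.
  by rewrite mulrC ler_wpM2l// lerDl.
move: z2; rewrite ltr_pdivlMr// => z2; apply: le_lt_trans z2.
by rewrite mulrC ler_wpM2l// lerDl.
Qed.

Lemma radial_zscale (r : R) x : 0 < r -> radial (mat4 (cpt r 0) 0 0 (cpt r 0) x) = radial x.
Proof.
move=> r0; rewrite -[LHS]to_cplx2K -[RHS]to_cplx2K !to_cplx2_radial mat4_zscale of_cplx2K.
rewrite -sqnorm_to_cplx2 of_cplx2K sqnorm_zscale -zscaleM sqnorm_to_cplx2; congr (of_cplx2 (zscale _ _)).
have -> : cmod (cpt r 0) ^+ 2 = r ^+ 2 by rewrite sqr_cmod Re_cpt Im_cpt expr0n addr0.
rewrite sqrtrM ?sqr_ge0// sqrtr_sqr ger0_norm ?(ltW r0)// invfM.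
apply: cplx_eq; rewrite -!/(cre _) -!/(cim _) (creM, cimM) !Re_cpt !Im_cpt ?mulr0 ?mul0r ?addr0 ?subr0//.
by rewrite mulrAC mulVf ?mul1r// gt_eqF.
Qed.

Lemma sqnorm4_radial x : 0 < sqnorm4 x -> sqnorm4 (radial x) = 1.
Proof.
move=> x0; rewrite -sqnorm_to_cplx2 to_cplx2_radial sqnorm_zscale sqr_cmod Re_cpt Im_cpt.
rewrite expr0n addr0 exprVn sqr_sqrtr ?(ltW x0)// sqnorm_to_cplx2 mulVf// gt_eqF//.
Qed.

(** The origin is excluded because the radial projection is only meaningful off
it. *)
Definition pball a : set (Real4 R) := [set x | 0 < sqnorm4 x < a].

Definition shell a b : set (Real4 R) := [set x | a <= sqnorm4 x < b].

Let measurable_itv_sqnorm (I : interval R) :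
  measurable (sqnorm4 @^-1` [set` I] : set (Real4 R)).
Proof. by rewrite -[X in measurable X]setTI; apply: measurable_sqnorm4 => //; exact: measurable_itv. Qed.

Lemma measurable_pball a : measurable (pball a).
Proof.
rewrite (_ : pball a = sqnorm4 @^-1` [set` `]0, a[]); first exact: measurable_itv_sqnorm.
by apply/seteqP; split => x /=; rewrite in_itv.
Qed.

Lemma measurable_shell a b : measurable (shell a b).
Proof.
rewrite (_ : shell a b = sqnorm4 @^-1` [set` `[a, b[]); first exact: measurable_itv_sqnorm.
by apply/seteqP; split => x /=; rewrite in_itv.
Qed.

Lemma measurable_sphere : measurable (to_cplx2 @^-1` unit_sphere : set (Real4 R)).
Proof.
rewrite (_ : _ @^-1` _ = sqnorm4 @^-1` [set` `[1, 1]]); first exact: measurable_itv_sqnorm.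
apply/seteqP; split => x /=; rewrite in_itv /= /unit_sphere /= sqnorm_to_cplx2.
  by move=> ->; rewrite lexx.
by move=> /andP[? ?]; apply/eqP; rewrite eq_le; apply/andP.
Qed.

(** The factor of the measure is a variable k because the literal 4 would be
unfolded by conversion. *)
Let cone_integral_ge (k : {nonneg R}) (F : Real4 R -> R) :
  measurable_fun (to_cplx2 @^-1` unit_sphere) F -> (forall x, 0 <= F x) ->
  (k%:num%:E * \int[leb4]_(x in pball 1) (F (radial x))%:E <=
   \int[mscale k (mrestr leb4 measurable_ball4)]_(x in
     radial @^-1` (to_cplx2 @^-1` unit_sphere)) (F (radial x))%:E)%E.
Proof.
move=> mF F0; set D := to_cplx2 @^-1` unit_sphere.
have mD : measurable D := measurable_sphere.
have mFE : measurable_fun D (EFin \o F) by exact/measurable_EFinP.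
have mrD : measurable (radial @^-1` D).
  by rewrite -[X in measurable X]setTI; exact: measurable_radial.
have mFr : measurable_fun (radial @^-1` D) (fun x => (F (radial x))%:E).
  change (measurable_fun (radial @^-1` D) ((EFin \o F) \o radial)).
  apply: (@measurable_comp _ _ _ _ _ _ D) => //.
    by move=> _ [x /= Dx <-].
  exact: measurable_funTS measurable_radial.
have Fr0 x : (radial @^-1` D) x -> (0 <= (F (radial x))%:E)%E by rewrite lee_fin.
rewrite (@ge0_integral_mscale _ _ _ (mrestr leb4 measurable_ball4) _ mrD k
  (fun x => (F (radial x))%:E) mFr Fr0).
apply: lee_wpmul2l; first by rewrite lee_fin.
have sub : pball 1 `<=` radial @^-1` D.
  move=> x /andP[x0 _]; rewrite /D /unit_sphere /= sqnorm_to_cplx2.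
  exact: sqnorm4_radial.
apply: (@le_trans _ _ (\int[mrestr leb4 measurable_ball4]_(x in pball 1) (F (radial x))%:E)%E).
  rewrite le_eqVlt; apply/orP; left; apply/eqP; apply: eq_measure_integral => A mA Ap.
  rewrite /= /mrestr setIidl// => x /Ap /andP[_]; exact.
apply: ge0_subset_integral => //; first exact: measurable_pball.
Qed.

(** Unfolds the definition of surface measure: integrals over the sphere are
integrals of functions constant on rays over the punctured ball. *)
Lemma sphere_integral_ge (F : Real4 R -> R) :
  measurable_fun (to_cplx2 @^-1` unit_sphere) F -> (forall x, 0 <= F x) ->
  (4%:E * \int[leb4]_(x in pball 1) (F (radial x))%:E <=
   \int[sphere_measure]_(x in to_cplx2 @^-1` unit_sphere) (F x)%:E)%E.
Proof.
move=> mF F0; set D := to_cplx2 @^-1` unit_sphere.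
have mD : measurable D := measurable_sphere.
have mFE : measurable_fun D (EFin \o F) by exact/measurable_EFinP.
rewrite [leRHS](_ : _ = \int[mscale (4%:nng)%R (mrestr leb4 measurable_ball4)]_(x in radial @^-1` D)
    (F (radial x))%:E)%E.
  have H (k : {nonneg R}) : k%:num = 4 -> (4%:E * \int[leb4]_(x in pball 1) (F (radial x))%:E <=
      \int[mscale k (mrestr leb4 measurable_ball4)]_(x in radial @^-1` D) (F (radial x))%:E)%E.
    by move=> <-; exact: cone_integral_ge.
  exact: H.
apply: (@ge0_integral_pushforward _ _ _ _ _ radial measurable_radial
  (mscale (4%:nng)%R (mrestr leb4 measurable_ball4)) D (EFin \o F) mD mFE).
by move=> x _; rewrite lee_fin.
Qed.

End ball_geometry.

(** * Hardy space functions on shells *)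

Section slices.
Context {R : realType}.

Lemma differentiable_slice (g : Cplx2 R -> Cplx R) (X : Cplx2 R) (w : Cplx R) :
  differentiable g (zscale w X) -> differentiable (fun w => g (zscale w X)) w.
Proof.
move=> dg; apply: (@differentiable_comp _ _ _ _ (fun w => zscale w X) g); last exact: dg.
have dl (c : Cplx R) : differentiable (fun w : Cplx R => w * c) w.
  by apply: differentiableM; [exact: differentiable_idc|exact: differentiable_cst].
exact: differentiable_pair.
Qed.

End slices.

Section shell_estimate.
Context {R : realType}.
Variables (f : Cplx2 R -> Cplx R) (p : R).
Hypothesis hf : holomorphic_on unit_ball f.
Hypothesis p2 : 2^-1 <= p.

Let u (z : Cplx2 R) := cmod (f z) `^ p.

Let p0 : 0 < p. Proof. by apply: lt_le_trans p2; rewrite invr_gt0. Qed.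

(** On every complex line through 0 the rotation sums of |f|^p nearly increase
with the radius; uniform continuity of |f|^p makes the number of rotations
independent of the line, which allows integration over a shell. On the right the
point has been moved to the sphere of radius sqrt b. *)
Let means_increase (b e : R) : 0 < b < 1 -> 0 < e -> exists2 N, (0 < N)%N &
  forall X : Cplx2 R, 0 < sqnorm X <= b ->
  rotsum N (fun w => u (zscale w X)) 1 <=
  rotsum N (fun w => u (zscale w X)) (cpt (Num.sqrt b / Num.sqrt (sqnorm X)) 0) + N%:R * e.
Proof.
move=> /andP[b0 b1] e0.
have uc z : sqnorm z <= b -> ccont_at2 u z.
  by move=> zb; apply: ccont_at2_comp_powR => //; apply: hf; exact: le_lt_trans b1.
have [q q0 qP] := uniform_continuity2 (closed_bounded2_ball b) uc e0.
have q2 : 0 < q / 2 by rewrite divr_gt0.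
have [N N0 Nd] := uroot_denseE q2.
exists N => // X /andP[X0 Xb].
set s := Num.sqrt (sqnorm X); set t := Num.sqrt b.
have s0 : 0 < s by rewrite sqrtr_gt0.
have st : s <= t by rewrite ler_wsqrtr.
have t1 : t <= 1 by rewrite -sqrtr1 ler_wsqrtr// ltW.
have t0 : 0 < t by rewrite sqrtr_gt0.
have ss : s ^+ 2 = sqnorm X by rewrite sqr_sqrtr// sqnorm_ge0.
have tt : t ^+ 2 = b by rewrite sqr_sqrtr// ltW.
have cb w : cmod w <= t / s -> sqnorm (zscale w X) <= b.
  rewrite ler_pdivlMr// => ws; rewrite sqnorm_zscale -ss -exprMn -tt.
  by rewrite ler_sqr ?nnegrE ?mulr_ge0// ltW.
have df w : cmod w <= t / s -> differentiable (fun w => f (zscale w X)) w.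
  by move=> wts; apply: differentiable_slice; apply: hf; exact: le_lt_trans (cb _ wts) b1.
have cm : cmod (cpt (t / s) 0) = t / s.
  by rewrite cmodE Re_cpt Im_cpt expr0n addr0 sqrtr_sqr ger0_norm// divr_ge0// ltW.
apply: (@rotsum_increasing _ _ (t / s) (q / 2) e N N0 Nd).
- by move=> w wts; apply: ccont_at_powR => //; exact: df.
- move=> w wts; apply: (@subh_at_powR _ _ _ (t / s - cmod w)) => //; first by rewrite subr_gt0.
  by move=> z zw; apply: df; have := le_lt_trans (cmod_lip _ _) zw => /ltr_normlP[]; lra.
- move=> w w' wts w'w ww'; apply: qP; first exact: cb.
  have H (c : Cplx R) : cmod c <= s -> cmod (w' * c - w * c) < q.
    move=> cs; rewrite -mulrBl cmodM (@le_lt_trans _ _ (q / 2))//; last first.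
      by rewrite ltr_pdivrMr// ltr_pMr// ltr1n.
    apply: (@le_trans _ _ ((q / 2 * cmod w) * s)); first by rewrite ler_pM.
    rewrite -mulrA -[leRHS]mulr1 ler_pM2l// (le_trans _ t1)//.
    by rewrite -ler_pdivlMr.
  have c1 : cmod X.1 <= s.
    by rewrite -[leLHS]ger0_norm// -sqrtr_sqr ler_wsqrtr// lerDl sqr_ge0.
  have c2 : cmod X.2 <= s.
    by rewrite -[leLHS]ger0_norm// -sqrtr_sqr ler_wsqrtr// lerDr sqr_ge0.
  by split; exact: H.
- by rewrite cm cmod1 ler_pdivlMr// mul1r.
- by rewrite cm.
Qed.

Variables (M : R).
Hypothesis hM : (Hp_pow p f <= M%:E)%E.

Variables (a b : R).
Hypotheses (a0 : 0 < a) (ab : a < b) (b1 : b < 1).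

Let b0 : 0 < b. Proof. exact: lt_trans ab. Qed.

Let t := Num.sqrt b.

Let t1 : 0 <= t < 1.
Proof. by rewrite sqrtr_ge0/= -sqrtr1 ltr_sqrt. Qed.

Let F (x : Real4 R) := u (zscale (cpt t 0) (to_cplx2 x)).

Let F0 x : 0 <= F x. Proof. exact: powR_ge0. Qed.

Let cmod_t : cmod (cpt t 0) ^+ 2 = b.
Proof. by rewrite sqr_cmod Re_cpt Im_cpt expr0n addr0 sqr_sqrtr// ltW. Qed.

Let measurable_F : measurable_fun (to_cplx2 @^-1` unit_sphere) F.
Proof.
have oU : copen2 [set z : Cplx2 R | sqnorm z < b^-1] by exact: copen2_ball.
have := @measurable_ccont2 R _ (fun z => u (zscale (cpt t 0) z)) oU _.
move=> /(_ _)/Wrap[z /= zb|mF].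
  apply: ccont_at2_zscale; apply: ccont_at2_comp_powR => //; apply: hf.
  by rewrite /unit_ball /= sqnorm_zscale cmod_t mulrC -ltr_pdivlMr// mul1r.
apply: measurable_funS mF; first exact: measurable_copen2.
move=> x; rewrite /unit_sphere /= => ->.
by rewrite invf_gt1.
Qed.

(** The H^p norm bounds the integral over the sphere of radius t = sqrt b. *)
Let sphere_bound : (4%:E * \int[leb4]_(x in pball 1) (F (radial x))%:E <= M%:E)%E.
Proof.
apply: le_trans (sphere_integral_ge measurable_F F0) _; apply: le_trans hM.
by apply: ereal_sup_ubound; exists t.
Qed.

Let measurable_Fr c : measurable_fun (pball c) (fun x => F (radial x)).
Proof.
apply: (@measurable_comp _ _ _ _ _ _ (to_cplx2 @^-1` unit_sphere) F) => //.
- exact: measurable_sphere.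
- move=> _ [x /andP[x0 _] <-]; rewrite /unit_sphere /= sqnorm_to_cplx2.
  exact: sqnorm4_radial.
- exact: measurable_funTS measurable_radial.
Qed.

(** Functions that are constant on rays have integrals over balls proportional
to the fourth power of the radius. *)
Let pball_homogeneous c : 0 < c ->
  (\int[leb4]_(x in pball c) (F (radial x))%:E =
   (c ^+ 2)%:E * \int[leb4]_(x in pball 1) (F (radial x))%:E)%E.
Proof.
move=> c0; have s0 : 0 < Num.sqrt c by rewrite sqrtr_gt0.
have mG : measurable_fun (pball c) (fun x => (F (radial x))%:E).
  by apply/measurable_EFinP; exact: measurable_Fr.
have G0 x : pball c x -> (0 <= (F (radial x))%:E)%E by rewrite lee_fin.
have := scales_integral (scales_dilate4 s0) (measurable_pball c) mG G0.
under eq_integral do rewrite radial_zscale//.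
have -> : mat4 (cpt (Num.sqrt c) 0) 0 0 (cpt (Num.sqrt c) 0) @^-1` pball c = pball 1.
  have cE : cmod (cpt (Num.sqrt c) 0) ^+ 2 = c.
    by rewrite sqr_cmod Re_cpt Im_cpt expr0n addr0 sqr_sqrtr// ltW.
  by apply/seteqP; split => x; rewrite /pball /= mat4_zscale -!sqnorm_to_cplx2 of_cplx2K
    sqnorm_zscale cE pmulr_rgt0// -{2}[c]mulr1 ltr_pM2l.
rewrite (_ : Num.sqrt c ^- 4 = (c ^+ 2)^-1); last first.
  by rewrite (exprM _ 2 2) sqr_sqrtr// ltW.
by move=> ->; rewrite muleA -EFinM mulfV ?mul1e// expf_neq0// gt_eqF.
Qed.

Let measurable_u c : c <= 1 -> measurable_fun (shell a c) (fun x => u (to_cplx2 x)).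
Proof.
move=> c1; have := @measurable_ccont2 R _ u (@copen2_ball R 1).
have uc z : [set z : Cplx2 R | sqnorm z < 1] z -> ccont_at2 u z.
  by move=> z1; apply: ccont_at2_comp_powR => //; exact: hf.
move=> /(_ uc); apply: measurable_funS; first exact: measurable_copen2 (@copen2_ball R 1).
by move=> x /andP[_ xc] /=; rewrite sqnorm_to_cplx2 (lt_le_trans xc).
Qed.

Let leb4_shell_fin : (leb4 (shell a b) < +oo)%E.
Proof.
apply: (@le_lt_trans _ _ (leb4 (disc2 1 `*` disc2 1))).
  apply: le_measure; rewrite ?inE; first exact: measurable_shell.
    by apply: measurableX; exact: measurable_disc2.
  move=> x /andP[_ xb]; have : sqnorm4 x < 1 by exact: lt_trans b1.
  rewrite -sqnorm_to_cplx2 /sqnorm /= => x1; split; rewrite /disc2 /=.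
    by have := sqr_ge0 (cmod (to_cplx x.2)); lra.
  by have := sqr_ge0 (cmod (to_cplx x.1)); lra.
rewrite /leb4 product_measure1E//; [|exact: measurable_disc2|exact: measurable_disc2].
have L := @leb2_disc2 R 1 ler01; rewrite mulr1 in L.
rewrite (_ : (_ * _)%E = (disc_area%:E * disc_area%:E)%E); first by rewrite ltry.
by congr (_ * _)%E; exact: L.
Qed.

(** Spread the shell along complex lines to the sphere of radius sqrt b, where
the integral is bounded by the H^p norm, and use homogeneity: the volume of the
shell is proportional to b^2 - a^2. *)
Lemma shell_bound : (\int[leb4]_(x in shell a b) (cmod (f (to_cplx2 x)) `^ p)%:E <=
  ((b ^+ 2 - a ^+ 2) * (M / 4))%:E)%E.
Proof.
set I := (\int[leb4]_(x in pball 1) (F (radial x))%:E)%E.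
have I0 : (0 <= I)%E by apply: integral_ge0 => x _; rewrite lee_fin.
have IM : (I <= (M / 4)%:E)%E.
  move: sphere_bound; rewrite -/I; move: I I0 => [i| |]//= _.
    by rewrite -EFinM !lee_fin ler_pdivlMr// mulrC.
  by rewrite gt0_muley ?lte_fin.
set J := (\int[leb4]_(x in shell a b) (F (radial x))%:E)%E.
have shb : shell a b `<=` pball b by move=> x /andP[ax xb]; rewrite /pball /= (lt_le_trans a0 ax).
have mGb : measurable_fun (pball b) (fun x => (F (radial x))%:E).
  by apply/measurable_EFinP; exact: measurable_Fr.
have J0 : (0 <= J)%E by apply: integral_ge0 => x _; rewrite lee_fin.
have JE : J = ((b ^+ 2 - a ^+ 2)%:E * I)%E.
  have : ((b ^+ 2)%:E * I = (a ^+ 2)%:E * I + J)%E.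
    rewrite -!pball_homogeneous//.
    have pbE : pball b = pball a `|` shell a b.
      apply/seteqP; split => x; rewrite /pball /shell /=.
        by move=> /andP[x0 xb]; case: (ltP (sqnorm4 x) a) => H; [left|right]; rewrite ?x0.
      move=> [/andP[x0 xa]|/andP[ax xb]]; first by rewrite x0 (lt_trans xa).
      by rewrite xb (lt_le_trans a0 ax).
    rewrite pbE ge0_integral_setU//.
    - exact: measurable_pball.
    - exact: measurable_shell.
    - by rewrite -pbE.
    - by move=> x _; rewrite lee_fin.
    - apply/disj_set2P/seteqP; split => // x [/andP[_ xa] /andP[ax _]].
      by move: ax; rewrite leNgt xa.
  move: I J I0 IM J0 {shb mGb} => [i| |]//= [j| |]//= _ _ _.
  rewrite -!EFinM -EFinD => -[e]; congr EFin.
  by rewrite mulrBl e addrAC subrr add0r.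
have b2a2 : 0 <= b ^+ 2 - a ^+ 2.
  by rewrite subr_ge0 ler_sqr ?nnegrE ltW.
suff : (\int[leb4]_(x in shell a b) (cmod (f (to_cplx2 x)) `^ p)%:E <= J)%E.
  move=> /le_trans; apply; rewrite JE [leRHS]EFinM.
  by apply: lee_wpmul2l; rewrite ?lee_fin.
apply: (@lee_eps_measure R _ _ (leb4 (shell a b))) => // e e0.
have [|N N0 HN] := @means_increase b e _ e0; first by rewrite b0.
have NR0 : 0 < N%:R :> R by rewrite ltr0n.
pose rho (j : nat) : Real4 R -> Real4 R := mat4 (uroot N j) 0 0 (uroot N j).
have srho j : scales leb4 (rho j) 1 by apply: scales_rot4; exact: cmod_uroot.
have nrho j x : sqnorm4 (rho j x) = sqnorm4 x.
  by rewrite -!sqnorm_to_cplx2 /rho mat4_zscale of_cplx2K sqnorm_zscale cmod_uroot expr1n mul1r.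
have shrho j : rho j @^-1` shell a b = shell a b.
  by apply/seteqP; split => x; rewrite /shell /= nrho.
have mu := measurable_u (ltW b1).
have mG : measurable_fun (shell a b) (fun x => F (radial x)).
  exact: (measurable_funS (@measurable_pball R b) shb (@measurable_Fr b)).
have mrho (h : Real4 R -> R) : measurable_fun (shell a b) h ->
    measurable_fun (shell a b) (fun x => (\sum_(j < N) h (rho j x))%:E).
  move=> mh; apply/measurable_EFinP; apply: measurable_sum => j.
  change (measurable_fun (shell a b) (h \o rho j)).
  apply: (@measurable_comp _ _ _ _ _ _ (shell a b)) => //; first exact: measurable_shell.
    by move=> _ [x Sx <-]; have : (rho j @^-1` shell a b) x by rewrite shrho.
  by apply: measurable_funTS; have [] := srho j.
have mS := measurable_shell a b.
rewrite -(@lee_pmul2l _ N%:R%:E)//.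
rewrite (ge0_muleDr _ J0); last by rewrite mule_ge0// lee_fin ltW.
rewrite -(integral_orbit_sum N srho shrho mS mu) -?(integral_orbit_sum N srho shrho mS mG)//;
  last by move=> x _; exact: powR_ge0.
have Ne0 : 0 <= N%:R * e by rewrite mulr_ge0// ltW.
rewrite muleA -EFinM -integral_cst// -ge0_integralD//; last 2 first.
- by move=> x _; rewrite lee_fin sumr_ge0.
- exact: (mrho _ mG).
apply: ge0_le_integral => //.
- by move=> x _; rewrite lee_fin sumr_ge0// => j _; exact: powR_ge0.
- exact: (mrho _ mu).
- by apply: emeasurable_funD => //; exact: (mrho _ mG).
move=> x /andP[ax xb]; rewrite -EFinD lee_fin.
have x0 : 0 < sqnorm4 x by exact: lt_le_trans ax.
have := HN (to_cplx2 x); rewrite sqnorm_to_cplx2 x0 (ltW xb) => /(_ isT).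
congr (_ <= _ + _); rewrite /rotsum; apply: eq_bigr => j _.
  by rewrite /rho mat4_zscale of_cplx2K mulr1.
rewrite /F to_cplx2_radial nrho /rho mat4_zscale of_cplx2K -!zscaleM; congr (u (zscale _ _)).
by apply: cplx_eq; rewrite -!/(cre _) -!/(cim _) !(creM, cimM) !Re_cpt !Im_cpt; rewrite -/t; ring.
Qed.

End shell_estimate.

(** * Shells sliced along complex lines *)

Section measurable_complex.
Context {R : realType} d (T : measurableType d).
Implicit Types (F G : T -> Cplx R) (D : set T).

(** Measurability of complex valued functions, through their coordinates. *)
Definition mcfun D F :=
  measurable_fun D (fun x => cre (F x)) /\ measurable_fun D (fun x => cim (F x)).

Lemma mcfunD D F G : mcfun D F -> mcfun D G -> mcfun D (fun x => F x + G x).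
Proof.
move=> [F1 F2] [G1 G2]; split.
  apply: (@eq_measurable_fun _ _ _ _ _ (fun x => cre (F x) + cre (G x))).
    by move=> x _; rewrite creD.
  exact: measurable_funD.
apply: (@eq_measurable_fun _ _ _ _ _ (fun x => cim (F x) + cim (G x))).
  by move=> x _; rewrite cimD.
exact: measurable_funD.
Qed.

Lemma mcfunM D F G : mcfun D F -> mcfun D G -> mcfun D (fun x => F x * G x).
Proof.
move=> [F1 F2] [G1 G2]; split.
  apply: (@eq_measurable_fun _ _ _ _ _ (fun x => cre (F x) * cre (G x) - cim (F x) * cim (G x))).
    by move=> x _; rewrite creM.
  by apply: measurable_funB; exact: measurable_funM.
apply: (@eq_measurable_fun _ _ _ _ _ (fun x => cre (F x) * cim (G x) + cim (F x) * cre (G x))).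
  by move=> x _; rewrite cimM.
by apply: measurable_funD; exact: measurable_funM.
Qed.

Lemma mcfunN D F : mcfun D F -> mcfun D (fun x => - F x).
Proof.
move=> [F1 F2]; split.
  apply: (@eq_measurable_fun _ _ _ _ _ (fun x => - cre (F x))).
    by move=> x _; rewrite creN.
  exact: measurableT_comp.
apply: (@eq_measurable_fun _ _ _ _ _ (fun x => - cim (F x))).
  by move=> x _; rewrite cimN.
exact: measurableT_comp.
Qed.

Lemma mcfun_conj D F : mcfun D F -> mcfun D (fun x => cconj (F x)).
Proof. by move=> [F1 F2]; split => //; exact: measurableT_comp. Qed.

Lemma mcfun_cst D (c : Cplx R) : mcfun D (fun=> c).
Proof. by split; exact: measurable_cst. Qed.

Lemma mcfun_real D (g : T -> R) : measurable_fun D g -> mcfun D (fun x => cpt (g x) 0).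
Proof. by move=> mg; split => //; exact: measurable_cst. Qed.

Lemma measurable_sqr_cmod_comp D F : mcfun D F ->
  measurable_fun D (fun x => cmod (F x) ^+ 2).
Proof.
move=> [F1 F2].
apply: (@eq_measurable_fun _ _ _ _ _ (fun x => cre (F x) ^+ 2 + cim (F x) ^+ 2)).
  by move=> x _; rewrite sqr_cmod.
by apply: measurable_funD; exact: measurable_funX.
Qed.

Lemma mcfun_to_cplx D (h : T -> Real2 R) : measurable_fun D h ->
  mcfun D (fun x => to_cplx (h x)).
Proof.
by move=> mh; split;
  [apply: (measurableT_comp measurable_fst mh)|apply: (measurableT_comp measurable_snd mh)].
Qed.

End measurable_complex.

Section slices_of_shells.
Context {R : realType}.
Implicit Types (z : Cplx2 R) (s t w : Cplx R) (a b d r : R).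

Definition herm (y z : Cplx2 R) : Cplx R := y.1 * cconj z.1 + y.2 * cconj z.2.

(** With r = |z| and e = z / r the condition reads |<x, e> - r| < d; it is
multiplied by r to avoid the quotient. *)
Definition cap z d : set (Real4 R) :=
  [set x | cmod (herm (to_cplx2 x) z - cpt (sqnorm z) 0) ^+ 2 < d ^+ 2 * sqnorm z].

(** Coordinates adapted to z: the first parameter moves along the complex line
of z, shifted so that 0 corresponds to z, and the second orthogonally to it. *)
Definition slice z (x : Real4 R) : Real4 R :=
  let r := Num.sqrt (sqnorm z) in
  mat4 (cpt r^-1 0 * z.1) (- cconj (cpt r^-1 0 * z.2))
    (cpt r^-1 0 * z.2) (cconj (cpt r^-1 0 * z.1))
    (of_cplx (to_cplx x.1 + cpt r 0), x.2).

Lemma scales_slice z : 0 < sqnorm z -> scales leb4 (slice z) 1.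
Proof.
move=> z0; set r := Num.sqrt (sqnorm z).
have r0 : 0 < r by rewrite sqrtr_gt0.
have rr : r ^+ 2 = sqnorm z by rewrite sqr_sqrtr// ltW.
have cr : cmod (cpt r^-1 0) ^+ 2 = (sqnorm z)^-1.
  by rewrite sqr_cmod Re_cpt Im_cpt expr0n addr0 exprVn rr.
have H1 : scales leb4 (fun x : Real4 R => (of_cplx (to_cplx x.1 + cpt r 0), x.2)) 1.
  have := @scales_skew1 _ _ _ _ _ leb2 leb2 (fun _ x => of_cplx (to_cplx x + cpt r 0)) 1 ler01.
  apply; last by move=> _; exact: scales_cadd.
  have := measurable_cadd (@measurable_fst _ _ (Real2 R) (Real2 R)) (@measurable_cst _ _ _ _ setT (of_cplx (cpt r 0))).
  by apply: eq_measurable_fun => x _; rewrite /= of_cplxK.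
have H2 := @scales_unitary R (cpt r^-1 0 * z.1) (cpt r^-1 0 * z.2).
have : cmod (cpt r^-1 0 * z.1) ^+ 2 + cmod (cpt r^-1 0 * z.2) ^+ 2 = 1.
  by rewrite !cmodM !exprMn -mulrDr cr mulVf// gt_eqF.
by move=> /H2/scales_comp/(_ H1); rewrite mulr1.
Qed.

Lemma to_cplx2_slice z (x : Real4 R) : to_cplx2 (slice z x) =
  let e := zscale (cpt (Num.sqrt (sqnorm z))^-1 0) z in
  let s := to_cplx x.1 + cpt (Num.sqrt (sqnorm z)) 0 in
  (s * e.1 + to_cplx x.2 * - cconj e.2, s * e.2 + to_cplx x.2 * cconj e.1).
Proof.
rewrite /slice /mat4 /= !of_cplx2K of_cplxK /=; congr (_, _); first by rewrite mulrC [X in _ + X]mulrC.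
by rewrite mulrC [X in _ + X]mulrC.
Qed.

Let unit_vector z : 0 < sqnorm z ->
  let e := zscale (cpt (Num.sqrt (sqnorm z))^-1 0) z in
  cmod e.1 ^+ 2 + cmod e.2 ^+ 2 = 1.
Proof.
move=> z0 /=; rewrite !cmodM !exprMn -mulrDr sqr_cmod Re_cpt Im_cpt expr0n addr0 exprVn.
by rewrite sqr_sqrtr ?mulVf// ?gt_eqF// ltW.
Qed.

Let sqnorm_orth (e1 e2 s t : Cplx R) : cmod e1 ^+ 2 + cmod e2 ^+ 2 = 1 ->
  sqnorm (s * e1 + t * - cconj e2, s * e2 + t * cconj e1) = cmod s ^+ 2 + cmod t ^+ 2.
Proof.
rewrite /sqnorm /= => e1e2; rewrite -[RHS]mulr1 -e1e2.
rewrite !sqr_cmod !(creD, cimD, creM, cimM, creN, cimN) !Re_cpt !Im_cpt.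
by ring.
Qed.

Let herm_orth (e1 e2 s t : Cplx R) : cmod e1 ^+ 2 + cmod e2 ^+ 2 = 1 ->
  herm (s * e1 + t * - cconj e2, s * e2 + t * cconj e1) (e1, e2) = s.
Proof.
move=> e1e2; rewrite /herm /=.
have -> : (s * e1 + t * - cconj e2) * cconj e1 + (s * e2 + t * cconj e1) * cconj e2 =
  s * (e1 * cconj e1 + e2 * cconj e2) by ring.
rewrite !cmulJ -[RHS]mulr1; congr (_ * _).
by apply: cplx_eq; rewrite -!/(cre _) -!/(cim _) (creD, cimD) ?Re_cpt ?Im_cpt ?addr0// e1e2.
Qed.

Lemma sqnorm_slice z (x : Real4 R) : 0 < sqnorm z ->
  sqnorm (to_cplx2 (slice z x)) =
  cmod (to_cplx x.1 + cpt (Num.sqrt (sqnorm z)) 0) ^+ 2 + cmod (to_cplx x.2) ^+ 2.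
Proof. by move=> z0; rewrite to_cplx2_slice /= sqnorm_orth//; exact: unit_vector. Qed.

Lemma slice_center z : 0 < sqnorm z -> to_cplx2 (slice z (of_cplx 0, of_cplx 0)) = z.
Proof.
move=> z0; have r0 : 0 < Num.sqrt (sqnorm z) by rewrite sqrtr_gt0.
rewrite to_cplx2_slice /= !of_cplxK add0r !mul0r !addr0 !mulrA.
rewrite (_ : cpt _ 0 * cpt _ 0 = 1) ?mul1r; first by case: (z).
apply: cplx_eq; rewrite -!/(cre _) -!/(cim _) (creM, cimM) !Re_cpt !Im_cpt ?mulr0 ?mul0r ?subr0 ?addr0//.
by rewrite mulfV// gt_eqF.
Qed.

(** The slice of a shell by the affine complex line orthogonal to z through the
point with parameter w. *)
Definition slice_annulus z a b (w : Real2 R) : set (Real2 R) :=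
  annulus (a - cmod (to_cplx w + cpt (Num.sqrt (sqnorm z)) 0) ^+ 2)
    (b - cmod (to_cplx w + cpt (Num.sqrt (sqnorm z)) 0) ^+ 2).

Lemma slice_preimage z a b d : 0 < sqnorm z -> 0 < d ->
  slice z @^-1` (shell a b `&` cap z d) =
  [set x | disc2 (d ^+ 2) x.1 /\ slice_annulus z a b x.1 x.2].
Proof.
move=> z0 d0; set r := Num.sqrt (sqnorm z).
have r0 : 0 < r by rewrite sqrtr_gt0.
have rr : r ^+ 2 = sqnorm z by rewrite sqr_sqrtr// ltW.
have ue := unit_vector z0; rewrite -/r /= in ue.
have zr : z = zscale (cpt r 0) (zscale (cpt r^-1 0) z).
  rewrite -zscaleM (_ : cpt r 0 * cpt r^-1 0 = 1) /zscale ?mul1r; first by case: (z).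
  apply: cplx_eq; rewrite -!/(cre _) -!/(cim _) (creM, cimM) !Re_cpt !Im_cpt ?mulr0 ?mul0r ?subr0 ?addr0//.
  by rewrite mulfV// gt_eqF.
have hr (y : Cplx2 R) (e : Cplx2 R) : herm y (zscale (cpt r 0) e) = cpt r 0 * herm y e.
  rewrite /herm /=.
  have cj (c : Cplx R) : cconj (cpt r 0 * c) = cpt r 0 * cconj c.
    apply: cplx_eq; rewrite -!/(cre _) -!/(cim _) /cconj ?Re_cpt ?Im_cpt !(creM, cimM) ?Re_cpt ?Im_cpt; ring.
  by rewrite !cj; ring.
have hz (y : Cplx2 R) : herm y z = cpt r 0 * herm y (cpt r^-1 0 * z.1, cpt r^-1 0 * z.2).
  by rewrite {1}zr hr.
have E (w : Cplx R) : cmod (cpt r 0 * (w + cpt r 0) - cpt (sqnorm z) 0) ^+ 2 < d ^+ 2 * sqnorm z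
    <-> cmod w ^+ 2 < d ^+ 2.
  have -> : cpt r 0 * (w + cpt r 0) - cpt (sqnorm z) 0 = cpt r 0 * w.
    rewrite mulrDr -addrA (_ : cpt r 0 * cpt r 0 - cpt (sqnorm z) 0 = 0) ?addr0// -rr.
    by apply: cplx_eq; rewrite -!/(cre _) -!/(cim _) !(creD, cimD, creN, cimN, creM, cimM) !Re_cpt !Im_cpt /cre /cim /=; ring.
  have cr : cmod (cpt r 0) ^+ 2 = sqnorm z by rewrite sqr_cmod Re_cpt Im_cpt expr0n addr0.
  by rewrite cmodM exprMn cr mulrC ltr_pM2r.
apply/seteqP; split => x; rewrite /= /shell /cap /slice_annulus /annulus /disc2 /= -sqnorm_to_cplx2
  to_cplx2_slice -/r /= sqnorm_orth// hz herm_orth// lerBlDl ltrBrDl.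
  by move=> [H /E H']; split.
by move=> [H' H]; split => //; exact/E.
Qed.

Lemma mcfun_herm dT (T : measurableType dT) (D : set T) (F1 F2 G1 G2 : T -> Cplx R) :
  mcfun D F1 -> mcfun D F2 -> mcfun D G1 -> mcfun D G2 ->
  mcfun D (fun x => herm (F1 x, F2 x) (G1 x, G2 x)).
Proof.
by move=> *; apply: mcfunD; apply: mcfunM => //; exact: mcfun_conj.
Qed.

Lemma measurable_cap z d : measurable (cap z d).
Proof.
have mf : measurable_fun setT (fun x : Real4 R =>
    cmod (herm (to_cplx2 x) z - cpt (sqnorm z) 0) ^+ 2).
  apply: measurable_sqr_cmod_comp; apply: mcfunD; last exact: mcfun_cst.
  apply: (@mcfun_herm _ _ setT (fun x => to_cplx x.1) (fun x => to_cplx x.2) (fun=> z.1) (fun=> z.2)).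
  - exact: mcfun_to_cplx measurable_fst.
  - exact: mcfun_to_cplx measurable_snd.
  - exact: mcfun_cst.
  - exact: mcfun_cst.
rewrite (_ : cap z d = (fun x : Real4 R =>
    cmod (herm (to_cplx2 x) z - cpt (sqnorm z) 0) ^+ 2) @^-1` `]-oo, d ^+ 2 * sqnorm z[%classic).
  by rewrite -[X in measurable X]setTI; apply: mf => //; exact: measurable_itv.
by apply/seteqP; split => x; rewrite /= in_itv.
Qed.

(** Integration over a cap, line by line: Tonelli's theorem in the coordinates
adapted to z. *)
Lemma slice_integral z a b d (h : Real4 R -> \bar R) : 0 < sqnorm z -> 0 < d ->
  measurable_fun (shell a b `&` cap z d) h ->
  (forall x, (shell a b `&` cap z d) x -> (0 <= h x)%E) ->
  measurable_fun (disc2 (d ^+ 2))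
    (fun w : Real2 R => \int[leb2]_(t in slice_annulus z a b w) h (slice z (w, t)))%E /\
  (\int[leb4]_(x in shell a b `&` cap z d) h x =
   \int[leb2]_(w in disc2 (d ^+ 2)) \int[leb2]_(t in
     slice_annulus z a b w) h (slice z (w, t)))%E.
Proof.
move=> z0 d0 mh h0; set S := shell a b `&` cap z d.
have mS : measurable S by apply: measurableI; [exact: measurable_shell|exact: measurable_cap].
have mSl : measurable (slice z @^-1` S).
  by rewrite -[X in measurable X]setTI; have [+ _] := scales_slice z0; exact.
have mhS : measurable_fun (slice z @^-1` S) (h \o slice z).
  apply: (@measurable_comp _ _ _ _ _ _ S) => //; first by move=> _ [x /= ? <-].
  by apply: measurable_funTS; have [] := scales_slice z0.
have mhs : measurable_fun setT ((fun x => h (slice z x)) \_ (slice z @^-1` S)).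
  exact: (measurable_restrictT _ mSl).1 mhS.
have hs0 (y : Real4 R) : (0 <= ((fun x => h (slice z x)) \_ (slice z @^-1` S)) y)%E.
  by rewrite /patch; case: ifPn => // /set_mem Sy; exact: h0.
have SE (w t : Real2 R) : ((w, t) \in slice z @^-1` S) =
    (w \in disc2 (d ^+ 2)) && (t \in slice_annulus z a b w).
  rewrite slice_preimage//; apply/idP/andP => [/set_mem[/= ? ?]|[/set_mem ? /set_mem ?]].
    by split; exact/mem_set.
  exact/mem_set.
have FE (w : Real2 R) : w \in disc2 (d ^+ 2) ->
    fubini_F leb2 ((fun x => h (slice z x)) \_ (slice z @^-1` S)) w =
    (\int[leb2]_(t in slice_annulus z a b w) h (slice z (w, t)))%E.
  move=> wd; rewrite /fubini_F [RHS]integral_mkcond; apply: eq_integral => t _.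
  by rewrite /patch SE wd.
split.
  apply: (@eq_measurable_fun _ _ _ _ _ (fubini_F leb2 ((fun x => h (slice z x)) \_ (slice z @^-1` S)))).
    by move=> w; exact: FE.
  by apply: measurable_funTS; exact: measurable_fun_fubini_tonelli_F.
have := scales_integral (scales_slice z0) mS mh h0; rewrite mul1e => <-.
rewrite integral_mkcond [LHS](@fubini_tonelli1 _ _ _ _ _ leb2 leb2 _ mhs hs0).
rewrite [RHS]integral_mkcond; apply: eq_integral => w _.
rewrite [RHS]/patch; case: ifPn => wd; first exact: FE.
by rewrite /fubini_F; apply: integral0_eq => t _; rewrite /patch SE (negbTE wd).
Qed.

End slices_of_shells.

(** * The sub-mean value property over caps *)

Section submean_powers.
Context {R : realType}.

(** For powers of holomorphic functions the sub-mean value property holds down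
to the exponent 1/2, the one needed for |f|^(p/2) when p = 1. *)
Lemma powR_area_submean (g : Cplx R -> Cplx R) (q rho : R) (E : set (Real2 R)) :
  2^-1 <= q -> (forall w, cmod w <= rho -> differentiable g w) ->
  radial_set E -> measurable E -> (leb2 E < +oo)%E ->
  (forall x, E x -> cmod (to_cplx x) <= rho) ->
  measurable_fun E (fun x => cmod (g (to_cplx x)) `^ q) ->
  ((cmod (g 0%R) `^ q)%:E * leb2 E <= \int[leb2]_(x in E) (cmod (g (to_cplx x)) `^ q)%:E)%E.
Proof.
move=> q2 dg rE mE Eoo Er mg; have q0 : 0 < q by apply: lt_le_trans q2; rewrite invr_gt0.
apply: (@area_submean R (fun w => cmod (g w) `^ q) rho E) => //.
- by move=> w wr; exact: (ccont_at_powR q0 (dg _ wr)).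
- move=> w wr; have r0 : 0 < rho - cmod w by rewrite subr_gt0.
  apply: (subh_at_powR q2 r0) => z zw; apply: dg.
  by have := le_lt_trans (cmod_lip _ _) zw => /ltr_normlP[]; lra.
- by move=> x _; exact: powR_ge0.
Qed.

End submean_powers.

Section ball_submean.
Context {R : realType}.
Variables (z : Cplx2 R) (a b d : R).
Hypotheses (z0 : 0 < sqnorm z) (d0 : 0 < d) (ab : a < b) (b1 : b < 1).

Let r := Num.sqrt (sqnorm z).

(** The disc of radius d about z in its complex line lies in the inner ball
|x|^2 <= a, so that every slice of the shell orthogonal to z is a full annulus, of
area independent of the slice. *)
Hypothesis rda : (r + d) ^+ 2 <= a.

Let r0 : 0 < r. Proof. by rewrite sqrtr_gt0. Qed.

Let shift_le (w : Cplx R) : cmod w <= d -> cmod (w + cpt r 0) ^+ 2 <= a.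
Proof.
move=> wd; apply: le_trans rda; rewrite ler_sqr ?nnegrE ?addr_ge0// ?(ltW r0) ?(ltW d0)//.
apply: le_trans (cmodD _ _) _; rewrite addrC lerD//.
by rewrite cmodE Re_cpt Im_cpt expr0n addr0 sqrtr_sqr ger0_norm// ltW.
Qed.

Let disc_le (w : Real2 R) : disc2 (d ^+ 2) w -> cmod (to_cplx w) <= d.
Proof. by rewrite /disc2 /= ltr_sqr ?nnegrE ?(ltW d0)// => /ltW. Qed.

Let slice_annulus_measure (w : Real2 R) : disc2 (d ^+ 2) w ->
  leb2 (slice_annulus z a b w) = (disc_area * (b - a))%:E.
Proof.
move=> /disc_le/shift_le wa; rewrite leb2_annulus; last first.
  by rewrite subr_ge0 wa lerD2r ltW.
by rewrite opprB addrA subrK.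
Qed.

Let S := shell a b `&` cap z d.

Let measurable_S : measurable S.
Proof. by apply: measurableI; [exact: measurable_shell|exact: measurable_cap]. Qed.

Lemma leb4_cap : leb4 S = (disc_area * d ^+ 2 * (disc_area * (b - a)))%:E.
Proof.
have := @slice_integral R z a b d (fun=> 1%E) z0 d0 (measurable_cst _) (fun _ _ => lee01).
move=> [_]; rewrite integral_cst// mul1e => ->.
have H (w : Real2 R) : w \in disc2 (d ^+ 2) ->
    (\int[leb2]_(t in slice_annulus z a b w) 1 = (disc_area * (b - a))%:E)%E.
  move=> /set_mem wd; rewrite integral_cst; last exact: measurable_annulus.
  by rewrite mul1e; exact: slice_annulus_measure.
rewrite (eq_integral _ _ H) integral_cst; last exact: measurable_disc2.
transitivity ((disc_area * (b - a))%:E * leb2 (disc2 (d ^+ 2)))%E; first by [].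
by rewrite leb2_disc2 ?sqr_ge0// -EFinM mulrC.
Qed.

Variables (f : Cplx2 R -> Cplx R) (q : R).
Hypothesis hf : holomorphic_on unit_ball f.
Hypothesis q2 : 2^-1 <= q.

Let u (y : Cplx2 R) := cmod (f y) `^ q.

Let q0 : 0 < q. Proof. by apply: lt_le_trans q2; rewrite invr_gt0. Qed.

Let u0 y : 0 <= u y. Proof. exact: powR_ge0. Qed.

Let measurable_u : measurable_fun (to_cplx2 @^-1` unit_ball : set (Real4 R)) (fun x => u (to_cplx2 x)).
Proof.
apply: measurable_ccont2; first exact: (@copen2_ball R 1).
by move=> y y1; apply: ccont_at2_comp_powR => //; exact: hf.
Qed.

Let differentiable_affine (c0 c1 c2 c3 w : Cplx R) :
  unit_ball (c0 + w * c1, c2 + w * c3) ->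
  differentiable (fun s : Cplx R => f (c0 + s * c1, c2 + s * c3)) w.
Proof.
move=> hw; apply: (@differentiable_comp _ _ _ _ (fun s : Cplx R => (c0 + s * c1, c2 + s * c3)) f); last exact: hf.
have dl (c c' : Cplx R) : differentiable (fun s : Cplx R => c + s * c') w.
  apply: differentiableD; first exact: differentiable_cst.
  by apply: differentiableM; [exact: differentiable_idc|exact: differentiable_cst].
exact: differentiable_pair.
Qed.

Let sliceE (s t : Cplx R) : exists c : (Cplx R * Cplx R) * (Cplx R * Cplx R),
  (forall t', to_cplx2 (slice z (of_cplx s, of_cplx t')) = (c.1.1 + t' * c.1.2, c.2.1 + t' * c.2.2)).
Proof.
exists (((s + cpt r 0) * (cpt r^-1 0 * z.1), - cconj (cpt r^-1 0 * z.2)),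
   ((s + cpt r 0) * (cpt r^-1 0 * z.2), cconj (cpt r^-1 0 * z.1))) => t'.
by rewrite to_cplx2_slice /= !of_cplxK.
Qed.

Let sliceE1 : exists c : (Cplx R * Cplx R) * (Cplx R * Cplx R),
  (forall s, to_cplx2 (slice z (of_cplx s, of_cplx 0)) = (c.1.1 + s * c.1.2, c.2.1 + s * c.2.2)).
Proof.
exists ((cpt r 0 * (cpt r^-1 0 * z.1), cpt r^-1 0 * z.1),
   (cpt r 0 * (cpt r^-1 0 * z.2), cpt r^-1 0 * z.2)) => s.
by rewrite to_cplx2_slice /= !of_cplxK !mul0r !addr0 !mulrDl ![s * _ + _]addrC.
Qed.

Let measurable_slice : measurable_fun setT (slice z).
Proof. by have [] := scales_slice z0. Qed.

(** The sub-mean value property over a disc in the complex line of z, followed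
by the one over annuli centred on that line, in the orthogonal lines. *)
Lemma ball_submean : ((u z)%:E * leb4 S <= \int[leb4]_(x in S) (u (to_cplx2 x))%:E)%E.
Proof.
have Sball : S `<=` to_cplx2 @^-1` unit_ball.
  by move=> x [/andP[_ xb] _]; rewrite /unit_ball /= sqnorm_to_cplx2 (lt_trans xb).
have mball : measurable (to_cplx2 @^-1` unit_ball : set (Real4 R)).
  exact: measurable_copen2 (@copen2_ball R 1).
have muS : measurable_fun S (fun x => (u (to_cplx2 x))%:E).
  by apply/measurable_EFinP; exact: measurable_funS mball Sball measurable_u.
have [mI ->] := slice_integral z0 d0 muS (fun x _ => u0 (to_cplx2 x)).
pose cen (w : Real2 R) := slice z (w, of_cplx 0).
have mcen : measurable_fun (disc2 (d ^+ 2)) (fun w => u (to_cplx2 (cen w))).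
  have mc : measurable_fun setT cen.
    exact: (measurableT_comp measurable_slice (pair2_measurable (of_cplx 0))).
  change (measurable_fun (disc2 (d ^+ 2)) ((fun x => u (to_cplx2 x)) \o cen)).
  apply: (@measurable_comp _ _ _ _ _ _ (to_cplx2 @^-1` unit_ball)) => //; last exact: measurable_funTS.
  move=> _ [w /disc_le/shift_le wd <-]; rewrite /unit_ball /= /cen sqnorm_slice//= of_cplxK cmod0 expr0n addr0.
  exact: le_lt_trans wd (lt_trans ab b1).
have inner (w : Real2 R) : disc2 (d ^+ 2) w ->
    ((u (to_cplx2 (cen w)))%:E * (disc_area * (b - a))%:E <=
     \int[leb2]_(t in slice_annulus z a b w) (u (to_cplx2 (slice z (w, t))))%:E)%E.
  move=> wd; rewrite -(slice_annulus_measure wd).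
  have [c cE] := sliceE (to_cplx w) 0; rewrite to_cplxK in cE.
  pose rho := Num.sqrt (b - cmod (to_cplx w + cpt r 0) ^+ 2).
  have wa := shift_le (disc_le wd).
  have rho0 : 0 <= b - cmod (to_cplx w + cpt r 0) ^+ 2 by rewrite subr_ge0 (le_trans wa)// ltW.
  have rr : rho ^+ 2 = b - cmod (to_cplx w + cpt r 0) ^+ 2 by rewrite sqr_sqrtr.
  have inb (t : Cplx R) : cmod t <= rho -> unit_ball (c.1.1 + t * c.1.2, c.2.1 + t * c.2.2).
    move=> tr; rewrite -cE /unit_ball /= sqnorm_slice//= of_cplxK.
    apply: le_lt_trans b1; rewrite -lerBrDl -rr ler_sqr ?nnegrE// sqrtr_ge0//.
  have dv (t : Cplx R) : cmod t <= rho -> differentiable (fun t : Cplx R => f (c.1.1 + t * c.1.2, c.2.1 + t * c.2.2)) t.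
    by move=> tr; apply: differentiable_affine; exact: inb.
  pose v (t : Cplx R) := f (c.1.1 + t * c.1.2, c.2.1 + t * c.2.2).
  have vE t : cmod (v (to_cplx t)) `^ q = u (to_cplx2 (slice z (w, t))).
    by rewrite /v -cE to_cplxK.
  have Er t : slice_annulus z a b w t -> cmod (to_cplx t) <= rho.
    by move=> /andP[_]; rewrite -/r -rr ltr_sqr ?nnegrE ?sqrtr_ge0// => /ltW.
  have mE : measurable (slice_annulus z a b w) by exact: measurable_annulus.
  have mv : measurable_fun (slice_annulus z a b w) (fun t => cmod (v (to_cplx t)) `^ q).
    apply: (@eq_measurable_fun _ _ _ _ _ (fun t => u (to_cplx2 (slice z (w, t))))).
      by move=> t _; rewrite vE.
    change (measurable_fun (slice_annulus z a b w) ((fun x => u (to_cplx2 x)) \o (fun t => slice z (w, t)))).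
    apply: (@measurable_comp _ _ _ _ _ _ (to_cplx2 @^-1` unit_ball)) => //.
      move=> _ [t /Er /inb + <-]; rewrite -cE to_cplxK; exact.
    apply: measurable_funTS.
    exact: (measurableT_comp measurable_slice (pair1_measurable w)).
  have fin : (leb2 (slice_annulus z a b w) < +oo)%E by rewrite slice_annulus_measure// ltry.
  have := powR_area_submean q2 dv (@radial_annulus _ _ _) mE fin Er mv.
  have -> : cmod (v 0) `^ q = u (to_cplx2 (cen w)) by rewrite -[0]of_cplxK vE.
  by under [X in is_true (_ <= X)%E -> _]eq_integral do rewrite vE.
have A0 : 0 <= disc_area * (b - a) by rewrite mulr_ge0 ?(ltW disc_area_gt0)// subr_ge0 ltW.
apply: (@le_trans _ _ (\int[leb2]_(w in disc2 (d ^+ 2))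
    ((disc_area * (b - a))%:E * (u (to_cplx2 (cen w)))%:E))%E); last first.
  apply: ge0_le_integral => //.
  - exact: measurable_disc2.
  - by move=> w _; rewrite mule_ge0// lee_fin.
  - by apply: emeasurable_funM => //; exact/measurable_EFinP.
  - by move=> w wd; rewrite muleC; exact: inner.
rewrite ge0_integralZl_EFin//; [|exact: measurable_disc2|by move=> w _; rewrite lee_fin|exact/measurable_EFinP].
rewrite leb4_cap EFinM muleA [leLHS]muleC; apply: lee_wpmul2l; first by rewrite lee_fin.
rewrite -leb2_disc2 ?sqr_ge0//.
have [c cE] := sliceE1.
pose v (s : Cplx R) := f (c.1.1 + s * c.1.2, c.2.1 + s * c.2.2).
have inb (s : Cplx R) : cmod s <= d -> unit_ball (c.1.1 + s * c.1.2, c.2.1 + s * c.2.2).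
  move=> sd; rewrite -cE /unit_ball /= sqnorm_slice//= !of_cplxK cmod0 expr0n addr0.
  by apply: le_lt_trans (shift_le sd) (lt_trans ab b1).
have dv (s : Cplx R) : cmod s <= d -> differentiable (fun s : Cplx R => f (c.1.1 + s * c.1.2, c.2.1 + s * c.2.2)) s.
  by move=> sd; apply: differentiable_affine; exact: inb.
have vE (s : Real2 R) : cmod (v (to_cplx s)) `^ q = u (to_cplx2 (cen s)).
  by rewrite /v -cE to_cplxK.
have mv : measurable_fun (disc2 (d ^+ 2)) (fun s => cmod (v (to_cplx s)) `^ q).
  apply: (@eq_measurable_fun _ _ _ _ _ (fun w => u (to_cplx2 (cen w)))); last exact: mcen.
  by move=> s _; rewrite vE.
have fin : (leb2 (disc2 (d ^+ 2) : set (Real2 R)) < +oo)%E.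
  by rewrite leb2_disc2 ?sqr_ge0// ltry.
have := powR_area_submean q2 dv (@radial_disc2 _ _) (@measurable_disc2 _ _) fin disc_le mv.
have -> : cmod (v 0) `^ q = u z by rewrite -[0]of_cplxK vE /cen slice_center.
by under [X in is_true (_ <= X)%E -> _]eq_integral do rewrite vE.
Qed.

End ball_submean.

(** * Holomorphic discs and Hopf's lemma *)

Section discs_in_the_ball.
Context {R : realType}.
Variable phi : Cplx R -> Cplx2 R.
Hypothesis phi_ball : forall w, unit_disc w -> unit_ball (phi w).
Hypothesis phi_holo : holomorphic_on unit_disc phi.

Lemma differentiable_phi1 w : unit_disc w -> differentiable (fun w => (phi w).1 : Cplx R) w.
Proof.
move=> /phi_holo dw; apply: (@differentiable_comp _ _ _ _ phi (fun z : Cplx2 R => z.1)) => //.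
apply: (@linear_differentiable _ _ _ (GRing.Linear.clone _ _ _ _ (@fst (Cplx R) (Cplx R)) _)).
by move=> z; exact: cvg_fst.
Qed.

Lemma differentiable_phi2 w : unit_disc w -> differentiable (fun w => (phi w).2 : Cplx R) w.
Proof.
move=> /phi_holo dw; apply: (@differentiable_comp _ _ _ _ phi (fun z : Cplx2 R => z.2)) => //.
apply: (@linear_differentiable _ _ _ (GRing.Linear.clone _ _ _ _ (@snd (Cplx R) (Cplx R)) _)).
by move=> z; exact: cvg_snd.
Qed.

Let psi (w : Cplx R) : R := sqnorm (phi w).

Let psiE : psi = fun w => cmod (phi w).1 `^ 2 + cmod (phi w).2 `^ 2.
Proof. by apply/funext => w; rewrite /psi /sqnorm !powR_mulrn // cmod_ge0. Qed.

Lemma ccont_at_sqnorm_phi w : unit_disc w -> ccont_at (fun w => sqnorm (phi w)) w.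
Proof.
move=> w1; change (ccont_at psi w); rewrite psiE.
by apply: ccont_at_add; apply: ccont_at_powR => //; [exact: differentiable_phi1|exact: differentiable_phi2].
Qed.

Lemma subh_at_sqnorm_phi w : unit_disc w -> subh_at (fun w => sqnorm (phi w)) w.
Proof.
move=> w1; change (subh_at psi w); rewrite psiE.
have H z : cmod (z - w) < 1 - cmod w -> unit_disc z.
  by move=> zw; have := le_lt_trans (cmod_lip _ _) zw => /ltr_normlP[]; rewrite /unit_disc /=; lra.
by apply: subh_at_add; apply: (@subh_at_powR _ _ _ (1 - cmod w)); rewrite ?subr_gt0//; try lra;
  move=> z /H z1; [exact: differentiable_phi1|exact: differentiable_phi2].
Qed.

Let differentiable_inv (w : Cplx R) : w != 0 -> differentiable (fun w : Cplx R => w^-1) w.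
Proof. by move=> w0; apply: differentiableV => //; exact: differentiable_idc. Qed.

Let annulus_closed_bounded (r : R) : closed_bounded [set w : Cplx R | 2^-1 <= cmod w <= r].
Proof.
split; first by exists r => w /andP[].
move=> w /negP; rewrite negb_and -!ltNge => /orP[w2|wr].
  exists (2^-1 - cmod w); first by rewrite subr_gt0.
  move=> z zw; apply/negP; rewrite negb_and -!ltNge; apply/orP; left.
  by have := le_lt_trans (cmod_lip _ _) zw => /ltr_normlP[]; lra.
exists (cmod w - r); first by rewrite subr_gt0.
move=> z zw; apply/negP; rewrite negb_and -!ltNge; apply/orP; right.
by have := le_lt_trans (cmod_lip _ _) zw => /ltr_normlP[]; lra.
Qed.

(** Compare 1 - |phi|^2 with a multiple of 1 / |w| - 1, which is superharmonic
and vanishes on the unit circle. *)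
Lemma hopf : exists2 c : R, 0 < c & forall w, unit_disc w ->
  c * (1 - cmod w ^+ 2) <= 1 - sqnorm (phi w).
Proof.
have [w0 w02 w0max] : exists2 w0 : Cplx R, [set w | cmod w <= 2^-1] w0 &
    forall w, [set w | cmod w <= 2^-1] w -> psi w <= psi w0.
  apply: max_exists; first exact: disc_closed_bounded.
  - by move=> w /= w2; apply: ccont_at_sqnorm_phi; apply: le_lt_trans w2 _; lra.
  - by exists 0; rewrite /= cmod0 invr_ge0.
pose c1 := 1 - psi w0.
have c10 : 0 < c1.
  by rewrite subr_gt0; apply: phi_ball; apply: le_lt_trans w02 _; lra.
exists (c1 / 2); first by rewrite divr_gt0.
move=> w w1; rewrite -/(psi w); have [w2|w2] := leP (cmod w) 2^-1.
  apply: (@le_trans _ _ (1 - psi w0)); last by rewrite lerD2l lerN2; exact: w0max.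
  rewrite -/c1 -mulrA ler_piMr ?(ltW c10)//.
  by have := sqr_ge0 (cmod w); lra.
(* On 1/2 <= |z| <= rho both boundary values of v are at most c1 / rho + 1. *)
pose v (z : Cplx R) := c1 * cmod (z^-1) + psi z.
have w00 : 0 < cmod w by lra.
have rho_bound (rho : R) : cmod w <= rho -> rho < 1 -> c1 / cmod w + psi w <= c1 / rho + 1.
  move=> wr r1; have r0 : 0 < rho by apply: lt_le_trans wr.
  have Kd z : 2^-1 <= cmod z <= rho -> z != 0 /\ unit_disc z.
    by move=> /andP[z2 zr]; rewrite -cmod_gt0 /unit_disc/=; split; lra.
  have -> : c1 / cmod w + psi w = v w by rewrite /v cmodV.
  apply: (@max_principle _ [set w : Cplx R | 2^-1 <= cmod w <= rho]) => //=.
  - move=> z /Kd[z0 z1]; apply: ccont_at_add; last exact: ccont_at_sqnorm_phi.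
    apply: ccont_at_scale; under eq_fun do rewrite -[cmod _]powRr1//.
    exact: (ccont_at_powR ltr01 (differentiable_inv z0)).
  - move=> z zK; have [z0 z1] := Kd _ zK; have [z2 zr] := andP zK.
    have cr : c1 <= c1 / rho by rewrite ler_pdivlMr// ler_piMr// ltW.
    move: z2; rewrite le_eqVlt => /predU1P[z2|z2].
      left; rewrite /v cmodV -z2 invrK; have := w0max z; rewrite /= -z2 lexx => /(_ isT).
      by rewrite /c1 in cr *; lra.
    move: zr; rewrite le_eqVlt => /predU1P[zr|zr].
      by left; rewrite /v cmodV zr lerD2l ltW//; exact: phi_ball.
    right; split.
      apply: subh_at_add; last exact: subh_at_sqnorm_phi.
      apply: subh_at_scale; first exact: ltW.
      under eq_fun do rewrite -[cmod _]powRr1//.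
      have half1 : 2^-1 <= 1 :> R by lra.
      have z00 : 0 < cmod z by rewrite cmod_gt0.
      apply: (subh_at_powR half1 z00) => z' zz'; apply: differentiable_inv; rewrite -cmod_gt0.
      by have := le_lt_trans (cmod_lip _ _) zz' => /ltr_normlP[]; lra.
    exists (Num.min (cmod z - 2^-1) (rho - cmod z)); first by rewrite lt_min !subr_gt0 z2.
    move=> z'; rewrite lt_min => /andP[/(le_lt_trans (cmod_lip _ _))/ltr_normlP[A1 A2]].
    move=> /(le_lt_trans (cmod_lip _ _))/ltr_normlP[A3 A4].
    by apply/andP; split; lra.
  - by apply/andP; split => //; exact: ltW.
have H : c1 / cmod w + psi w <= c1 + 1.
  apply/ler_addgt0Pr => e e0.
  (* Close enough to 1 for c1 / rho <= c1 + e. *)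
  pose rho := Num.max (cmod w) (c1 / (c1 + e)).
  have ce : 0 < c1 + e by rewrite addr_gt0.
  have r1 : rho < 1 by rewrite gt_max w1/= ltr_pdivrMr// mul1r ltrDl.
  have := rho_bound rho; rewrite le_max lexx r1 => /(_ isT isT) /le_trans; apply.
  rewrite -addrA [1 + e]addrC addrA lerD2r ler_pdivrMr; last by rewrite lt_max w00.
  apply: (@le_trans _ _ ((c1 + e) * (c1 / (c1 + e)))); first by rewrite mulrC divfK// gt_eqF.
  by rewrite ler_wpM2l ?(ltW ce)// le_max lexx orbT.
have : c1 * (2 - cmod w) <= c1 / cmod w.
  by rewrite ler_pdivlMr// -mulrA ler_piMr ?(ltW c10)//; have := sqr_ge0 (1 - cmod w); nra.
move: H; have : 0 <= c1 * (1 - cmod w) ^+ 2 by rewrite mulr_ge0 ?sqr_ge0// ltW.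
by generalize (c1 / cmod w) => t; clear; nra.
Qed.

End discs_in_the_ball.

(** * Schur's test *)

Lemma measurable_invR {R : realType} d (T : measurableType d) (D : set T) (f : T -> R) :
  (forall x, 0 <= f x) -> measurable_fun D f -> measurable_fun D (fun x => (f x)^-1).
Proof.
move=> f0 mf; apply: (@eq_measurable_fun _ _ _ _ _ (fun x => f x `^ (-1))).
  by move=> x _; rewrite powR_inv1.
exact: (measurableT_comp (measurable_powR _) mf).
Qed.

Section schur_test.
Context d1 d2 (T1 : measurableType d1) (T2 : measurableType d2) {R : realType}.
Variable m1 : {sigma_finite_measure set T1 -> \bar R}.
Variable m2 : {sigma_finite_measure set T2 -> \bar R}.
Variables (Q : T1 * T2 -> R) (s A : T1 -> R) (u : T2 -> R) (k c : R).
Hypotheses (mQ : measurable_fun setT Q) (ms : measurable_fun setT s).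
Hypotheses (mA : measurable_fun setT A) (mu : measurable_fun setT u).
Hypotheses (Q0 : forall x, 0 <= Q x) (s1 : forall w, 1 <= s w).
Hypotheses (A0 : forall w, 0 <= A w) (u0 : forall x, 0 <= u x).
Hypotheses (k0 : 0 <= k) (c0 : 0 <= c).
Hypothesis AQ : forall w, ((A w * c)%:E <= \int[m2]_x (Q (w, x) * u x)%:E)%E.
Hypothesis Q1 : forall w, (\int[m2]_x (Q (w, x))%:E <= c%:E)%E.
Hypothesis QQ : forall w,
  (\int[m1]_w' \int[m2]_x (Q (w, x) * Q (w', x) * s w')%:E <= (k * c * s w)%:E)%E.
Hypothesis Qs : forall x, (\int[m1]_w (Q (w, x) * s w)%:E < +oo)%E.
Hypothesis A2 : (\int[m1]_w (A w ^+ 2)%:E < +oo)%E.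

(** The weight on the second factor is the one induced by s: this makes one of the
two inequalities of Schur's test an identity and turns the other into QQ. *)
Let g (x : T2) : R := fine (\int[m1]_w (Q (w, x) * s w)%:E).

Let s0 w : 0 < s w. Proof. exact: lt_le_trans (s1 w). Qed.

Let gE x : ((g x)%:E = \int[m1]_w (Q (w, x) * s w)%:E)%E.
Proof.
by rewrite /g fineK// ge0_fin_numE ?Qs// integral_ge0// => w _; rewrite lee_fin mulr_ge0// ltW.
Qed.

Let g0 x : 0 <= g x.
Proof. by rewrite fine_ge0// integral_ge0// => w _; rewrite lee_fin mulr_ge0// ltW. Qed.

Let ms1 : measurable_fun setT (fun z : T1 * T2 => s z.1).
Proof. exact: (measurableT_comp ms measurable_fst). Qed.

Let mA1 : measurable_fun setT (fun z : T1 * T2 => A z.1).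
Proof. exact: (measurableT_comp mA measurable_fst). Qed.

Let mu2 : measurable_fun setT (fun z : T1 * T2 => u z.2).
Proof. exact: (measurableT_comp mu measurable_snd). Qed.

Let mg : measurable_fun setT g.
Proof.
apply: (measurableT_comp (@fine_measurable _ _ measurableT)) => //=.
have mQs : measurable_fun setT (fun z : T1 * T2 => (Q z * s z.1)%:E).
  by apply/measurable_EFinP; exact: measurable_funM.
exact: (@measurable_fun_fubini_tonelli_G _ _ _ _ _ m1 _ mQs (fun z => mulr_ge0 (Q0 z) (ltW (s0 z.1)))).
Qed.

Let t := k + 1.

Let t0 : 0 < t. Proof. by rewrite /t ltr_wpDl. Qed.

(** The two halves of the weighted inequality of arithmetic and geometric means
for A Q u. The 1 added to g avoids division by 0 and is paid for by Q1. *)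
Let wA (z : T1 * T2) := (A z.1 ^+ 2 / (s z.1 * t)) * (Q z * (g z.2 + 1)).

Let wu (z : T1 * T2) := (t * (u z.2 ^+ 2 / (g z.2 + 1))) * (Q z * s z.1).

Let g1 x : 0 < g x + 1. Proof. by rewrite ltr_wpDl. Qed.

Let wA0 z : 0 <= wA z.
Proof. by rewrite mulr_ge0 ?divr_ge0 ?sqr_ge0// mulr_ge0// ltW. Qed.

Let wu0 z : 0 <= wu z.
Proof. by rewrite !mulr_ge0 ?sqr_ge0 ?invr_ge0// ltW. Qed.

Let mg2 : measurable_fun setT (fun z : T1 * T2 => g z.2 + 1).
Proof. by apply: measurable_funD => //; exact: (measurableT_comp mg measurable_snd). Qed.

Let mwA : measurable_fun setT wA.
Proof.
apply: measurable_funM; last exact: measurable_funM.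
apply: measurable_funM; first exact: measurable_funX.
by apply: measurable_invR => [z|]; [rewrite mulr_ge0// ltW|exact: measurable_funM].
Qed.

Let mwu : measurable_fun setT wu.
Proof.
apply: measurable_funM; last exact: measurable_funM.
apply: measurable_funM => //; apply: measurable_funM; first exact: measurable_funX.
by apply: measurable_invR => [z|//]; exact: ltW.
Qed.

Let amgm z : 2 * (A z.1 * (Q z * u z.2)) <= wA z + wu z.
Proof.
pose y := (g z.2 + 1) / (s z.1 * t).
have y0 : 0 < y by rewrite divr_gt0// mulr_gt0.
have -> : wA z + wu z = Q z * (A z.1 ^+ 2 * y + u z.2 ^+ 2 * y^-1).
  by rewrite /wA /wu /y invf_div; field; rewrite !gt_eqF.
have -> : 2 * (A z.1 * (Q z * u z.2)) = Q z * (A z.1 * (u z.2 * 2)) by ring.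
rewrite ler_wpM2l//.
rewrite -subr_ge0; have -> : A z.1 ^+ 2 * y + u z.2 ^+ 2 / y - A z.1 * (u z.2 * 2) =
    (A z.1 * y - u z.2) ^+ 2 / y by field; rewrite gt_eqF.
by rewrite divr_ge0 ?sqr_ge0// ltW.
Qed.

Let Qg w : (\int[m2]_x (Q (w, x) * (g x + 1))%:E <= (t * c * s w)%:E)%E.
Proof.
have mQw : measurable_fun setT (fun x => Q (w, x)) by exact: measurable_fun_pair2.
under eq_integral do rewrite mulrDr mulr1 EFinD.
rewrite ge0_integralD//; last 4 first.
- by move=> x _; rewrite lee_fin mulr_ge0.
- by apply/measurable_EFinP; exact: measurable_funM.
- by move=> x _; rewrite lee_fin.
- exact/measurable_EFinP.
apply: (@le_trans _ _ ((k * c * s w)%:E + c%:E)%E); last first.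
  by rewrite -EFinD lee_fin /t !mulrDl mul1r lerD2l ler_peMr.
apply: leeD => //; apply: le_trans (QQ w).
have mF : measurable_fun setT (fun z : T1 * T2 => (Q (w, z.2) * Q z * s z.1)%:E).
  apply/measurable_EFinP; apply: measurable_funM => //; apply: measurable_funM => //.
  exact: (measurableT_comp mQw measurable_snd).
have F0 z : (0 <= (Q (w, z.2) * Q z * s z.1)%:E)%E by rewrite lee_fin !mulr_ge0// ltW.
rewrite (@fubini_tonelli _ _ _ _ _ m1 m2 _ mF F0)/=.
rewrite le_eqVlt; apply/orP; left; apply/eqP; apply: eq_integral => x _.
rewrite EFinM gE -ge0_integralZl_EFin//.
- by apply: eq_integral => w' _; rewrite -EFinM mulrA.
- by move=> w' _; rewrite lee_fin mulr_ge0// ltW.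
- by apply/measurable_EFinP; apply: measurable_funM => //; exact: measurable_fun_pair1.
Qed.

(** By the weighted inequality 2 c |A|^2 <= c |A|^2 + t |u|^2 for the squared
norms; since |A| is finite it can be absorbed. *)
Lemma schur_test : (c%:E * \int[m1]_w (A w ^+ 2)%:E <= t%:E * \int[m2]_x (u x ^+ 2)%:E)%E.
Proof.
have mA2 : measurable_fun setT (fun w => (A w ^+ 2)%:E).
  by apply/measurable_EFinP; exact: measurable_funX.
have mu2' : measurable_fun setT (fun x => (u x ^+ 2)%:E).
  by apply/measurable_EFinP; exact: measurable_funX.
have A20 w : (0 <= (A w ^+ 2)%:E)%E by rewrite lee_fin sqr_ge0.
have mE1 : measurable_fun setT (fun z => (wA z)%:E) by exact/measurable_EFinP.
have mE2 : measurable_fun setT (fun z => (wu z)%:E) by exact/measurable_EFinP.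
have mE12 : measurable_fun setT (fun z => (wA z)%:E + (wu z)%:E)%E by exact: emeasurable_funD.
have E120 z : (0 <= (wA z)%:E + (wu z)%:E)%E by rewrite -EFinD lee_fin addr_ge0.
have I1 : (\int[m1]_w \int[m2]_x (wA (w, x))%:E <= c%:E * \int[m1]_w (A w ^+ 2)%:E)%E.
  rewrite -ge0_integralZl_EFin//; apply: ge0_le_integral => //.
  - by move=> w _; apply: integral_ge0 => x _; rewrite lee_fin.
  - exact: (@measurable_fun_fubini_tonelli_F _ _ _ _ _ m2 _ mE1).
  - exact: measurable_funeM.
  move=> w _; have -> : (\int[m2]_x (wA (w, x))%:E =
      \int[m2]_x ((A w ^+ 2 / (s w * t))%:E * (Q (w, x) * (g x + 1))%:E))%E.
    by apply: eq_integral => x _; rewrite -EFinM.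
  rewrite ge0_integralZl_EFin//; last 3 first.
  - by move=> x _; rewrite lee_fin mulr_ge0// ltW.
  - apply/measurable_EFinP; apply: measurable_funM; first exact: measurable_fun_pair2.
    exact: measurable_funD.
  - by rewrite divr_ge0 ?sqr_ge0// mulr_ge0// ltW.
  apply: (@le_trans _ _ ((A w ^+ 2 / (s w * t))%:E * (t * c * s w)%:E)%E).
    by apply: lee_wpmul2l => //; rewrite lee_fin divr_ge0 ?sqr_ge0// mulr_ge0// ltW.
  rewrite -!EFinM lee_fin le_eqVlt; apply/orP; left; apply/eqP; field.
  by rewrite !gt_eqF.
have I2 : (\int[m2]_x \int[m1]_w (wu (w, x))%:E <= t%:E * \int[m2]_x (u x ^+ 2)%:E)%E.
  rewrite -ge0_integralZl_EFin//; [|by move=> x _; rewrite lee_fin sqr_ge0|exact: ltW].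
  apply: ge0_le_integral => //.
  - by move=> w _; apply: integral_ge0 => x _; rewrite lee_fin.
  - exact: (@measurable_fun_fubini_tonelli_G _ _ _ _ _ m1 _ mE2).
  - exact: measurable_funeM.
  move=> x _; have -> : (\int[m1]_w (wu (w, x))%:E =
      \int[m1]_w ((t * (u x ^+ 2 / (g x + 1)))%:E * (Q (w, x) * s w)%:E))%E.
    by apply: eq_integral => w _; rewrite -EFinM.
  rewrite ge0_integralZl_EFin//; last 3 first.
  - by move=> w _; rewrite lee_fin mulr_ge0// ltW.
  - by apply/measurable_EFinP; apply: measurable_funM => //; exact: measurable_fun_pair1.
  - by rewrite mulr_ge0 ?divr_ge0 ?sqr_ge0// ltW.
  rewrite -gE -!EFinM lee_fin -mulrA ler_wpM2l ?(ltW t0)//.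
  rewrite -mulrA ler_piMr ?sqr_ge0// mulrC ler_pdivrMr// mul1r lerDl//.
have I12 : ((2 * c)%:E * \int[m1]_w (A w ^+ 2)%:E <=
    \int[m1]_w \int[m2]_x ((wA (w, x))%:E + (wu (w, x))%:E))%E.
  have c20 : 0 <= 2 * c by rewrite mulr_ge0.
  rewrite -ge0_integralZl_EFin//; apply: ge0_le_integral => //.
  - by move=> w _; rewrite mule_ge0.
  - exact: measurable_funeM.
  - exact: (@measurable_fun_fubini_tonelli_F _ _ _ _ _ m2 _ mE12).
  move=> w _; have mQu : measurable_fun setT (fun x => (Q (w, x) * u x)%:E).
    by apply/measurable_EFinP; apply: measurable_funM => //; exact: measurable_fun_pair2.
  have Qu0 x : (0 <= (Q (w, x) * u x)%:E)%E by rewrite lee_fin mulr_ge0.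
  have AA0 : 0 <= 2 * A w by rewrite mulr_ge0.
  apply: (@le_trans _ _ ((2 * A w)%:E * \int[m2]_x (Q (w, x) * u x)%:E)%E).
    have -> : ((2 * c)%:E * (A w ^+ 2)%:E = (2 * A w)%:E * (A w * c)%:E)%E.
      by rewrite -!EFinM; congr EFin; ring.
    by apply: lee_wpmul2l; rewrite ?lee_fin.
  rewrite -ge0_integralZl_EFin//; apply: ge0_le_integral => //.
  - by move=> x _; rewrite mule_ge0.
  - exact: measurable_funeM.
  - exact: (measurable_fun_pair2 w mE12).
  by move=> x _; rewrite -EFinM -EFinD lee_fin -mulrA; exact: (amgm (w, x)).
rewrite -(@fubini_tonelli1 _ _ _ _ _ m1 m2 _ mE12 E120) ge0_integralD//= in I12; last 2 first.
- by move=> z _; rewrite lee_fin.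
- by move=> z _; rewrite lee_fin.
rewrite (@fubini_tonelli1 _ _ _ _ _ m1 m2 _ mE1)// in I12.
rewrite (@fubini_tonelli2 _ _ _ _ _ m1 m2 _ mE2)// in I12.
have := le_trans I12 (leeD I1 I2).
have : (\int[m1]_w (A w ^+ 2)%:E)%E \is a fin_num by rewrite ge0_fin_numE// integral_ge0.
move=> /fineK <-; rewrite -!EFinM.
case: (t%:E * _)%E => [r||] //=; rewrite ?leey// -?EFinD ?lee_fin.
by lra.
Qed.

End schur_test.

(** * Overlapping caps *)

Section hermitian_form.
Context {R : realType}.
Implicit Types (x y z : Cplx2 R).

Let csub x y : Cplx2 R := (x.1 - y.1, x.2 - y.2).

Lemma sqnorm_csub y z : sqnorm (csub y z) = sqnorm y + sqnorm z - 2 * cre (herm y z).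
Proof.
rewrite /sqnorm /herm /csub /= !sqr_cmod !creD !cimD !creN !cimN !creM.
rewrite /cconj !Re_cpt !Im_cpt; ring.
Qed.

Lemma cmod_herm_le y z : cmod (herm y z) <= (sqnorm y + sqnorm z) / 2.
Proof.
apply: le_trans (cmodD _ _) _; rewrite !cmodM !cmod_conj /sqnorm.
by have := sqr_ge0 (cmod y.1 - cmod z.1); have := sqr_ge0 (cmod y.2 - cmod z.2); nra.
Qed.

Lemma herm_conj y z : herm y z = cconj (herm z y).
Proof.
apply: cplx_eq; rewrite /herm /cconj ?Re_cpt ?Im_cpt ?creD ?cimD ?creM ?cimM ?Re_cpt ?Im_cpt; ring.
Qed.

Lemma herm_diag z : herm z z = cpt (sqnorm z) 0.
Proof.
apply: cplx_eq; rewrite /herm /sqnorm ?sqr_cmod /cconj ?Re_cpt ?Im_cpt ?creD ?cimD ?creM ?cimM ?Re_cpt ?Im_cpt; ring.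
Qed.

Lemma Re_one_sub_herm y z : (1 - sqnorm y) + (1 - sqnorm z) <= 2 * cre (1 - herm y z).
Proof.
have := sqnorm_ge0 (csub y z); rewrite sqnorm_csub.
have -> : cre (1 - herm y z) = 1 - cre (herm y z) by rewrite creD creN.
by lra.
Qed.

(** The quantity |1 - <y, z>| is, up to a constant, the square of a distance on
the ball; this is its triangle inequality, through a point x close to the
sphere. *)
Lemma quasi_triangle x y z : sqnorm x <= 1 ->
  cmod (1 - herm y z) <= cmod (1 - herm y x) + cmod (1 - herm x z) + (1 - sqnorm x)
    + (sqnorm (csub y x) + sqnorm (csub z x)) / 2.
Proof.
move=> x1.
have -> : 1 - herm y z = ((1 - herm y x) + (1 - herm x z) - cpt (1 - sqnorm x) 0)
    - herm (csub y x) (csub z x).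
  have -> : cpt (1 - sqnorm x) 0 = 1 - herm x x.
    by rewrite herm_diag; apply: cplx_eq; rewrite ?creD ?cimD ?creN ?cimN ?Re_cpt ?Im_cpt ?subr0.
  apply: cplx_eq; rewrite /herm /csub /= /cconj
    ?(creD, cimD, creN, cimN, creM, cimM, Re_cpt, Im_cpt); ring.
apply: le_trans (cmodB _ _) _; apply: lerD; last exact: cmod_herm_le.
apply: le_trans (cmodB _ _) _; apply: lerD; first exact: cmodD.
by rewrite cmodE Re_cpt Im_cpt expr0n addr0 sqrtr_sqr ger0_norm// subr_ge0.
Qed.

Definition cap_size z : R := (1 - Num.sqrt (sqnorm z)) / 2.

(** A point x of the cap at z is as close to z as z is to the sphere, both in
the sense of |1 - <x, z>| and of the square of |x - z|. The constants come from
1 - |z|^2 <= 4 d and |x|^2 >= (1 - d)^2, where d is the size of the cap. *)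
Let in_cap z b (x : Real4 R) : sqnorm z < 1 -> 0 < sqnorm z -> b < 1 ->
  shell ((Num.sqrt (sqnorm z) + cap_size z) ^+ 2) b x -> cap z (cap_size z) x ->
  [/\ cmod (1 - herm (to_cplx2 x) z) <= 5 * cap_size z,
      sqnorm (csub z (to_cplx2 x)) <= 10 * cap_size z,
      1 - sqnorm (to_cplx2 x) <= 2 * cap_size z & sqnorm (to_cplx2 x) <= 1].
Proof.
have arith (s t : R) : t < (1 - s) / 2 * s -> 1 - s ^+ 2 + t <= 5 * ((1 - s) / 2).
  by have := sqr_ge0 (1 - s); nra.
move=> z1 z0 b1; rewrite /shell /cap /= -sqnorm_to_cplx2.
set X := to_cplx2 x; set d : R := cap_size z; set r : R := Num.sqrt (sqnorm z).
have r2 : sqnorm z = r ^+ 2 by rewrite sqr_sqrtr// ltW.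
have r0 : 0 < r by rewrite sqrtr_gt0.
have r1 : r < 1 by rewrite -[X in _ < X]sqrtr1 ltr_sqrt.
have dE : d = (1 - r) / 2 by [].
move=> /andP[ax xb]; rewrite r2 -exprMn ltr_sqr ?nnegrE ?cmod_ge0//; last first.
  by rewrite mulr_ge0 ?(ltW r0)// dE divr_ge0// subr_ge0 ltW.
move=> xc; have h5 : cmod (1 - herm X z) <= 5 * d.
  have -> : 1 - herm X z = cpt (1 - r ^+ 2) 0 - (herm X z - cpt (r ^+ 2) 0).
    by apply: cplx_eq; rewrite ?(creD, cimD, creN, cimN, Re_cpt, Im_cpt) /cre /cim /=; ring.
  apply: le_trans (cmodB _ _) _.
  rewrite cmodE Re_cpt Im_cpt expr0n addr0 sqrtr_sqr ger0_norm//; last by rewrite subr_ge0 expr_le1// ltW.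
  by move: xc; rewrite dE; exact: arith.
split => //.
- rewrite sqnorm_csub herm_conj.
  have -> : cre (cconj (herm X z)) = cre (herm X z) by rewrite /cconj Re_cpt.
  have := le_trans (le_trans (ler_norm _) (Re_le_cmod _)) h5; have -> : cre (1 - herm X z) = 1 - cre (herm X z) by rewrite creD creN.
  by have := ltW z1; lra.
- by move: ax; rewrite dE; nra.
- by lra.
Qed.

(** Up to a constant factor, the density of the mean over the cap at z; its
volume is proportional to the square of its size. *)
Definition cap_kernel z (x : Real4 R) : R :=
  if cmod (herm (to_cplx2 x) z - cpt (sqnorm z) 0) ^+ 2 < cap_size z ^+ 2 * sqnorm z
  then (cap_size z ^+ 2)^-1 else 0.

Lemma cap_kernel_ge0 z (x : Real4 R) : 0 <= cap_kernel z x.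
Proof. by rewrite /cap_kernel; case: ifP => // _; rewrite invr_ge0 sqr_ge0. Qed.

Lemma cap_size_gt0 z : sqnorm z < 1 -> 0 < cap_size z.
Proof.
move=> z1; rewrite divr_gt0// subr_gt0 -[X in _ < X]sqrtr1 ltr_sqrt//.
Qed.

Let cap_kernel_prod y z b (x : Real4 R) : 0 < sqnorm y < 1 -> 0 < sqnorm z < 1 ->
  b < 1 -> shell ((Num.sqrt (sqnorm y) + cap_size y) ^+ 2) b x ->
  shell ((Num.sqrt (sqnorm z) + cap_size z) ^+ 2) b x ->
  cap_kernel y x * cap_kernel z x <=
  2 * 12 ^+ 2 * (cmod (1 - herm y z) ^+ 2)^-1 * (cap_kernel y x + cap_kernel z x).
Proof.
move=> /andP[y0 y1] /andP[z0 z1] b1 xy xz.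
have [ky0 kz0] := (cap_kernel_ge0 y x, cap_kernel_ge0 z x).
have R0 : 0 <= 2 * 12 ^+ 2 * (cmod (1 - herm y z) ^+ 2)^-1 * (cap_kernel y x + cap_kernel z x).
  by apply: mulr_ge0 (addr_ge0 ky0 kz0); rewrite mulr_ge0 ?invr_ge0 ?sqr_ge0// mulr_ge0 ?sqr_ge0.
move: R0; rewrite /cap_kernel; case: ifP => ycap; last by rewrite mul0r.
case: ifP => zcap; last by rewrite mulr0.
move=> _; have [y5 yx x1y xl1] := in_cap y1 y0 b1 xy ycap.
have [z5 zx x1z _] := in_cap z1 z0 b1 xz zcap.
have [dy0 dz0] := (cap_size_gt0 y1, cap_size_gt0 z1).
have h0 : 0 < cmod (1 - herm y z).
  apply: lt_le_trans (le_trans (ler_norm _) (Re_le_cmod _)).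
  by have := Re_one_sub_herm y z; lra.
have h12 : cmod (1 - herm y z) <= 12 * (cap_size y + cap_size z).
  have := quasi_triangle y z xl1.
  have -> : cmod (1 - herm y (to_cplx2 x)) = cmod (1 - herm (to_cplx2 x) y).
    rewrite -cmod_conj; congr cmod; rewrite [herm y _]herm_conj.
    by apply: cplx_eq; rewrite /cconj ?(creD, cimD, creN, cimN, Re_cpt, Im_cpt) /cre /cim /=; ring.
  by lra.
move: h0 h12 dy0 dz0; set h := cmod _; set d := cap_size y; set e := cap_size z.
move=> h0 h12 d0 e0.
have hh : h ^+ 2 <= 2 * 12 ^+ 2 * (d ^+ 2 + e ^+ 2).
  apply: (@le_trans _ _ ((12 * (d + e)) ^+ 2)).
    by rewrite ler_sqr ?nnegrE ?mulr_ge0 ?addr_ge0// ltW.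
  by have := sqr_ge0 (d - e); nra.
have -> : (d ^+ 2)^-1 + (e ^+ 2)^-1 = (d ^+ 2 + e ^+ 2) * ((d ^+ 2)^-1 * (e ^+ 2)^-1).
  by field; rewrite !gt_eqF.
rewrite mulrA ler_peMl ?mulr_ge0 ?invr_ge0 ?sqr_ge0//.
by rewrite mulrAC ler_pdivlMr ?exprn_gt0// mul1r.
Qed.

(** If the caps at y and z have a point x in common then |1 - <y, z>| <= 12 (d +
e), where d and e are their sizes, by the quasi-triangle inequality. As (d e)^-2
= (d^-2 + e^-2) / (d^2 + e^2), a product of kernels is controlled by their sum
times |1 - <y, z>|^-2. *)
Lemma cap_kernel_overlap : exists2 k : R, 0 <= k & forall y z b (x : Real4 R),
  0 < sqnorm y < 1 -> 0 < sqnorm z < 1 ->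
  b < 1 -> shell ((Num.sqrt (sqnorm y) + cap_size y) ^+ 2) b x ->
  shell ((Num.sqrt (sqnorm z) + cap_size z) ^+ 2) b x ->
  cap_kernel y x * cap_kernel z x <=
  k * (cmod (1 - herm y z) ^+ 2)^-1 * (cap_kernel y x + cap_kernel z x).
Proof.
(* (12 (d + e))^2 <= 2 * 12^2 (d^2 + e^2). *)
by exists (2 * 12 ^+ 2); [by rewrite mulr_ge0 ?sqr_ge0|move=> y z b x; exact: cap_kernel_prod]. Qed.

End hermitian_form.

(** * The kernel on layers of the disc *)

Section layers.
Context {R : realType}.
Variables (phi : Cplx R -> Cplx2 R) (c : R).
Hypothesis phi_ball : forall w, unit_disc w -> unit_ball (phi w).
Hypothesis phi_holo : holomorphic_on unit_disc phi.
Hypothesis c0 : 0 < c.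
Hypothesis phi_hopf : forall w, unit_disc w -> c * (1 - cmod w ^+ 2) <= 1 - sqnorm (phi w).

Lemma copen_unit_disc : copen (@unit_disc R).
Proof.
move=> w w1; exists (1 - cmod w); first by rewrite subr_gt0.
by move=> z zw; have := le_lt_trans (cmod_lip _ _) zw => /ltr_normlP[]; rewrite /unit_disc /=; lra.
Qed.

Lemma measurable_unit_disc : measurable (to_cplx @^-1` unit_disc : set (Real2 R)).
Proof. exact: measurable_copen copen_unit_disc. Qed.

Lemma mcfun_differentiable (g : Cplx R -> Cplx R) :
  (forall w, unit_disc w -> differentiable g w) ->
  mcfun (to_cplx @^-1` unit_disc : set (Real2 R)) (fun x => g (to_cplx x)).
Proof.
move=> dg; have H (h : Cplx R -> R) : (forall z w, `|h z - h w| <= cmod (z - w)) ->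
    measurable_fun (to_cplx @^-1` unit_disc : set (Real2 R)) (fun x => h (g (to_cplx x))).
  move=> hlip; apply: (measurable_ccont copen_unit_disc (f := h \o g)).
  move=> w /dg/differentiable_ccont gc e e0; have [r r0 rP] := gc _ e0.
  by exists r => // z /rP; rewrite [w + _]addrC subrK; apply: le_trans; exact: hlip.
split; apply: H => z w.
- by rewrite -creN -creD; exact: Re_le_cmod.
- by rewrite -cimN -cimD; exact: Im_le_cmod.
Qed.

Lemma mcfun_phi :
  mcfun (to_cplx @^-1` unit_disc : set (Real2 R)) (fun x => (phi (to_cplx x)).1) /\
  mcfun (to_cplx @^-1` unit_disc : set (Real2 R)) (fun x => (phi (to_cplx x)).2).
Proof.
split; first exact: (mcfun_differentiable (differentiable_phi1 phi_holo)).
exact: (mcfun_differentiable (differentiable_phi2 phi_holo)).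
Qed.

Definition disc_kernel (z : Cplx2 R) (x : Real2 R) : R :=
  (cmod (1 - herm (phi (to_cplx x)) z) ^+ 2)^-1.

Lemma disc_kernel_ge0 z x : 0 <= disc_kernel z x.
Proof. by rewrite invr_ge0 sqr_ge0. Qed.

Lemma measurable_disc_kernel z :
  measurable_fun (to_cplx @^-1` unit_disc : set (Real2 R)) (disc_kernel z).
Proof.
apply: measurable_invR => [x|]; first exact: sqr_ge0.
apply: measurable_sqr_cmod_comp; apply: mcfunD; first exact: mcfun_cst.
by have [m1 m2] := mcfun_phi; apply: mcfunN; apply: mcfunD; apply: mcfunM => //; exact: mcfun_cst.
Qed.

Let Re_gt0 w z : unit_disc w -> sqnorm z < 1 -> 0 < cre (1 - herm (phi w) z).
Proof.
move=> /phi_ball w1 z1; have := Re_one_sub_herm (phi w) z.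
by have w1' : sqnorm (phi w) < 1 := w1; lra.
Qed.

Let ker_neq0 w z : unit_disc w -> sqnorm z < 1 -> 1 - herm (phi w) z != 0.
Proof.
move=> w1 z1; rewrite -cmod_gt0; apply: lt_le_trans (Re_gt0 w1 z1) _.
exact: le_trans (ler_norm _) (Re_le_cmod _).
Qed.

(** F = 1 / (1 - <phi, z>) has positive real part, so |F| <= B gives |F|^2 = 2
(Re F)^2 - Re F^2 <= Re (2 B F - F^2), whose mean over a rotation invariant set
is its value at 0. That value is at most 3 B K. *)
Lemma layer_kernel_le (z : Cplx2 R) (a b B K : R) : 0 <= a <= b -> b < 1 -> sqnorm z < 1 ->
  (forall x, annulus a b x -> cmod (1 - herm (phi (to_cplx x)) z)^-1 <= B) ->
  cmod (1 - herm (phi 0) z)^-1 <= K -> K <= B ->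
  (\int[leb2]_(x in annulus a b) (disc_kernel z x)%:E <= (3 * B * K * (disc_area * (b - a)))%:E)%E.
Proof.
move=> /andP[a0 ab] b1 z1 FB F0 KB.
have b0 : 0 <= b by apply: le_trans ab.
pose F w : Cplx R := (1 - herm (phi w) z)^-1.
pose S w : Cplx R := cpt (2 * B) 0 * F w - F w * F w.
have dF w : unit_disc w -> differentiable F w.
  move=> w1; apply: differentiableV; last exact: ker_neq0.
  apply: differentiableB; first exact: differentiable_cst.
  by apply: differentiableD; apply: differentiableM;
    [exact: differentiable_phi1| exact: differentiable_cst|
     exact: differentiable_phi2| exact: differentiable_cst].
have dS w : unit_disc w -> differentiable S w.
  move=> w1; apply: differentiableB; last by apply: differentiableM; exact: dF.
  by apply: differentiableM; [exact: differentiable_cst|exact: dF].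
have sb1 : Num.sqrt b < 1 by rewrite -[X in _ < X]sqrtr1 ltr_sqrt.
have Er (x : Real2 R) : annulus a b x -> cmod (to_cplx x) <= Num.sqrt b.
  by move=> /andP[_ /ltW xb]; rewrite -[leLHS]ger0_norm// -sqrtr_sqr ler_wsqrtr.
have Ed : (annulus a b : set (Real2 R)) `<=` to_cplx @^-1` unit_disc.
  by move=> x /Er xb; exact: le_lt_trans sb1.
have mE : measurable (annulus a b : set (Real2 R)) by exact: measurable_annulus.
have KS (x : Real2 R) : annulus a b x -> disc_kernel z x <= cre (S (to_cplx x)).
  move=> xE; have x1 := Ed _ xE; have := FB _ xE; rewrite -/(F _).
  have -> : disc_kernel z x = cmod (F (to_cplx x)) ^+ 2 by rewrite /F cmodV exprVn.
  have : 0 < cre (F (to_cplx x)).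
    have hn := ker_neq0 x1 z1; have hp := Re_gt0 x1 z1.
    have : cre (1 - herm (phi (to_cplx x)) z) = cmod (1 - herm (phi (to_cplx x)) z) ^+ 2 * cre (F (to_cplx x)).
      have hF : (1 - herm (phi (to_cplx x)) z) * F (to_cplx x) = 1 by rewrite mulfV.
      move: hF; set h := 1 - _; set g := F _ => hF.
      have := congr1 cre hF; have := congr1 cim hF; rewrite creM cimM sqr_cmod.
      rewrite (_ : cre 1 = 1)// (_ : cim 1 = 0)// => e1 e2.
      have := congr1 ( *%R (cre h)) e2; have := congr1 ( *%R (cim h)) e1; lra.
    by move=> e; move: hp; rewrite {1}e pmulr_rgt0// exprn_gt0// cmod_gt0.
  have := Re_le_cmod (F (to_cplx x)).
  rewrite /S creD creN !creM Re_cpt Im_cpt !sqr_cmod.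
  move: (F (to_cplx x)) => g /ler_normlP[_ g1] g0 gB.
  rewrite mul0r subr0 opprB; have := ler_wpM2l (ltW g0) (le_trans g1 gB); lra.
have mS : measurable_fun (annulus a b) (fun x => cre (S (to_cplx x))).
  exact: measurable_funS measurable_unit_disc Ed (mcfun_differentiable dS).1.
have mk : measurable_fun (annulus a b) (disc_kernel z).
  exact: measurable_funS measurable_unit_disc Ed (measurable_disc_kernel z).
have lE : (leb2 (annulus a b : set (Real2 R)) < +oo)%E by rewrite leb2_annulus ?a0// ltry.
apply: (@le_trans _ _ (\int[leb2]_(x in annulus a b) (cre (S (to_cplx x)))%:E)%E).
  apply: ge0_le_integral => //.
  - by move=> x _; rewrite lee_fin disc_kernel_ge0.
  - exact/measurable_EFinP.
  - exact/measurable_EFinP.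
have S0 (x : Real2 R) : annulus a b x -> 0 <= cre (S (to_cplx x)).
  by move=> /KS; apply: le_trans; exact: disc_kernel_ge0.
apply: le_trans (@area_mean_le R S (Num.sqrt b) (annulus a b)
  (fun w wb => dS w (le_lt_trans wb sb1)) (@radial_annulus _ _ _) mE lE Er mS S0) _.
rewrite leb2_annulus ?a0// -EFinM lee_fin ler_wpM2r//.
  by rewrite mulr_ge0 ?subr_ge0// ltW// disc_area_gt0.
apply: le_trans (ler_norm _) (le_trans (Re_le_cmod _) (le_trans (cmodB _ _) _)).
rewrite !cmodM -/(F 0) in F0 *.
rewrite cmodE Re_cpt Im_cpt expr0n addr0 sqrtr_sqr ger0_norm; last first.
  by have := cmod_ge0 (F 0); lra.
by have := cmod_ge0 (F 0); nra.
Qed.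

(** The function (1 - |x|^2)^(-1/2) on the disc; the maximum only serves to make
it at least 1 off the disc as well. *)
Definition disc_weight (x : Real2 R) : R :=
  Num.max 1 ((1 - cmod (to_cplx x) ^+ 2) `^ (- 2^-1)).

Lemma disc_weight_ge1 x : 1 <= disc_weight x.
Proof. by rewrite le_max lexx. Qed.

Lemma disc_weight_ge0 x : 0 <= disc_weight x.
Proof. exact: le_trans ler01 (disc_weight_ge1 x). Qed.

Lemma measurable_disc_weight : measurable_fun setT disc_weight.
Proof.
apply: measurable_maxr; first exact: measurable_cst.
apply: (measurableT_comp (measurable_powR _)); apply: measurable_funB => //.
exact: measurable_sqr_cmod.
Qed.

Lemma sqr_disc_weight x : cmod (to_cplx x) ^+ 2 < 1 ->
  disc_weight x ^+ 2 = (1 - cmod (to_cplx x) ^+ 2)^-1.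
Proof.
set r := cmod _ ^+ 2 => r1; have r0 : 0 <= r by exact: sqr_ge0.
have y0 : 0 < 1 - r by rewrite subr_gt0.
have Y2 : ((1 - r) `^ (- 2^-1)) ^+ 2 = (1 - r)^-1.
  by rewrite -powR_mulrn ?powR_ge0// -powRrM mulNr mulVf// powR_inv1// ltW.
rewrite /disc_weight -/r max_r//.
rewrite -[leRHS]ger0_norm ?powR_ge0// -sqrtr_sqr Y2 -[leLHS]sqrtr1 ler_wsqrtr//.
by rewrite invf_ge1// gerBl.
Qed.

Let K : R := 2 / c.

Let K0 : 0 < K. Proof. by rewrite divr_gt0. Qed.

(** By Hopf's lemma |1 - <phi(w), phi(w')>| is at least a multiple of both 1 -
|w|^2 and 1 - |w'|^2. *)
Let inv_ker_le (w w' : Cplx R) : unit_disc w -> unit_disc w' ->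
  cmod (1 - herm (phi w) (phi w'))^-1 <= K * (1 - cmod w ^+ 2)^-1 /\
  cmod (1 - herm (phi w) (phi w'))^-1 <= K * (1 - cmod w' ^+ 2)^-1.
Proof.
move=> w1 w1'; rewrite !cmodV; have h := Re_gt0 w1 (phi_ball w1').
have := Re_one_sub_herm (phi w) (phi w').
have := le_trans (ler_norm _) (Re_le_cmod (1 - herm (phi w) (phi w'))).
have := phi_hopf w1; have := phi_hopf w1'.
have sq (v : Cplx R) : unit_disc v -> 0 < 1 - cmod v ^+ 2.
  by move=> v1; rewrite subr_gt0 expr_lt1.
have := sq _ w1; have := sq _ w1'; move: h.
move: (cre _) (cmod (1 - _)) (1 - cmod w ^+ 2) (1 - cmod w' ^+ 2) => r m x y.
move: (1 - sqnorm (phi w)) (1 - sqnorm (phi w')) => X Y r0 y0 x0 yY xX rm XY.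
have m0 : 0 < m by apply: lt_le_trans rm.
have E (v : R) : 0 < v -> K * v^-1 = (c * v / 2)^-1.
  by move=> v0; rewrite /K; field; rewrite !gt_eqF.
have cx := mulr_gt0 c0 x0; have cy := mulr_gt0 c0 y0.
by split; rewrite E// lef_pV2 ?posrE ?divr_gt0//; lra.
Qed.

Let C1 : R := 18 * K ^+ 2 * disc_area.

Let C10 : 0 < C1.
Proof. by rewrite mulr_gt0 ?disc_area_gt0// mulr_gt0// exprn_gt0. Qed.

(** For t = 2^k, the layer 4^-(k+1) < 1 - |x|^2 <= 4^-k of the disc. *)
Let layer t : set (Real2 R) := annulus (1 - (t ^+ 2)^-1) (1 - ((2 * t) ^+ 2)^-1).

(** On the layer the weight is at most 2 t, the area is proportional to t^-2 and
the kernel F of the previous estimate is bounded by a multiple of both s(w)^2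
and (2 t)^2. *)
Let layer_le (w : Real2 R) t : 1 <= t -> cmod (to_cplx w) ^+ 2 < 1 ->
  (\int[leb2]_(x in layer t) (disc_kernel (phi (to_cplx w)) x * disc_weight x)%:E <=
   (C1 * Num.min (disc_weight w ^+ 2 / t) t)%:E)%E.
Proof.
move=> t1 w1; have t0 : 0 < t by apply: lt_le_trans t1.
have wd : unit_disc (to_cplx w) by rewrite /unit_disc /= -(@expr_lt1 _ 2).
have s1 := disc_weight_ge1 w.
have ts : 1 <= t ^+ 2 by rewrite expr_ge1// ltW.
have ss : 1 <= disc_weight w ^+ 2 by rewrite expr_ge1// (le_trans _ s1).
pose a := 1 - (t ^+ 2)^-1; pose b := 1 - ((2 * t) ^+ 2)^-1.
have b1 : b < 1 by rewrite /b gtrBl invr_gt0 exprn_gt0// mulr_gt0.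
have a0 : 0 <= a by rewrite /a subr_ge0 invf_le1// (lt_le_trans _ ts).
have ba : b - a = 3 / 4 / t ^+ 2 by rewrite /b /a; field; rewrite gt_eqF.
have ab : a <= b.
  by rewrite -subr_ge0 ba !mulr_ge0// invr_ge0 sqr_ge0.
have ringd (x : Real2 R) : layer t x -> cmod (to_cplx x) ^+ 2 < 1 /\ unit_disc (to_cplx x).
  move=> /andP[_ xb]; have x1 := lt_trans xb b1; split => //.
  by rewrite /unit_disc /= -(@expr_lt1 _ 2).
have sq2 (x : Real2 R) : layer t x -> disc_weight x ^+ 2 <= (2 * t) ^+ 2.
  move=> xt; have [x1 xd] := ringd _ xt; rewrite sqr_disc_weight// -[leRHS]invrK lef_pV2 ?posrE.
  - by move: xt => /andP[_]; rewrite -/b /b; lra.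
  - by rewrite subr_gt0.
  - by rewrite invr_gt0 exprn_gt0// mulr_gt0.
have s2 (x : Real2 R) : layer t x -> disc_weight x <= 2 * t.
  have t20 : 0 <= 2 * t by rewrite mulr_ge0// ltW.
  by move=> /sq2; rewrite ler_sqr ?nnegrE ?disc_weight_ge0.
pose m := Num.min (disc_weight w ^+ 2) ((2 * t) ^+ 2).
have m1 : 1 <= m by rewrite le_min ss expr_ge1//; lra.
have rsub : layer t `<=` to_cplx @^-1` unit_disc by move=> x /ringd[].
have mr : measurable (layer t) by exact: measurable_annulus.
have mk : measurable_fun (layer t) (disc_kernel (phi (to_cplx w))).
  exact: measurable_funS measurable_unit_disc rsub (measurable_disc_kernel _).
have L := @layer_kernel_le (phi (to_cplx w)) a b (K * m) K.
have /L{L} : 0 <= a <= b by rewrite a0.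
move=> /(_ b1 (phi_ball wd)) L.
have {L} : (\int[leb2]_(x in layer t) (disc_kernel (phi (to_cplx w)) x)%:E <=
    (3 * (K * m) * K * (disc_area * (b - a)))%:E)%E.
  apply: L.
  - move=> x xt; have [x1 xd] := ringd _ xt.
    have [k1 k2] := inv_ker_le xd wd.
    rewrite minr_pMr ?(ltW K0)// le_min.
    apply/andP; split; first by rewrite sqr_disc_weight.
    apply: le_trans k1 _; rewrite ler_wpM2l ?(ltW K0)// -sqr_disc_weight//.
    exact: sq2.
  - have z1 : unit_disc (0 : Cplx R) by rewrite /unit_disc /= cmod0.
    have [k1 _] := inv_ker_le z1 wd; move: k1.
    by rewrite cmod0 expr0n subr0 invr1 mulr1.
  - by rewrite ler_peMr// ltW.
move=> L; apply: (@le_trans _ _ ((2 * t)%:E * \int[leb2]_(x in layer t) (disc_kernel (phi (to_cplx w)) x)%:E)%E).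
  have t20 : 0 <= 2 * t by rewrite mulr_ge0// ltW.
  rewrite -ge0_integralZl_EFin//; last 2 first.
  - by move=> x _; rewrite lee_fin disc_kernel_ge0.
  - exact/measurable_EFinP.
  apply: ge0_le_integral => //.
  - by move=> x _; rewrite lee_fin; exact: mulr_ge0 (disc_kernel_ge0 _ _) (disc_weight_ge0 _).
  - apply/measurable_EFinP; apply: measurable_funM => //.
    exact: measurable_funTS measurable_disc_weight.
  - by apply: measurable_funeM; exact/measurable_EFinP.
  by move=> x /s2 xs; rewrite -EFinM lee_fin mulrC ler_wpM2r// disc_kernel_ge0.
apply: le_trans (lee_wpmul2l _ L) _; first by rewrite lee_fin mulr_ge0// ltW.
rewrite -EFinM lee_fin ba.
have -> : 2 * t * (3 * (K * m) * K * (disc_area * (3 / 4 / t ^+ 2))) = C1 * (m / t / 4).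
  by rewrite /C1; field; rewrite gt_eqF.
rewrite ler_wpM2l ?(ltW C10)// le_min; apply/andP; split.
  apply: (@le_trans _ _ (m / t)).
    by rewrite ler_pdivrMr// ler_peMr ?divr_ge0 ?(le_trans _ m1) ?(ltW t0)// ler1n.
  by rewrite ler_wpM2r ?invr_ge0 ?(ltW t0)// ge_min lexx.
rewrite !ler_pdivrMr//; apply: (@le_trans _ _ ((2 * t) ^+ 2)).
  by rewrite ge_min lexx orbT.
by rewrite exprMn; lra.
Qed.

(** With s = s(w) the layers 2^k contribute min (s^2 / 2^k, 2^k) up to a
constant: the terms grow geometrically up to 2^k = s and then decay
geometrically, so their sum is at most 4 s. *)
Lemma disc_kernel_schur : exists2 C : R, 0 <= C & forall (w : Real2 R) n,
  cmod (to_cplx w) ^+ 2 < 1 ->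
  (\int[leb2]_(x in disc2 (1 - ((2 ^+ n) ^+ 2)^-1))
     (disc_kernel (phi (to_cplx w)) x * disc_weight x)%:E <= (C * disc_weight w)%:E)%E.
Proof.
exists (C1 * 4); first by rewrite (pmulr_rge0 _ C10).
move=> w n w1; set s := disc_weight w; have s1 : 1 <= s := disc_weight_ge1 w.
pose I m := (\int[leb2]_(x in disc2 (1 - ((2 ^+ m) ^+ 2)^-1))
     (disc_kernel (phi (to_cplx w)) x * disc_weight x)%:E)%E.
(* The two regimes of the partial sums; the second one has the tail
2 s^2 / 2^m to spare, which pays for the remaining terms. *)
have H m : (I m <= (C1 * 2 ^+ m)%:E)%E /\
    (s <= 2 ^+ m -> (I m <= (C1 * (4 * s - 2 * s ^+ 2 / 2 ^+ m))%:E)%E).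
  elim: m => [|m [IH1 IH2]].
    have -> : I 0%N = 0%E.
      rewrite /I (_ : disc2 _ = set0) ?integral_set0//.
      apply/seteqP; split => // x; rewrite /disc2 /= expr0 expr1n invr1 subrr.
      by rewrite ltNge sqr_ge0.
    rewrite expr0; split; rewrite lee_fin (pmulr_rge0 _ C10)// => s11.
    have -> : s = 1 by apply/eqP; rewrite eq_le s11 s1.
    by rewrite expr1n divr1; lra.
  have t1 : (1 : R) <= 2 ^+ m by rewrite exprn_ege1// ler1n.
  have := layer_le t1 w1; rewrite -/s.
  have -> : I m.+1 = (I m + \int[leb2]_(x in layer (2 ^+ m)) (disc_kernel (phi (to_cplx w)) x * disc_weight x)%:E)%E.
    rewrite /I.
    have t0 : 0 < 2 ^+ m :> R by rewrite exprn_gt0.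
    have t2 : 1 - ((2 ^+ m) ^+ 2)^-1 <= 1 - ((2 * 2 ^+ m) ^+ 2)^-1 :> R.
      rewrite lerD2l lerN2 lef_pV2 ?posrE ?exprn_gt0 ?mulr_gt0// exprMn ler_peMl ?sqr_ge0//.
      by rewrite exprn_ege1// ler1n.
    have -> : disc2 (1 - ((2 ^+ m.+1) ^+ 2)^-1) = disc2 (1 - ((2 ^+ m) ^+ 2)^-1) `|` layer (2 ^+ m) :> set (Real2 R).
      rewrite [2 ^+ m.+1]exprS /layer annulusE setDUK//.
      by move=> x /lt_le_trans; apply.
    have sd : (disc2 (1 - ((2 ^+ m) ^+ 2)^-1) `|` layer (2 ^+ m)) `<=` to_cplx @^-1` unit_disc.
      move=> x [xd|/andP[_ xd]]; rewrite /unit_disc /= -(@expr_lt1 _ 2)//; apply: lt_trans xd _.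
        by rewrite gtrBl invr_gt0 exprn_gt0.
      by rewrite gtrBl invr_gt0 exprn_gt0// mulr_gt0.
    rewrite ge0_integral_setU//.
    - exact: measurable_disc2.
    - exact: measurable_annulus.
    - apply/measurable_EFinP; apply: measurable_funM.
        exact: measurable_funS measurable_unit_disc sd (measurable_disc_kernel _).
      exact: measurable_funTS measurable_disc_weight.
    - by move=> x _; rewrite lee_fin; exact: mulr_ge0 (disc_kernel_ge0 _ _) (disc_weight_ge0 _).
    - rewrite /layer annulusE; apply/disj_setPS => x [xd [_ xn]]; exact: xn xd.
  have E2 : 2 ^+ m.+1 = 2 * 2 ^+ m :> R by rewrite exprS.
  move: IH1 IH2 t1; rewrite !E2; move: (I m) (2 ^+ m) => i t IH1 IH2 t1.
  move: (\int[_]_(_ in _) _)%E => j jt.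
  have t0 : 0 < t by apply: lt_le_trans t1.
  have jt1 : (j <= (C1 * t)%:E)%E.
    by apply: le_trans jt _; rewrite lee_fin ler_wpM2l ?(ltW C10)// ge_min lexx orbT.
  have jt2 : (j <= (C1 * (s ^+ 2 / t))%:E)%E.
    by apply: le_trans jt _; rewrite lee_fin ler_wpM2l ?(ltW C10)// ge_min lexx.
  have i2 : (i + j <= (C1 * (2 * t))%:E)%E.
    by apply: le_trans (leeD IH1 jt1) _; rewrite -EFinD lee_fin; lra.
  split => // s2t; have [st|st] := leP s t.
    apply: le_trans (leeD (IH2 st) jt2) _; rewrite -EFinD lee_fin -mulrDr ler_wpM2l ?(ltW C10)//.
    by rewrite le_eqVlt; apply/orP; left; apply/eqP; field; rewrite gt_eqF.
  apply: le_trans i2 _; rewrite lee_fin ler_wpM2l ?(ltW C10)//.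
  rewrite -subr_ge0; have -> : 4 * s - 2 * s ^+ 2 / (2 * t) - 2 * t = (4 * s * t - s ^+ 2 - 2 * t ^+ 2) / t.
    by field; rewrite gt_eqF.
  by rewrite divr_ge0 ?(ltW t0)//; nra.
have [H1 H2] := H n; rewrite -/(I n); have [sn|sn] := leP s (2 ^+ n).
  apply: le_trans (H2 sn) _; rewrite lee_fin -(mulrA C1 4) ler_wpM2l ?(ltW C10)//.
  by rewrite gerBl divr_ge0 ?exprn_ge0// mulr_ge0 ?sqr_ge0.
apply: le_trans H1 _; rewrite lee_fin -(mulrA C1 4) ler_wpM2l ?(ltW C10)//.
by apply: le_trans (ltW sn) _; lra.
Qed.

End layers.

(** * Averages over caps *)

Section sigma_finiteness.
Context {R : realType}.

Let leb4_sigma_finite : sigma_finite [set: Real4 R] leb4.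
Proof.
exists (fun n => disc2 n%:R `*` disc2 n%:R); last first.
  move=> n; split; first by apply: measurableX; exact: measurable_disc2.
  rewrite /leb4 product_measure1E; [|exact: measurable_disc2|exact: measurable_disc2].
  transitivity (leb2 (disc2 n%:R : set (Real2 R)) * leb2 (disc2 n%:R : set (Real2 R)) < +oo)%E; first by [].
  by rewrite !leb2_disc2// -EFinM ltry.
apply/seteqP; split => // x _; pose r := cmod (to_cplx x.1) ^+ 2 + cmod (to_cplx x.2) ^+ 2.
have rn : r < (Num.truncn r).+1%:R by exact: truncnS_gt.
exists (Num.truncn r).+1 => //; split; rewrite /disc2 /=; apply: le_lt_trans rn.
  by rewrite lerDl sqr_ge0.
by rewrite lerDr sqr_ge0.
Qed.

HB.instance Definition _ :=
  Measure_isSigmaFinite.Build _ _ _ (@leb4 R) leb4_sigma_finite.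

End sigma_finiteness.

Section cap_averages.
Context {R : realType}.
Variables (z : Cplx2 R) (a b : R).
Hypotheses (z0 : 0 < sqnorm z < 1) (ab : a < b) (b1 : b < 1).
Hypothesis za : (Num.sqrt (sqnorm z) + cap_size z) ^+ 2 <= a.

Let d0 : 0 < cap_size z. Proof. by apply: cap_size_gt0; case/andP: z0. Qed.

Let X : set (Real4 R) := shell a b.

Let mS : measurable (X `&` cap z (cap_size z)).
Proof. by apply: measurableI; [exact: measurable_shell|exact: measurable_cap]. Qed.

(** Up to the constant d^-2, integrating against the kernel is integrating over
the cap. *)
Let cap_kernel_integral (v : Real4 R -> R) :
  (\int[leb4]_(x in X) (cap_kernel z x * v x)%:E =
   \int[leb4]_(x in X `&` cap z (cap_size z)) ((cap_size z ^+ 2)^-1%:E * (v x)%:E))%E.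
Proof.
rewrite [RHS]integral_mkcondr; apply: eq_integral => x _; rewrite patchE /cap_kernel.
case: ifP => xc; case: ifPn => // xn.
- by move: xn; rewrite notin_setE /cap /= xc.
- by move: xn; rewrite inE /cap /= xc.
- by rewrite mul0r.
Qed.

Lemma cap_kernel_mass :
  (\int[leb4]_(x in shell a b) (cap_kernel z x)%:E = (disc_area ^+ 2 * (b - a))%:E)%E.
Proof.
have [z00 z1] := andP z0.
transitivity (\int[leb4]_(x in X) (cap_kernel z x * 1)%:E)%E.
  by apply: eq_integral => x _; rewrite mulr1.
rewrite cap_kernel_integral ge0_integralZl_EFin//; last first.
  by rewrite invr_ge0 sqr_ge0.
rewrite integral_cst// mul1e.
transitivity ((cap_size z ^+ 2)^-1%:E * leb4 (X `&` cap z (cap_size z)))%E; first by [].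
rewrite leb4_cap//; rewrite -EFinM; congr EFin; field.
by rewrite gt_eqF.
Qed.

Lemma cap_kernel_submean (f : Cplx2 R -> Cplx R) (q : R) :
  holomorphic_on unit_ball f -> 2^-1 <= q ->
  ((cmod (f z) `^ q * (disc_area ^+ 2 * (b - a)))%:E <=
   \int[leb4]_(x in shell a b) (cap_kernel z x * cmod (f (to_cplx2 x)) `^ q)%:E)%E.
Proof.
move=> hf q2; have [z00 z1] := andP z0.
rewrite (cap_kernel_integral (fun x => cmod (f (to_cplx2 x)) `^ q)).
have mu : measurable_fun (X `&` cap z (cap_size z)) (fun x => cmod (f (to_cplx2 x)) `^ q).
  have mball : measurable (to_cplx2 @^-1` unit_ball : set (Real4 R)).
    exact: measurable_copen2 (@copen2_ball R 1).
  apply: measurable_funS mball _ _.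
    by move=> x [/andP[_ xb] _]; rewrite /unit_ball /= sqnorm_to_cplx2 (lt_trans xb).
  apply: (measurable_ccont2 (@copen2_ball R 1) (f := fun y => cmod (f y) `^ q)).
  move=> y y1; apply: ccont_at2_comp_powR; last exact: hf.
  by apply: lt_le_trans q2; rewrite invr_gt0.
rewrite ge0_integralZl_EFin//; last 3 first.
- by move=> x _; rewrite lee_fin powR_ge0.
- exact/measurable_EFinP.
- by rewrite invr_ge0 sqr_ge0.
have := ball_submean z00 d0 ab b1 za hf q2.
rewrite -/X leb4_cap// => /(lee_wpmul2l (x := (cap_size z ^+ 2)^-1%:E)).
rewrite lee_fin invr_ge0 sqr_ge0 => /(_ isT); apply: le_trans.
rewrite -!EFinM lee_fin le_eqVlt; apply/orP; left; apply/eqP; field.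
by rewrite gt_eqF.
Qed.

End cap_averages.

(** * The area integral of f o phi *)

Section composition_estimate.
Context {R : realType}.
Variables (phi : Cplx R -> Cplx2 R) (f : Cplx2 R -> Cplx R) (p : R).
Hypothesis phi_ball : forall w, unit_disc w -> unit_ball (phi w).
Hypothesis phi_holo : holomorphic_on unit_disc phi.
Hypothesis hf : holomorphic_on unit_ball f.
Hypothesis p1 : 1 <= p.

Let q := p / 2.

Let q2 : 2^-1 <= q. Proof. by rewrite /q ler_pdivlMr// mulVf. Qed.

Let q0 : 0 < q. Proof. by apply: lt_le_trans q2; rewrite invr_gt0. Qed.

Let powR_half (t : R) : 0 <= t -> (t `^ q) ^+ 2 = t `^ p.
Proof. by move=> t0; rewrite -powR_mulrn ?powR_ge0// -powRrM divfK. Qed.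

Variables (C M t K : R).
Hypothesis K0 : 0 <= K.
Hypothesis overlapK : forall (y z : Cplx2 R) b (x : Real4 R), 0 < sqnorm y < 1 -> 0 < sqnorm z < 1 ->
  b < 1 -> shell ((Num.sqrt (sqnorm y) + cap_size y) ^+ 2) b x ->
  shell ((Num.sqrt (sqnorm z) + cap_size z) ^+ 2) b x ->
  cap_kernel y x * cap_kernel z x <=
  K * (cmod (1 - herm y z) ^+ 2)^-1 * (cap_kernel y x + cap_kernel z x).
Hypothesis C0 : 0 <= C.
(** The disc |x|^2 < 1 - t^-2 is relatively compact in the unit disc; all bounds have to be
independent of t. *)
Hypothesis schurC : forall w : Real2 R, cmod (to_cplx w) ^+ 2 < 1 ->
  (\int[leb2]_(x in disc2 (1 - (t ^+ 2)^-1))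
     (disc_kernel phi (phi (to_cplx w)) x * disc_weight x)%:E <= (C * disc_weight w)%:E)%E.
Hypothesis fM : (Hp_pow p f <= M%:E)%E.
Hypothesis t1 : 1 <= t.

Let D : set (Real2 R) := disc2 (1 - (t ^+ 2)^-1).

Let t0 : 0 < t. Proof. exact: lt_le_trans t1. Qed.

Let rho1 : 1 - (t ^+ 2)^-1 < 1.
Proof. by rewrite gtrBl invr_gt0 exprn_gt0. Qed.

Let D1 (x : Real2 R) : D x -> cmod (to_cplx x) ^+ 2 < 1.
Proof. by move=> xD; exact: lt_trans xD rho1. Qed.

Let Dd (x : Real2 R) : D x -> unit_disc (to_cplx x).
Proof. by move=> /D1; rewrite expr_lt1. Qed.

Let mD : measurable D. Proof. exact: measurable_disc2. Qed.

(** There is no cap at the origin, so zeros of phi are set aside. *)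
Let E : set (Real2 R) := D `&` [set x | 0 < sqnorm (phi (to_cplx x))].

Let E1 (x : Real2 R) : E x -> 0 < sqnorm (phi (to_cplx x)) < 1.
Proof. by move=> [/Dd/phi_ball xb x0]; apply/andP. Qed.

Let measurable_sqnorm_phi :
  measurable_fun (to_cplx @^-1` unit_disc : set (Real2 R)) (fun x => sqnorm (phi (to_cplx x))).
Proof.
apply: (measurable_ccont copen_unit_disc (f := fun w => sqnorm (phi w))).
by move=> w; exact: ccont_at_sqnorm_phi.
Qed.

Let mE : measurable E.
Proof.
have ms : measurable_fun D (fun x => sqnorm (phi (to_cplx x))).
  by apply: measurable_funS measurable_unit_disc _ measurable_sqnorm_phi => x /Dd.
exact: (measurable_fun_ltr (measurable_cst (0 : R)) ms mD (Y := [set true]) I).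
Qed.

Let g w := f (phi w).

Let dg w : unit_disc w -> differentiable g w.
Proof.
move=> w1; apply: (@differentiable_comp _ _ _ _ phi f); first exact: phi_holo.
by apply: hf; exact: phi_ball.
Qed.

Let h (r : R) (x : Real2 R) := cmod (g (to_cplx x)) `^ r.

Let mh r : 0 < r -> measurable_fun (to_cplx @^-1` unit_disc : set (Real2 R)) (h r).
Proof.
move=> r0; apply: (measurable_ccont copen_unit_disc (f := fun w => cmod (g w) `^ r)).
by move=> w w1; apply: ccont_at_powR => //; exact: dg.
Qed.

Let rho2 : Num.sqrt (1 - (t ^+ 2)^-1) < 1.
Proof. by rewrite -[X in _ < X]sqrtr1 ltr_sqrt. Qed.

Let D_sqrt (x : Real2 R) : D x -> cmod (to_cplx x) <= Num.sqrt (1 - (t ^+ 2)^-1).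
Proof. by move=> /ltW xD; rewrite -[leLHS]ger0_norm// -sqrtr_sqr ler_wsqrtr. Qed.

Let phi_max : exists2 m : R, 0 < m < 1 & forall x, D x -> sqnorm (phi (to_cplx x)) <= m.
Proof.
have [w w1 wm] : exists2 w : Cplx R, [set w | cmod w <= Num.sqrt (1 - (t ^+ 2)^-1)] w &
    forall w', [set w | cmod w <= Num.sqrt (1 - (t ^+ 2)^-1)] w' -> sqnorm (phi w') <= sqnorm (phi w).
  apply: (max_exists (f := fun w => sqnorm (phi w))); first exact: disc_closed_bounded.
  - by move=> w /= w2; apply: ccont_at_sqnorm_phi => //; exact: le_lt_trans rho2.
  - by exists 0; rewrite /= cmod0.
exists ((1 + sqnorm (phi w)) / 2); last first.
  move=> x /D_sqrt/wm; have : sqnorm (phi w) < 1 by apply: phi_ball; exact: le_lt_trans rho2.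
  by move=> /ltW; lra.
have : sqnorm (phi w) < 1 by apply: phi_ball; exact: le_lt_trans rho2.
by have := sqnorm_ge0 (phi w); move=> *; apply/andP; split; lra.
Qed.

Let h_bounded : exists2 B : R, 0 <= B & forall x, D x -> h p x <= B.
Proof.
have p0 : 0 < p by apply: lt_le_trans p1.
have [w w1 wm] : exists2 w : Cplx R, [set w | cmod w <= Num.sqrt (1 - (t ^+ 2)^-1)] w &
    forall w', [set w | cmod w <= Num.sqrt (1 - (t ^+ 2)^-1)] w' ->
      cmod (g w') `^ p <= cmod (g w) `^ p.
  apply: (max_exists (f := fun w => cmod (g w) `^ p)); first exact: disc_closed_bounded.
  - by move=> w /= w2; apply: ccont_at_powR => //; apply: dg; exact: le_lt_trans rho2.
  - by exists 0; rewrite /= cmod0.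
by exists (cmod (g w) `^ p); [exact: powR_ge0|move=> x /D_sqrt/wm].
Qed.

Let leb2_D : (leb2 D < +oo)%E.
Proof.
rewrite /D leb2_disc2 ?ltry// subr_ge0 invf_le1 ?exprn_gt0//.
by rewrite exprn_ege1.
Qed.

Let bounded_integral (A : set (Real2 R)) (v : Real2 R -> R) (B : R) :
  measurable A -> A `<=` D -> measurable_fun A v -> 
  (forall x, A x -> 0 <= v x <= B) -> (\int[leb2]_(x in A) (v x)%:E < +oo)%E.
Proof.
move=> mA AD mv vB; have [A0|/set0P[x0 Ax0]] := eqVneq A set0.
  by rewrite A0 integral_set0.
apply: (@le_lt_trans _ _ (\int[leb2]_(x in A) B%:E)%E).
  apply: ge0_le_integral => //.
  - by move=> x /vB/andP[? _]; rewrite lee_fin.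
  - exact/measurable_EFinP.
  - by move=> x /vB/andP[_]; rewrite lee_fin.
rewrite integral_cst//.
have B0 : 0 <= B by have /andP[] := vB _ Ax0; exact: le_trans.
apply: lte_mul_pinfty; rewrite ?lee_fin//.
by apply: le_lt_trans leb2_D; apply: le_measure; rewrite ?inE.
Qed.

Section fixed_shell.
Variables (a b m : R).
Hypotheses (m01 : 0 < m < 1) (phi_m : forall x, D x -> sqnorm (phi (to_cplx x)) <= m).
(** The inner radius of the shell is at least |z| + d = (1 + |z|) / 2 for all
z = phi(w) that occur. *)
Hypotheses (aE : a = ((1 + Num.sqrt m) / 2) ^+ 2) (ab : a < b) (b1 : b < 1).

Let X : set (Real4 R) := shell a b.

Let mX : measurable X. Proof. exact: measurable_shell. Qed.

Let sm1 : Num.sqrt m < 1.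
Proof. by case/andP: m01 => _ m1; rewrite -[X in _ < X]sqrtr1 ltr_sqrt. Qed.

Let capa x : D x -> (Num.sqrt (sqnorm (phi (to_cplx x))) + cap_size (phi (to_cplx x))) ^+ 2 <= a.
Proof.
move=> /phi_m; rewrite -(ler_sqrt (sqnorm (phi (to_cplx x)))); last by rewrite ltW//; case/andP: m01.
rewrite aE /cap_size => xm; have := sqrtr_ge0 (sqnorm (phi (to_cplx x))); have := sqrtr_ge0 m => m0 s0.
by rewrite ler_sqr ?nnegrE; lra.
Qed.

Let cap_size_ge x : D x -> (1 - Num.sqrt m) / 2 <= cap_size (phi (to_cplx x)).
Proof.
move=> /phi_m; rewrite -(ler_sqrt (sqnorm (phi (to_cplx x)))); last by rewrite ltW//; case/andP: m01.
by rewrite /cap_size; lra.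
Qed.

(** Extended by 0 so that Tonelli's theorem applies on the whole product. *)
Let Q : Real2 R * Real4 R -> R :=
  (fun wx => cap_kernel (phi (to_cplx wx.1)) wx.2) \_ (E `*` X).

Let QE w x : E w -> X x -> Q (w, x) = cap_kernel (phi (to_cplx w)) x.
Proof. by move=> wE xX; rewrite /Q patchE mem_set. Qed.

Let Q_out w x : ~ (E w /\ X x) -> Q (w, x) = 0.
Proof. by move=> n; rewrite /Q patchE memNset. Qed.

Let Q0 x : 0 <= Q x.
Proof. by rewrite /Q patchE; case: ifP => // _; exact: cap_kernel_ge0. Qed.

Let measurable_Q : measurable_fun setT Q.
Proof.
have mEX : measurable (E `*` X) by exact: measurableX.
apply/(measurable_restrictT _ mEX).
have Esub : E `<=` to_cplx @^-1` unit_disc by move=> x [/Dd].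
have mfst (v : Real2 R -> R) : measurable_fun (to_cplx @^-1` unit_disc : set (Real2 R)) v ->
    measurable_fun (E `*` X) (fun wx => v wx.1).
  move=> mv; apply: (@measurable_comp _ _ _ _ _ _ (to_cplx @^-1` unit_disc : set (Real2 R)) v _ fst).
  - exact: measurable_unit_disc.
  - by move=> _ [[w x] [wE _] <-]; exact: Esub.
  - exact: mv.
  - exact: measurable_funTS measurable_fst.
have [[m1r m1i] [m2r m2i]] := mcfun_phi phi_holo.
have ms := mfst _ measurable_sqnorm_phi.
have md : measurable_fun (E `*` X) (fun wx => cap_size (phi (to_cplx wx.1)) ^+ 2).
  apply: measurable_funX; apply: measurable_funM => //; apply: measurable_funB => //.
  apply: (@eq_measurable_fun _ _ _ _ _ (fun wx => sqnorm (phi (to_cplx wx.1)) `^ 2^-1)).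
    by move=> x _; rewrite powR12_sqrt// sqnorm_ge0.
  exact: (measurableT_comp (measurable_powR _) ms).
apply: measurable_fun_if => //.
- apply: measurable_fun_ltr; last exact: measurable_funM.
  apply: measurable_sqr_cmod_comp; apply: mcfunD; last first.
    by apply: mcfunN; exact: mcfun_real.
  have msnd : measurable_fun (E `*` X) (fun wx : Real2 R * Real4 R => wx.2).
    exact: measurable_funTS measurable_snd.
  have H : mcfun (E `*` X) (fun wx : Real2 R * Real4 R => herm (to_cplx wx.2.1, to_cplx wx.2.2)
      ((phi (to_cplx wx.1)).1, (phi (to_cplx wx.1)).2)).
    apply: mcfun_herm.
    - by apply: mcfun_to_cplx; exact: (measurableT_comp measurable_fst msnd).
    - by apply: mcfun_to_cplx; exact: (measurableT_comp measurable_snd msnd).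
    - by split; [exact: (mfst _ m1r)|exact: (mfst _ m1i)].
    - by split; [exact: (mfst _ m2r)|exact: (mfst _ m2i)].
  exact: H.
- apply: measurable_funS mEX _ _ => //; apply: measurable_invR => // x; exact: sqr_ge0.
Qed.

Let c := disc_area ^+ 2 * (b - a).

Let c0 : 0 < c. Proof. by rewrite mulr_gt0 ?subr_gt0// exprn_gt0// disc_area_gt0. Qed.

Let Q_integral w (v : Real4 R -> R) : E w ->
  (\int[leb4]_x (Q (w, x) * v x)%:E =
   \int[leb4]_(x in X) (cap_kernel (phi (to_cplx w)) x * v x)%:E)%E.
Proof.
move=> wE; rewrite [RHS]integral_mkcond; apply: eq_integral => x _; rewrite patchE.
case: ifPn => [/set_mem xX|xX]; first by rewrite QE.
by rewrite Q_out ?mul0r// => -[_ /mem_set]; exact/negP.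
Qed.

Let Q_integral_out w (v : Real4 R -> R) : ~ E w -> (\int[leb4]_x (Q (w, x) * v x)%:E = 0)%E.
Proof. by move=> wE; rewrite integral0_eq// => x _; rewrite Q_out ?mul0r// => -[]. Qed.

Let A := h q \_ E.

Let u := (fun x => cmod (f (to_cplx2 x)) `^ q) \_ X.

Let Q_submean w : ((A w * c)%:E <= \int[leb4]_x (Q (w, x) * u x)%:E)%E.
Proof.
have [wE|wE] := pselect (E w); last first.
  by rewrite Q_integral_out// /A patchE memNset// mul0r.
rewrite Q_integral// /A patchE mem_set//.
have -> : (\int[leb4]_(x in X) (cap_kernel (phi (to_cplx w)) x * u x)%:E =
    \int[leb4]_(x in X) (cap_kernel (phi (to_cplx w)) x * cmod (f (to_cplx2 x)) `^ q)%:E)%E.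
  by apply: eq_integral => x xX; rewrite /u patchE xX.
exact: cap_kernel_submean (E1 wE) ab b1 (capa wE.1) _ _ hf q2.
Qed.

Let Q_mass w : (\int[leb4]_x (Q (w, x))%:E <= c%:E)%E.
Proof.
have -> : (\int[leb4]_x (Q (w, x))%:E = \int[leb4]_x (Q (w, x) * 1)%:E)%E.
  by apply: eq_integral => x _; rewrite mulr1.
have [wE|wE] := pselect (E w); last by rewrite Q_integral_out// lee_fin ltW.
rewrite Q_integral//; have := cap_kernel_mass (E1 wE) ab (capa wE.1).
by under eq_integral do rewrite -[cap_kernel _ _]mulr1; move=> ->.
Qed.

Let measurable_cap_kernel w : E w -> measurable_fun X (cap_kernel (phi (to_cplx w))).
Proof.
move=> wE; apply: (@eq_measurable_fun _ _ _ _ _ (fun x => Q (w, x))).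
  by move=> x /set_mem xX; rewrite QE.
by apply: measurable_funTS; exact: measurable_fun_pair2.
Qed.

(** Two caps meet only at distance comparable to their sizes, so the overlap of
the kernels is controlled by |1 - <phi(w'), phi(w)>|^-2. *)
Let Q_overlap w w' : E w -> E w' ->
  (\int[leb4]_x (Q (w, x) * Q (w', x))%:E <=
   (2 * K * c * disc_kernel phi (phi (to_cplx w)) w')%:E)%E.
Proof.
move=> wE wE'; rewrite Q_integral//.
set z := phi (to_cplx w); set z' := phi (to_cplx w').
pose k := disc_kernel phi z w'.
have k0 : 0 <= k by exact: disc_kernel_ge0.
have mz : measurable_fun X (cap_kernel z) by exact: measurable_cap_kernel.
have mz' : measurable_fun X (cap_kernel z') by exact: measurable_cap_kernel.
apply: (@le_trans _ _ (\int[leb4]_(x in X) ((K * k)%:E * ((cap_kernel z' x)%:E + (cap_kernel z x)%:E)))%E).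
  apply: ge0_le_integral => //.
  - by move=> x _; rewrite lee_fin mulr_ge0// cap_kernel_ge0.
  - by apply/measurable_EFinP; apply: measurable_funM => //; apply: measurable_funTS; exact: measurable_fun_pair2.
  - by apply: measurable_funeM; apply: emeasurable_funD; exact/measurable_EFinP.
  move=> x xX; rewrite QE// mulrC -EFinD -EFinM lee_fin.
  have sub y : E y -> shell ((Num.sqrt (sqnorm (phi (to_cplx y))) + cap_size (phi (to_cplx y))) ^+ 2) b x.
    by move=> [yD _]; move: xX; rewrite /X /shell /= => /andP[ax ->]; rewrite (le_trans (capa yD)).
  exact: (@overlapK z' z b x (E1 wE') (E1 wE) b1 (sub _ wE') (sub _ wE)).
rewrite ge0_integralZl_EFin//; last 3 first.
- by move=> x _; rewrite -EFinD lee_fin addr_ge0// cap_kernel_ge0.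
- by apply: emeasurable_funD; exact/measurable_EFinP.
- by rewrite mulr_ge0.
rewrite ge0_integralD//; last 4 first.
- by move=> x _; rewrite lee_fin cap_kernel_ge0.
- exact/measurable_EFinP.
- by move=> x _; rewrite lee_fin cap_kernel_ge0.
- exact/measurable_EFinP.
have M1 := cap_kernel_mass (E1 wE) ab (capa wE.1).
have M2 := cap_kernel_mass (E1 wE') ab (capa wE'.1).
rewrite /X M1 M2 -EFinD -EFinM lee_fin -/c le_eqVlt; apply/orP; left; apply/eqP.
by rewrite /k; ring.
Qed.

Let Q_schur w :
  (\int[leb2]_w' \int[leb4]_x (Q (w, x) * Q (w', x) * disc_weight w')%:E <=
   (2 * K * C * c * disc_weight w)%:E)%E.
Proof.
have s0 (x : Real2 R) : 0 <= disc_weight x by rewrite (le_trans _ (disc_weight_ge1 x)).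
have inner w' : (\int[leb4]_x (Q (w, x) * Q (w', x) * disc_weight w')%:E =
    (disc_weight w')%:E * \int[leb4]_x (Q (w, x) * Q (w', x))%:E)%E.
  rewrite -ge0_integralZl_EFin//.
  - by apply: eq_integral => x _; rewrite -EFinM mulrC.
  - by move=> x _; rewrite lee_fin mulr_ge0.
  - by apply/measurable_EFinP; apply: measurable_funM; exact: measurable_fun_pair2.
have [wE|wE] := pselect (E w); last first.
  apply: (@le_trans _ _ 0%E).
    rewrite le_eqVlt; apply/orP; left; apply/eqP.
    by apply: integral0_eq => w' _; rewrite inner Q_integral_out// mule0.
  by rewrite lee_fin; apply: mulr_ge0 => //; apply: mulr_ge0 (ltW c0); apply: mulr_ge0 => //; exact: mulr_ge0.
pose k x := disc_kernel phi (phi (to_cplx w)) x * disc_weight x.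
have mk : measurable_fun D (fun x => (k x)%:E).
  apply/measurable_EFinP; apply: measurable_funM.
    by apply: measurable_funS measurable_unit_disc _ (measurable_disc_kernel phi_holo _) => x /Dd.
  exact: measurable_funTS measurable_disc_weight.
have k0 x : 0 <= k x by rewrite mulr_ge0// disc_kernel_ge0.
have c570 : 0 <= 2 * K * c by apply: mulr_ge0 (ltW c0); exact: mulr_ge0.
apply: (@le_trans _ _ (\int[leb2]_(x in D) ((2 * K * c)%:E * (k x)%:E))%E); last first.
  rewrite ge0_integralZl_EFin//; last by move=> x _; rewrite lee_fin.
  have := schurC (D1 wE.1) => /(lee_wpmul2l (x := (2 * K * c)%:E)); rewrite lee_fin => /(_ c570).
  move=> /le_trans; apply; rewrite -EFinM lee_fin le_eqVlt; apply/orP; left; apply/eqP.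
  by rewrite /c; ring.
rewrite [leRHS]integral_mkcond; apply: ge0_le_integral => //.
- by move=> x _; apply: integral_ge0 => y _; rewrite lee_fin !mulr_ge0.
- have mF : measurable_fun setT (fun z : Real2 R * Real4 R => (Q (w, z.2) * Q z * disc_weight z.1)%:E).
    apply/measurable_EFinP; apply: measurable_funM.
      apply: measurable_funM => //.
      exact: (measurableT_comp (measurable_fun_pair2 w measurable_Q) measurable_snd).
    exact: (measurableT_comp measurable_disc_weight measurable_fst).
  have F0 z : (0 <= (Q (w, z.2) * Q z * disc_weight z.1)%:E)%E by rewrite lee_fin !mulr_ge0.
  exact: (@measurable_fun_fubini_tonelli_F _ _ _ _ _ leb4 _ mF F0).
- by apply/(measurable_restrictT _ mD); exact: measurable_funeM.
move=> w' _; rewrite inner patchE; have [wE'|wE'] := pselect (E w'); last first.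
  under eq_integral do rewrite mulrC.
  rewrite Q_integral_out// mule0; case: ifP => // _.
  by rewrite -EFinM lee_fin mulr_ge0.
rewrite mem_set; last by case: wE'.
apply: le_trans (lee_wpmul2l _ (Q_overlap wE wE')) _; first by rewrite lee_fin.
by rewrite -!EFinM lee_fin le_eqVlt; apply/orP; left; apply/eqP; rewrite /k; ring.
Qed.

Let measurable_A : measurable_fun setT A.
Proof.
apply/(measurable_restrictT _ mE).
by apply: measurable_funS measurable_unit_disc _ (mh q0) => x [/Dd].
Qed.

Let measurable_u : measurable_fun setT u.
Proof.
apply/(measurable_restrictT _ mX).
have mball : measurable (to_cplx2 @^-1` unit_ball : set (Real4 R)).
  exact: measurable_copen2 (@copen2_ball R 1).
apply: measurable_funS mball _ _.
  by move=> x /andP[_ xb]; rewrite /unit_ball /= sqnorm_to_cplx2 (lt_trans xb).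
apply: (measurable_ccont2 (@copen2_ball R 1) (f := fun y => cmod (f y) `^ q)).
by move=> y y1; apply: ccont_at2_comp_powR => //; exact: hf.
Qed.

Let A0 w : 0 <= A w.
Proof. by rewrite /A patchE; case: ifP => // _; exact: powR_ge0. Qed.

Let u0 x : 0 <= u x.
Proof. by rewrite /u patchE; case: ifP => // _; exact: powR_ge0. Qed.

Let A_sqr : (\int[leb2]_w (A w ^+ 2)%:E = \int[leb2]_(w in E) (h p w)%:E)%E.
Proof.
rewrite [RHS]integral_mkcond; apply: eq_integral => w _; rewrite /A !patchE.
by case: ifP => _; rewrite ?expr0n// powR_half.
Qed.

Let u_sqr : (\int[leb4]_x (u x ^+ 2)%:E = \int[leb4]_(x in X) (cmod (f (to_cplx2 x)) `^ p)%:E)%E.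
Proof.
rewrite [RHS]integral_mkcond; apply: eq_integral => x _; rewrite /u !patchE.
by case: ifP => _; rewrite ?expr0n// powR_half.
Qed.

Let ED : E `<=` D. Proof. by move=> x []. Qed.

Let A_sqr_fin : (\int[leb2]_w (A w ^+ 2)%:E < +oo)%E.
Proof.
rewrite A_sqr; have [B B0 hB] := h_bounded.
apply: (@bounded_integral E (h p) B) => //.
- apply: measurable_funS measurable_unit_disc _ (mh (lt_le_trans ltr01 p1)).
  by move=> x [/Dd].
- by move=> x [/hB -> _]; rewrite powR_ge0.
Qed.

Let Q_weight_fin x : (\int[leb2]_w (Q (w, x) * disc_weight w)%:E < +oo)%E.
Proof.
pose e := (1 - Num.sqrt m) / 2.
have e0 : 0 < e by rewrite divr_gt0// subr_gt0.
have mF : measurable_fun setT (fun w => Q (w, x) * disc_weight w).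
  by apply: measurable_funM; [exact: measurable_fun_pair1|exact: measurable_disc_weight].
have s0 w : 0 <= disc_weight w :> R by rewrite (le_trans _ (disc_weight_ge1 w)).
have -> : (\int[leb2]_w (Q (w, x) * disc_weight w)%:E =
    \int[leb2]_(w in E) (Q (w, x) * disc_weight w)%:E)%E.
  rewrite [RHS]integral_mkcond; apply: eq_integral => w _; rewrite patchE.
  by case: ifPn => // /negP wE; rewrite Q_out ?mul0r// => -[/mem_set].
apply: (@bounded_integral E _ ((e ^+ 2)^-1 * t ^+ 2)) => //; first exact: measurable_funTS.
move=> w wE; rewrite mulr_ge0//=; apply: ler_pM => //.
  rewrite /Q patchE; case: ifP => [_|_]; last by rewrite invr_ge0 sqr_ge0.
  rewrite /cap_kernel; case: ifP => _; last by rewrite invr_ge0 sqr_ge0.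
  have ce := cap_size_ge wE.1; have c1 := lt_le_trans e0 ce.
  by rewrite lef_pV2 ?posrE ?exprn_gt0// ler_sqr ?nnegrE ?(ltW e0) ?(ltW c1).
have s1 := disc_weight_ge1 w.
apply: (@le_trans _ _ (disc_weight w ^+ 2)); first by rewrite expr2 ler_peMr.
rewrite sqr_disc_weight; last exact: D1 wE.1.
rewrite -[leRHS]invrK lef_pV2 ?posrE ?invr_gt0 ?exprn_gt0// ?subr_gt0; last exact: D1 wE.1.
by have := wE.1; rewrite /D /disc2 /=; lra.
Qed.

(** Schur's test bounds (b - a) times the integral by a multiple of the integral
of |f|^p over the shell, which is itself O(b - a): the thickness of the shell
cancels. *)
Lemma away_from_zeros_le :
  (\int[leb2]_(w in E) (h p w)%:E <= ((2 * K * C + 1) * M / (2 * disc_area ^+ 2))%:E)%E.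
Proof.
have k0 : 0 <= 2 * K * C by apply: mulr_ge0 => //; exact: mulr_ge0.
have := @schur_test _ _ _ _ R leb2 leb4 Q (@disc_weight R) A u (2 * K * C) c measurable_Q
  (@measurable_disc_weight R) measurable_A measurable_u Q0 (@disc_weight_ge1 R) A0 u0 k0 (ltW c0)
  Q_submean Q_mass Q_schur Q_weight_fin A_sqr_fin.
rewrite u_sqr A_sqr.
have a0 : 0 < a by rewrite aE exprn_gt0// divr_gt0// ltr_pwDl// sqrtr_ge0.
have p2 : 2^-1 <= p by apply: le_trans p1; rewrite invf_le1// ler1n.
have := shell_bound hf p2 fM a0 ab b1; rewrite -/X => uM H.
have M0 : 0 <= (b ^+ 2 - a ^+ 2) * (M / 4).
  rewrite -lee_fin; apply: le_trans uM; apply: integral_ge0 => x _.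
  by rewrite lee_fin powR_ge0.
have ba : 0 < b - a by rewrite subr_gt0.
have M4 : 0 <= M.
  move: M0; rewrite subr_sqr -mulrA pmulr_rge0// pmulr_rge0; last by rewrite addr_gt0// (lt_trans a0).
  by rewrite pmulr_lge0// invr_gt0.
have k1 : 0 <= 2 * K * C + 1 by rewrite addr_ge0.
have {H} := le_trans H (lee_wpmul2l (x := (2 * K * C + 1)%:E) k1 uM).
have I0 : (0 <= \int[leb2]_(w in E) (h p w)%:E)%E.
  by apply: integral_ge0 => w _; rewrite lee_fin powR_ge0.
move: I0; case: (\int[leb2]_(w in E) _)%E => [r||]; rewrite ?leey//; last first.
  by rewrite gt0_muley ?lte_fin// -EFinM leye_eq.
rewrite -!EFinM !lee_fin => r0 H.
have al0 : 0 < disc_area ^+ 2 :> R by rewrite exprn_gt0// disc_area_gt0.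
rewrite ler_pdivlMr; last by rewrite mulr_gt0.
rewrite -(ler_pM2r ba); apply: (@le_trans _ _ (2 * (c * r))).
  by rewrite /c le_eqVlt; apply/orP; left; apply/eqP; ring.
apply: (@le_trans _ _ (2 * ((2 * K * C + 1) * ((b ^+ 2 - a ^+ 2) * (M / 4))))).
  by rewrite ler_wpM2l.
have -> : 2 * ((2 * K * C + 1) * ((b ^+ 2 - a ^+ 2) * (M / 4))) =
    (2 * K * C + 1) * M * (b - a) * ((b + a) / 2) by field.
rewrite ler_piMr//; first by rewrite mulr_ge0 ?(ltW ba)// mulr_ge0.
rewrite ler_pdivrMr// mul1r -[leRHS]addr0 -subr_ge0.
have -> : 2 + 0 - (b + a) = (1 - b) + ((b - a) + (1 - b)) by ring.
have b10 : 0 <= 1 - b by rewrite subr_ge0 ltW.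
exact: addr_ge0 b10 (addr_ge0 (ltW ba) b10).
Qed.

End fixed_shell.

(** On the zero set of phi the function f o phi is the constant f 0. The
parameters of the shell are chosen here, depending on t, but do not enter the
bound. *)
Lemma disc_integral_le :
  (\int[leb2]_(w in D) (h p w)%:E <=
   ((2 * K * C + 1) * M / (2 * disc_area ^+ 2) + cmod (f 0) `^ p * disc_area)%:E)%E.
Proof.
have p0 : 0 < p by apply: lt_le_trans p1.
have [m m01 phi_m] := phi_max.
have m1 : Num.sqrt m < 1.
  by case/andP: m01 => _ m1; rewrite -[X in _ < X]sqrtr1 ltr_sqrt.
pose a := ((1 + Num.sqrt m) / 2) ^+ 2.
have a1 : a < 1.
  have hm : 0 <= (1 + Num.sqrt m) / 2 by rewrite divr_ge0// addr_ge0// sqrtr_ge0.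
  by rewrite /a expr_lt1//; lra.
have ab : a < (a + 1) / 2 by lra.
have b1 : (a + 1) / 2 < 1 by lra.
have H1 := away_from_zeros_le m01 phi_m erefl ab b1.
have mhD : measurable_fun D (h p) by apply: measurable_funS measurable_unit_disc _ (mh p0) => x /Dd.
have -> : D = E `|` (D `\` E) by rewrite setDUK// => x [].
rewrite ge0_integral_setU//; last 4 first.
- exact: measurableD.
- by rewrite setDUK; [exact/measurable_EFinP|move=> x []].
- by move=> x _; rewrite lee_fin powR_ge0.
- by apply/disj_setPS => x [xE [_]].
rewrite EFinD; apply: leeD => //.
have hE (x : Real2 R) : (D `\` E) x -> h p x = cmod (f 0) `^ p.
  move=> [xD xE]; rewrite /h /g; congr (cmod (f _) `^ _).
  have : ~~ (0 < sqnorm (phi (to_cplx x))) by apply/negP => x0; apply: xE.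
  rewrite -leNgt /sqnorm => H.
  have := sqr_ge0 (cmod (phi (to_cplx x)).1); have := sqr_ge0 (cmod (phi (to_cplx x)).2) => h2 h1.
  have e1 : cmod (phi (to_cplx x)).1 == 0 by rewrite -sqrf_eq0 eq_le; apply/andP; split; lra.
  have e2 : cmod (phi (to_cplx x)).2 == 0 by rewrite -sqrf_eq0 eq_le; apply/andP; split; lra.
  move: e1 e2; rewrite !cmod_eq0; case: (phi _) => u v /= /eqP -> /eqP ->; done.
rewrite (eq_integral (fun=> (cmod (f 0) `^ p)%:E)); last by move=> x /set_mem /hE ->.
rewrite integral_cst; last exact: measurableD.
apply: (@le_trans _ _ ((cmod (f 0) `^ p)%:E * leb2 (D : set (Real2 R)))%E).
  apply: lee_wpmul2l; first by rewrite lee_fin powR_ge0.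
  by apply: le_measure; rewrite ?inE//; exact: measurableD.
have tt : 0 <= 1 - (t ^+ 2)^-1 by rewrite subr_ge0 invf_le1 ?exprn_gt0// exprn_ege1.
rewrite /D leb2_disc2// -EFinM lee_fin ler_wpM2l ?powR_ge0// ler_piMr ?(ltW rho1)//.
by rewrite ltW// disc_area_gt0.
Qed.

End composition_estimate.

(** * Composition with holomorphic discs *)

Section composition.
Context {R : realType}.
Variables (phi : Cplx R -> Cplx2 R) (p : R).
Hypothesis phi_ball : forall w, unit_disc w -> unit_ball (phi w).
Hypothesis phi_holo : holomorphic_on unit_disc phi.
Hypothesis p1 : 1 <= p.

Let F (n : nat) : set (Real2 R) := disc2 (1 - ((2 ^+ n) ^+ 2)^-1).

Let F_le n k : (n <= k)%N -> F n `<=` F k.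
Proof.
move=> nk x; rewrite /F /disc2 /= => /lt_le_trans; apply.
by rewrite lerD2l lerN2 lef_pV2 ?posrE ?exprn_gt0// ler_sqr ?nnegrE ?exprn_ge0// ler_eXn2l// ltr1n.
Qed.

Let F_cover : \bigcup_n F n = to_cplx @^-1` unit_disc.
Proof.
apply/seteqP; split => x.
  move=> [n _]; rewrite /F /disc2 /= => xn; rewrite /unit_disc /= -(@expr_lt1 _ 2)//.
  by apply: lt_trans xn _; rewrite gtrBl invr_gt0 exprn_gt0// exprn_gt0.
rewrite /unit_disc /= -(@expr_lt1 _ 2)// -subr_gt0 => x1.
set y := 1 - _ in x1; pose n := (Num.truncn y^-1).+1.
exists n => //; rewrite /F /disc2 /=.
have yn : y^-1 < (2 ^+ n) ^+ 2.
  apply: (@lt_le_trans _ _ n%:R); first exact: truncnS_gt.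
  apply: (@le_trans _ _ (2 ^+ n)); first by rewrite -natrX ler_nat ltnW// ltn_expl.
  by rewrite expr2 ler_peMr ?exprn_ge0// exprn_ege1// ler1n.
have : ((2 ^+ n) ^+ 2)^-1 < y.
  by rewrite -[ltRHS]invrK ltf_pV2 ?posrE ?invr_gt0// exprn_gt0// exprn_gt0.
by rewrite /y; lra.
Qed.

(** The bounds over the discs |x|^2 < 1 - 4^-n do not depend on n, so monotone
convergence gives the area integral over the unit disc. *)
Lemma composition_Ap (f : Cplx2 R -> Cplx R) : Hp p f -> Ap p (f \o phi).
Proof.
move=> [hf fp]; have p0 : 0 < p by apply: lt_le_trans p1.
have dg w : unit_disc w -> differentiable (f \o phi) w.
  move=> w1; apply: differentiable_comp; first exact: phi_holo.
  by apply: hf; exact: phi_ball.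
split; first exact: dg.
have [M fM] : exists M : R, (Hp_pow p f <= M%:E)%E.
  by move: fp; case: (Hp_pow p f) => [r||] // _; [exists r|exists 0; rewrite leNye].
have [c c0 hopfc] := hopf phi_ball phi_holo.
have [C C0 schurC] := disc_kernel_schur phi_ball phi_holo c0 hopfc.
have [K K0 overlapK] := @cap_kernel_overlap R.
pose L := (2 * K * C + 1) * M / (2 * disc_area ^+ 2) + cmod (f 0) `^ p * disc_area.
have mh : measurable_fun (to_cplx @^-1` unit_disc : set (Real2 R))
    (fun x => (cmod ((f \o phi) (to_cplx x)) `^ p)%:E).
  apply/measurable_EFinP.
  apply: (measurable_ccont copen_unit_disc (f := fun w => cmod ((f \o phi) w) `^ p)).
  by move=> w w1; apply: ccont_at_powR => //; exact: dg.
have FL n : (\int[leb2]_(x in F n) (cmod ((f \o phi) (to_cplx x)) `^ p)%:E <= L%:E)%E.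
  have t1 : 1 <= 2 ^+ n :> R by rewrite exprn_ege1// ler1n.
  exact: (disc_integral_le phi_ball phi_holo hf p1 K0 overlapK C0 (fun w w1 => schurC w n w1) fM t1).
apply: (@le_lt_trans _ _ L%:E); last exact: ltry.
rewrite -F_cover; have cv := @ge0_nondecreasing_set_cvg_integral _ _ R F
  (fun x => (cmod ((f \o phi) (to_cplx x)) `^ p)%:E) leb2.
rewrite -(cvg_lim _ (cv _ _ _ _))//.
- apply: lime_le; last by apply: nearW => n; exact: FL.
  apply/cvg_ex; eexists; apply: cv.
  + by move=> n k nk; apply/subsetPset; exact: F_le.
  + by move=> n; exact: measurable_disc2.
  + move=> n; apply: measurable_funS measurable_unit_disc _ mh.
    by rewrite -F_cover; exact: bigcup_sup.
  + by move=> n x _; rewrite lee_fin powR_ge0.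
- by move=> n k nk; apply/subsetPset; exact: F_le.
- by move=> n; exact: measurable_disc2.
- move=> n; apply: measurable_funS measurable_unit_disc _ mh.
  by rewrite -F_cover; exact: bigcup_sup.
- by move=> n x _; rewrite lee_fin powR_ge0.
Qed.

End composition.

Theorem proposition5p1 (R : realType) (p : R) (hp : 1 <= p)
    (a : nat -> Cplx2 R) (ha : forall k, unit_ball (a k))
    (hS : interpolating_Hp p a)
    (alpha : nat -> Cplx R) (phi : Cplx R -> Cplx2 R)
    (hdisc : disc_through a alpha phi) :
  interpolating_Ap p a alpha.
Proof.
move=> l lp; have [C] := hS; move=> /(_ l lp)[f [fp fa _]].
have [_ phi_ball phi_holo phia] := hdisc.
exists (f \o phi); split; first exact: composition_Ap.
by move=> k /=; rewrite phia.
Qed.
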